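(* Let $A=\mathcal V[x_1,\dots,x_d]/(f_1,\dots,f_s)$ be a smooth $\mathcal V$-algebra lifting $A_0$, $X=\operatorname{Spec}A_0$, and let $(M,\phi_M)\in F^a\text{-}\mathrm{Modlib}(A^\dagger)$ be a free overconvergent $F$-module. Assume that $\mathcal V$ contains a root $\pi^*$ of $(\pi^* )^{p-1}=-p$. Let $(M_0,\phi_0)$ be a lift of $(M,\phi_M)$ to a free overconvergent $F$-module on $\mathbb A^d_{\mathbb F_q}$, let $pr:\mathbb A^{d+s}_{\mathbb F_q}\to\mathbb A^d_{\mathbb F_q}$ be the projection, and let $f^*(\mathcal L_\psi)$ be the pullback of the Dwork $F$-crystal by $f=\sum_{i=1}^s y_i\overline{f_i}(\underline x):\mathbb A^{d+s}_{\mathbb F_q}\to\mathbb A^1_{\mathbb F_q}$ (all defined in the context). Then $$L(X,M,t)=L\Bigl(\mathbb A^{d+s}_{\mathbb F_q},\ pr^*(M_0)\otimes f^*(\mathcal L_\psi),\ \tfrac1{q^s}\,t\Bigr).$$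
   Context: $k=\mathbb F_q$, $q=p^a$; $\mathcal V$ is a complete discrete valuation ring with residue field $k$, uniformizer $\pi$, fraction field $K$ of characteristic $0$; $\sigma$ is an automorphism of $\mathcal V$ lifting the $q$-power map of $k$ with $\sigma(\pi)=\pi$. For a smooth $\mathcal V$-algebra $B$ with $B_0=B/\pi B$, $B^\dagger$ is the weak completion (Monsky–Washnitzer) and $F_{B^\dagger}$ a chosen lift over $\sigma$ of the $q$-power Frobenius of $B_0$. $F^a\text{-}\mathrm{Modlib}(B^\dagger)$ is the category of finitely generated free $B^\dagger$-modules $N$ with a $B^\dagger$-linear map $\phi_N:F_{B^\dagger}^*N\to N$. $L$-functions: for a closed point $x$ of $\operatorname{Spec}B_0$ of degree $\deg x=[k(x):k]$, put $\mathcal V(x)=W(k(x))\otimes_{W(k)}\mathcal V$ with the automorphism $\sigma_{\mathcal V(x)}$ extending $\sigma$ and the Witt-vector lift of the $q$-power map of $k(x)$; $\tau^\dagger(x):B^\dagger\to\mathcal V(x)$ is the unique $\mathcal V$-algebra lift of $B_0\to k(x)$ with $\tau^\dagger(x)\circ F_{B^\dagger}=\sigma_{\mathcal V(x)}\circ\tau^\dagger(x)$ (Teichmüller lift); $N_x=\tau^\dagger(x)^*N$, with induced $\phi_x:\sigma_{\mathcal V(x)}^*N_x\to N_x$ and linear iterate $\phi_x^{\deg x}$; and $L(\operatorname{Spec}B_0,N,t)=\prod_x\det(1-t^{\deg x}\phi_x^{\deg x}\mid N_x)^{-1}$, the product being over the closed points of $\operatorname{Spec}B_0$. Lift of $M$: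 let $R=\mathcal V[x_1,\dots,x_d]$ and let $\mu:R^\dagger\to A^\dagger$ be the canonical surjection. Choose $F_{R^\dagger}$ lifting the $q$-power Frobenius of $k[\underline x]$ with $\mu\circ F_{R^\dagger}=F_{A^\dagger}\circ\mu$. Choose a basis $e_1,\dots,e_m$ of $M$, let $C$ be the $m\times m$ matrix over $A^\dagger$ of $\phi_M$ (viewed as an $F_{A^\dagger}$-semilinear map), and choose a matrix $C_0$ over $R^\dagger$ with $\mu(C_0)=C$. Then $M_0=\bigoplus_{i=1}^m R^\dagger e_i$, with $\phi_0$ the Frobenius of matrix $C_0$. On $R[\underline y]^\dagger=\mathcal V[x_1,\dots,x_d,y_1,\dots,y_s]^\dagger$ use the Frobenius $\sigma$ extending $F_{R^\dagger}$ with $y_i^\sigma=y_i^q$; write $\underline x^\sigma=F_{R^\dagger}(\underline x)$. $pr^*(M_0)$ is the base change of $(M_0,\phi_0)$ to $R[\underline y]^\dagger$. Dwork crystal: put $E(t)=\exp(\pi^*(t-t^q))$, let $\psi_0$ be the nontrivial additive character of $\mathbb F_p$ with $\psi_0(1)=E(1)$, a primitive $p$-th root of unity, and put $\psi=\psi_0\circ\mathrm{Tr}_{\mathbb F_q/\mathbb F_p}$. $\mathcal L_\psi$ is the free rank-one overconvergent $F$-module on $\mathbb A^1_{\mathbb F_q}$ with basis $\theta_\psi$ and Frobenius $\theta_\psi\otimes1\mapsto E(t)\theta_\psi$. Its pullback $f^*(\mathcal L_\psi)$ is the free rank-one module over $R[\underline y]^\dagger$ with basis $e$ and Frobenius $$e\otimes1\mapsto\exp\Bigl(\pi^*\sum_{i=1}^s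 y_if_i(\underline x)-\pi^*\sum_{i=1}^s y_i^\sigma f_i(\underline x^\sigma)\Bigr)e.$$ Here $\overline{f_i}=f_i\bmod\pi$. The tensor product carries the tensor product Frobenius. *)

(* Defs.v *)
(* MathComp, with multinomials for polynomial rings, the classical layer of
   MathComp-Analysis for sets, and mxtens for tensor products of matrices. *)
From HB Require Import structures.
From mathcomp Require Import all_boot all_order all_algebra all_field.
From mathcomp Require Import boolp classical_sets fsbigop.
From mathcomp Require Import mxtens mpoly.

Set Implicit Arguments.
Unset Strict Implicit.
Unset Printing Implicit Defensive.

Import GRing.Theory.
Local Open Scope ring_scope.

(** Rings are [comPzRingType] wherever the zero ring must be allowed: [A] and
    [A_0] may be zero (then [X] is empty).  Since [comAlgType] excludes the
    zero ring, an algebra is given by its structure morphism. *)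

(** ** Complete discrete valuation rings and Witt vectors *)

Section AdicRings.
Variable R : comPzRingType.

Definition divides (x r : R) : Prop := exists s, r = x * s.

(* [r] is the sum of the [x]-adically convergent series [\sum_i a i]. *)
Definition adic_sum (x : R) (a : nat -> R) (r : R) : Prop :=
  forall n, divides (x ^+ n) (r - \sum_(i < n) a i).

Definition adically_separated (x : R) : Prop :=
  forall r, (forall n, divides (x ^+ n) r) -> r = 0.

Definition adically_complete (x : R) : Prop :=
  adically_separated x /\
  forall a : nat -> R, exists r, adic_sum x (fun i => x ^+ i * a i) r.

End AdicRings.

Definition is_surj (X Y : Type) (h : X -> Y) : Prop := forall y, exists x, h x = y.

(* [h] presents its target as the quotient of its source by [x]. *)
Definition is_quotient (R S : comPzRingType) (x : R) (h : {rmorphism R -> S}) :=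
  is_surj h /\ forall r, h r = 0 <-> divides x r.

Definition is_dvr (V : idomainType) (pi : V) : Prop :=
  [/\ pi != 0, pi \isn't a GRing.unit &
      forall v : V, v != 0 ->
        exists (n : nat) (u : V), u \is a GRing.unit /\ v = u * pi ^+ n].

(* The ring [W(k)] of a perfect field [k] of characteristic [p] is the strict
   [p]-ring with residue field [k]; it is unique up to unique isomorphism. *)
Definition is_witt_ring (p : nat) (k : fieldType) (W : comNzRingType)
    (res : {rmorphism W -> k}) : Prop :=
  [/\ is_quotient (p%:R : W) res,
      forall w : W, p%:R * w = 0 -> w = 0 &
      adically_complete (p%:R : W)].

(* [T], with [j1] and [j2], is [W1 \otimes_W W2]: the tensor product of
   commutative algebras is their coproduct. *)
Definition is_tensor_product (W W1 W2 T : comNzRingType)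
    (i1 : {rmorphism W -> W1}) (i2 : {rmorphism W -> W2})
    (j1 : {rmorphism W1 -> T}) (j2 : {rmorphism W2 -> T}) : Prop :=
  (forall w, j1 (i1 w) = j2 (i2 w)) /\
  forall (S : comNzRingType) (g1 : {rmorphism W1 -> S}) (g2 : {rmorphism W2 -> S}),
    (forall w, g1 (i1 w) = g2 (i2 w)) ->
    (exists g : {rmorphism T -> S},
       (forall w, g (j1 w) = g1 w) /\ (forall w, g (j2 w) = g2 w)) /\
    (forall g g' : {rmorphism T -> S},
       (forall w, g (j1 w) = g' (j1 w)) -> (forall w, g (j2 w) = g' (j2 w)) ->
       g =1 g').

(** The base: [k = F_q] with [q = p ^ a], the complete discrete valuation ring
    [V] with residue field [k] and fraction field of characteristic 0, the
    automorphism [sigma], and [W(k)] with its canonical morphism to [V]. *)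
Record base (p a : nat) := Base {
  bk : finFieldType;
  bV : idomainType;
  bpi : bV;
  bres : {rmorphism bV -> bk};
  bsigma : {rmorphism bV -> bV};
  bW : comNzRingType;
  bWres : {rmorphism bW -> bk};
  bWV : {rmorphism bW -> bV};
  base_prime : prime p;
  base_card : #|bk| = (p ^ a)%N;
  base_dvr : is_dvr bpi;
  base_complete : adically_complete bpi;
  base_residue : is_quotient bpi bres;
  base_char0 : [pchar {fraction bV}] =i pred0;
  base_sigma_bij : bijective bsigma;
  base_sigma_res : forall v, bres (bsigma v) = bres v ^+ (p ^ a);
  base_sigma_pi : bsigma bpi = bpi;
  base_witt : is_witt_ring p bWres;
  base_WV : forall w, bres (bWV w) = bWres w
}.

(** ** Algebras and weak completions *)

(* [p(b_1, ..., b_n)] for [p] with coefficients mapped by [s]; it is [mmap],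
   except that the target may be the zero ring. *)
Definition peval (V : nzRingType) (B : comPzRingType) (s : V -> B) (n : nat)
    (b : 'I_n -> B) (P : {mpoly V[n]}) : B :=
  \sum_(m <- msupp P) s P@_m * \prod_(i < n) b i ^+ m i.

(* [h] presents the [V]-algebra [A] as [V[x_1, ..., x_d] / (f_1, ..., f_s)]. *)
Definition is_presentation (V : comNzRingType) (A : comPzRingType)
    (sA : {rmorphism V -> A}) (d s : nat) (f : 'I_s -> {mpoly V[d]})
    (h : {rmorphism {mpoly V[d]} -> A}) : Prop :=
  [/\ forall v : V, h v%:MP = sA v, is_surj h &
      forall g, h g = 0 <->
        exists c : 'I_s -> {mpoly V[d]}, g = \sum_(i < s) c i * f i].

Definition formally_smooth (V : comNzRingType) (A : comPzRingType)
    (sA : {rmorphism V -> A}) : Prop :=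
  forall (C C' : comPzRingType) (sC : {rmorphism V -> C})
    (h : {rmorphism C -> C'}) (g : {rmorphism A -> C'}),
    is_surj h ->
    (forall c1 c2, h c1 = 0 -> h c2 = 0 -> c1 * c2 = 0) ->
    (forall v, g (sA v) = h (sC v)) ->
    exists g' : {rmorphism A -> C},
      (forall v, g' (sA v) = sC v) /\ (forall x, h (g' x) = g x).

Definition smooth (V : comNzRingType) (A : comPzRingType)
    (sA : {rmorphism V -> A}) : Prop :=
  (exists (d s : nat) (f : 'I_s -> {mpoly V[d]}) (h : {rmorphism {mpoly V[d]} -> A}),
     is_presentation sA f h) /\
  formally_smooth sA.

Section WeakCompletion.
Variables (V : comNzRingType) (pi : V) (B Bd : comPzRingType).
Variables (sB : {rmorphism V -> B}) (j : {rmorphism B -> Bd}).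

(* The [c i] are the polynomials [p_i] of the series [z = \sum_i p_i(b)] of
   Monsky and Washnitzer: [p_i] has coefficients in [pi^i V] and
   [deg p_i <= M (i + 1)]; recall that [msize] is the degree plus one. *)
Definition overconvergent_terms (n M : nat) (c : nat -> {mpoly V[n]}) : Prop :=
  forall i, (msize (c i) <= (M * i.+1).+1)%N /\
            forall m, divides (pi ^+ i) (c i)@_m.

(* The first three conditions identify [Bd] with a subring of the [pi]-adic
   completion of [B]; the last two say that this subring consists of the sums
   of the overconvergent series. *)
Definition is_weak_completion : Prop :=
  [/\ adically_separated (j (sB pi)),
      forall n (w : Bd), exists b : B, divides (j (sB pi) ^+ n) (w - j b),
      forall n (b : B), divides (j (sB pi) ^+ n) (j b) -> divides (sB pi ^+ n) b,
      forall w : Bd, exists (n M : nat) (b : 'I_n -> B) (c : nat -> {mpoly V[n]}),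
        overconvergent_terms M c /\
        adic_sum (j (sB pi)) (fun i => j (peval sB b (c i))) w &
      forall (n M : nat) (b : 'I_n -> B) (c : nat -> {mpoly V[n]}),
        overconvergent_terms M c ->
        exists w : Bd, adic_sum (j (sB pi)) (fun i => j (peval sB b (c i))) w].

End WeakCompletion.

(** [B^\dagger] with a lift over [sigma] of the [q]-power Frobenius of [B_0],
    for [sB : V -> B] and [rB : B -> B_0 = B / pi B]. *)
Record dagger (p a : nat) (S : base p a) (B B0 : comPzRingType)
    (sB : {rmorphism bV S -> B}) (rB : {rmorphism B -> B0}) := Dagger {
  dring :> comPzRingType;
  din : {rmorphism B -> dring};
  dred : {rmorphism dring -> B0};
  dfrob : {rmorphism dring -> dring};
  dagger_wc : is_weak_completion (bpi S) sB din;
  dagger_red : forall b, dred (din b) = rB b;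
  dagger_frob_sigma : forall v, dfrob (din (sB v)) = din (sB (bsigma S v));
  dagger_frob_lift : forall w, dred (dfrob w) = dred w ^+ (p ^ a)
}.

(** ** Closed points and Teichmueller lifts *)

Section ClosedPoints.
Variable B0 : comPzRingType.

Definition is_ideal (I : set B0) : Prop :=
  [/\ I 0, forall u v, I u -> I v -> I (u + v) & forall c u, I u -> I (c * u)].

Definition is_maximal_ideal (I : set B0) : Prop :=
  [/\ is_ideal I, ~ I 1 &
      forall J : set B0, is_ideal J -> ~ J 1 -> (forall u, I u -> J u) -> J = I].

Record closed_point := ClosedPoint {
  cp_ideal :> set B0;
  cp_maximal : is_maximal_ideal cp_ideal
}.

HB.instance Definition _ := gen_eqMixin closed_point.
HB.instance Definition _ := gen_choiceMixin closed_point.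

End ClosedPoints.

(** All that [x] determines: [k(x)], [W(k(x))] with its Frobenius,
    [V(x) = W(k(x)) \otimes_(W(k)) V] with [sigma_(V(x))], and the Teichmueller
    lift [tau^\dagger(x)].  Each is unique up to unique isomorphism. *)
Record teichmueller (p a : nat) (S : base p a) (B B0 : comPzRingType)
    (sB : {rmorphism bV S -> B}) (rB : {rmorphism B -> B0})
    (D : dagger sB rB) (x : closed_point B0) := Teichmueller {
  tk : fieldExtType (bk S);
  tev : {rmorphism B0 -> tk};
  tW : comNzRingType;
  tWres : {rmorphism tW -> tk};
  tWW : {rmorphism bW S -> tW};
  tWfrob : {rmorphism tW -> tW};
  tV : comNzRingType;
  tinW : {rmorphism tW -> tV};
  tinV : {rmorphism bV S -> tV};
  tres : {rmorphism tV -> tk};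
  tsigma : {rmorphism tV -> tV};
  tau : {rmorphism D -> tV};
  tev_surj : is_surj tev;
  tev_ker : forall b, tev b = 0 <-> cp_ideal x b;
  tev_alg : forall v, tev (rB (sB v)) = (bres S v)%:A;
  tW_witt : is_witt_ring p tWres;
  tWW_res : forall w, tWres (tWW w) = (bWres S w)%:A;
  tWfrob_res : forall w, tWres (tWfrob w) = tWres w ^+ (p ^ a);
  tV_tensor : is_tensor_product tWW (bWV S) tinW tinV;
  tres_W : forall w, tres (tinW w) = tWres w;
  tres_V : forall v, tres (tinV v) = (bres S v)%:A;
  tsigma_V : forall v, tsigma (tinV v) = tinV (bsigma S v);
  tsigma_W : forall w, tsigma (tinW w) = tinW (tWfrob w);
  tau_alg : forall v, tau (din D (sB v)) = tinV v;
  tau_lift : forall w, tres (tau w) = tev (dred D w);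
  tau_frob : forall w, tau (dfrob D w) = tsigma (tau w)
}.

(** ** Free overconvergent F-modules *)

Section FModules.
Variables (R : comPzRingType) (F : {rmorphism R -> R}).

Definition is_basis (N : lmodType R) (m : nat) (e : 'I_m -> N) : Prop :=
  forall v : N, exists! c : 'cV[R]_m, v = \sum_(i < m) c i 0 *: e i.

(* An [R]-linear map [F^* N -> N], viewed as an [F]-semilinear map [N -> N]. *)
Definition is_semilinear (N : lmodType R) (phi : N -> N) : Prop :=
  forall (c : R) (u v : N), phi (c *: u + v) = F c *: phi u + phi v.

Definition is_frobenius_matrix (N : lmodType R) (phi : N -> N) (m : nat)
    (e : 'I_m -> N) (C : 'M[R]_m) : Prop :=
  forall i, phi (e i) = \sum_(l < m) C l i *: e l.

(* The Frobenius of matrix [C] on the free module [R^m]. *)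
Definition frobenius_of_mx (m : nat) (C : 'M[R]_m) (v : 'cV[R]_m) : 'cV[R]_m :=
  C *m map_mx F v.

(* The matrix of the [n]-th iterate of the Frobenius of matrix [C], i.e.
   [C * F(C) * ... * F^(n-1)(C)]. *)
Fixpoint frobenius_iter_mx (m : nat) (C : 'M[R]_m) (n : nat) : 'M[R]_m :=
  if n is n'.+1 then C *m map_mx F (frobenius_iter_mx C n') else 1%:M.

End FModules.

(** ** L-functions *)

Section LFunction.
Variables (p a : nat) (S : base p a) (B B0 : comPzRingType).
Variables (sB : {rmorphism bV S -> B}) (rB : {rmorphism B -> B0}).
Variables (D : dagger sB rB) (T : forall x : closed_point B0, teichmueller D x).
Variables (N : lmodType D) (phi : N -> N).

Definition cp_degree (x : closed_point B0) : nat := \dim {: tk (T x)}.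

(* [det (1 - t^(deg x) phi_x^(deg x) | N_x)] for the basis [1 \otimes e_i] of
   [N_x] when [phi] has matrix [C] in the basis [e] of [N]. *)
Definition fibre_det (x : closed_point B0) (m : nat) (C : 'M[D]_m) :
    {poly tV (T x)} :=
  \det (1%:M - 'X^(cp_degree x) *:
        map_mx polyC (frobenius_iter_mx (tsigma (T x)) (map_mx (tau (T x)) C)
                                        (cp_degree x))).

(* The same determinant, which does not depend on the basis and has its
   coefficients in [V]. *)
Definition euler_poly (x : closed_point B0) : {poly bV S} :=
  xget 1 [set P : {poly bV S} |
    exists (m : nat) (e : 'I_m -> N) (C : 'M[D]_m),
      [/\ is_basis e, is_frobenius_matrix phi e C &
          map_poly (tinV (T x)) P = fibre_det x C]]%classic.

(* [P^-1] modulo [t^n.+1], for [P] of constant term 1. *)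
Definition trunc_inv (R : comNzRingType) (n : nat) (P : {poly R}) : {poly R} :=
  \sum_(i < n.+1) (1 - P) ^+ i.

(* The coefficient of [t^n] in [\prod_x (euler_poly x)^-1]; the factors with
   [n < deg x] are 1 modulo [t^n.+1], and the other ones are finitely many. *)
Definition Lfun (n : nat) : {fraction bV S} :=
  FracField.tofrac
    (\big[*%R/1]_(x \in [set x | (cp_degree x <= n)%N]%classic)
        trunc_inv n (euler_poly x))`_n.

End LFunction.

(* [L(c t)], for a power series [L(t)] given by its coefficients. *)
Definition rescale (K : comNzRingType) (c : K) (L : nat -> K) : nat -> K :=
  fun n => c ^+ n * L n.

(** ** The Dwork crystal *)

Section Exponential.
Variables (R : comPzRingType) (s : nat) (y : 'I_s -> R).

(* The ideal [(y_1, ..., y_s)^n]. *)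
Definition ideal_pow (n : nat) (r : R) : Prop :=
  exists c : {ffun 'I_n -> 'I_s} -> R,
    r = \sum_g c g * \prod_(i < n) y (g i).

(* [u = exp z] as a formal power series, for [z] in the ideal [(y)]: for each
   [n], [u = \sum_(i <= n) z^i / i!] modulo [(y)^n.+1], where the denominators
   have been cleared ([n ^_ (n - i) = n! / i!]).  The series does not converge
   [pi]-adically. *)
Definition is_exp (z u : R) : Prop :=
  forall n, ideal_pow n.+1
    (n`!%:R * u - \sum_(i < n.+1) (n ^_ (n - i))%:R * z ^+ i).

End Exponential.

Section AffineSpace.
Variables (p a : nat) (S : base p a).

(* The constants [V -> V[x_1, ..., x_n]] and the reduction
   [V[x_1, ..., x_n] -> k[x_1, ..., x_n]]. *)
Definition affC (n : nat) : {rmorphism bV S -> {mpoly (bV S)[n]}} :=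
  @mpolyC n (bV S).
Definition affR (n : nat) : {rmorphism {mpoly (bV S)[n]} -> {mpoly (bk S)[n]}} :=
  map_mpoly (bres S).

Definition aff_dagger (n : nat) := dagger (affC n) (affR n).

(* [V[x_1, ..., x_d] -> V[x_1, ..., x_d, y_1, ..., y_s]]. *)
Definition pr_poly (d s : nat) (g : {mpoly (bV S)[d]}) : {mpoly (bV S)[d + s]} :=
  mmap (affC (d + s)) (fun i => 'X_(lshift s i)) g.

Variables (d s : nat) (Dy : aff_dagger (d + s)).

Definition xvar (i : 'I_d) : Dy := din Dy 'X_(lshift s i).
Definition yvar (i : 'I_s) : Dy := din Dy 'X_(rshift d i).

(* [pi^* \sum_i y_i f_i(x) - pi^* \sum_i y_i^sigma f_i(x^sigma)]. *)
Definition dwork_exponent (pistar : bV S) (f : 'I_s -> {mpoly (bV S)[d]}) : Dy :=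
  let sV v := din Dy (affC (d + s) v) in
  sV pistar * \sum_(i < s) yvar i * peval sV xvar (f i) -
  sV pistar * \sum_(i < s) dfrob Dy (yvar i) *
                           peval sV (fun l => dfrob Dy (xvar l)) (f i).

End AffineSpace.

(* Main.v *)
Require Import Defs.
From HB Require Import structures.
From mathcomp Require Import all_boot all_order all_algebra all_field.
From mathcomp Require Import all_fingroup all_solvable.
From mathcomp Require Import boolp classical_sets cardinality fsbigop.
From mathcomp Require Import mxtens mpoly zify ring.

Set Implicit Arguments.
Unset Strict Implicit.
Unset Printing Implicit Defensive.

Import GRing.Theory.
Local Open Scope ring_scope.

(** Let [S_j] denote the coefficient of [t^j] in the logarithmic derivative
    [t L'(t) / L(t)].  A power series with constant term 1 is determined by these
    coefficients in characteristic 0 ([log_deriv_rescale]), so it suffices to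
    show that [S_j] for [pr^*(M_0) (x) f^*(L_psi)] is [q^(j s)] times [S_j] for
    [M].

    The coefficient [S_j] is the sum of the traces of [phi^j] over the points
    with values in [F_(q^j)] ([Lfun_trace_formula]).  At a point [(v, w)] of the
    affine space [A^(d+s)] the trace of the tensor product is the trace of
    [phi_0^j] at [v] times the value at [(v, w)] of the [j]-th iterate of the
    Frobenius of [f^*(L_psi)].  The latter is a nontrivial additive character of
    [\sum_i w_i f_i(v)], so its sum over [w] is [q^(j s)] if [v] is a zero of
    all [f_i], that is, a point of [X], and 0 otherwise ([dwork_fibre_sum]).

    Two difficulties shape the formal proof.  The traces at different closed
    points lie in different rings [V(x)], which are known by a universal
    property.  Each is shown to be [V[t] / (P)] ([tV_monogenic]); hence the
    invariants of its Frobenius are [V] ([tV_invariants]), and it maps, by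
    Hensel's lemma, to one ring [comparison_ring] whose residue field contains
    all extensions of [k] of small degree ([tV_lift]).  Teichmueller lifts are
    compared there by their uniqueness ([frobenius_rigidity]).

    Secondly, [E] is given as a formal exponential, which cannot be evaluated
    termwise.  Specializing [y_i] to [t] times a Teichmueller representative
    makes it a power series in [t] whose reductions modulo powers of [pi] are
    polynomials, with a value at [t = 1] ([exp_value]).  Along a Frobenius orbit
    the exponents telescope ([exp_value_orbit]), and the product of the values is
    the value at 1 of [exp (pistar c (t - t^Q))], with [c] the value of
    [\sum_i y_i f_i(x)] and [Q = q^j].  It is multiplicative in [c] and equal to
    1 for [c] divisible by [pi] ([exp_value_trivial]); it is not always 1, since
    modulo [pistar pi] it is 1 plus [pistar] times a nonzero additive polynomial
    of degree less than [Q] in [c] ([exp_value_residue]). *)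

(** * Divisibility, and morphisms built from surjections *)

Section Divides.
Variable R : comPzRingType.
Implicit Types x y z r : R.

Lemma divides0 x : divides x 0.
Proof. by exists 0; rewrite mulr0. Qed.

Lemma dividesD x y z : divides x y -> divides x z -> divides x (y + z).
Proof. by case=> s -> [t ->]; exists (s + t); rewrite mulrDr. Qed.

Lemma dividesN x y : divides x y -> divides x (- y).
Proof. by case=> s ->; exists (- s); rewrite mulrN. Qed.

Lemma dividesB x y z : divides x y -> divides x z -> divides x (y - z).
Proof. by move=> hy hz; apply/dividesD/dividesN. Qed.

Lemma dividesMl x y z : divides x y -> divides x (z * y).
Proof. by case=> s ->; exists (z * s); rewrite mulrCA. Qed.

Lemma dividesMr x y z : divides x y -> divides x (y * z).
Proof. by rewrite mulrC; apply: dividesMl. Qed.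

Lemma divides_refl x : divides x x.
Proof. by exists 1; rewrite mulr1. Qed.

Lemma divides_mulr x y : divides x (x * y).
Proof. by exists y. Qed.

Lemma divides_sum x I (r : seq I) (P : pred I) (F : I -> R) :
  (forall i, P i -> divides x (F i)) -> divides x (\sum_(i <- r | P i) F i).
Proof.
move=> h; elim/big_ind: _ => //; first exact: divides0.
by move=> ? ?; apply: dividesD.
Qed.

Lemma divides_trans y x z : divides x y -> divides y z -> divides x z.
Proof. by case=> s -> [t ->]; exists (s * t); rewrite mulrA. Qed.

Lemma divides_mul x y z t : divides x y -> divides z t -> divides (x * z) (y * t).
Proof. by case=> s -> [u ->]; exists (s * u); rewrite mulrACA. Qed.

Lemma divides_expW x m n r : (m <= n)%N -> divides (x ^+ n) r -> divides (x ^+ m) r.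
Proof.
by move=> le; apply: divides_trans; exists (x ^+ (n - m)); rewrite -exprD subnKC.
Qed.

Lemma divides_exp x y n : divides x y -> divides (x ^+ n) (y ^+ n).
Proof. by case=> s ->; exists (s ^+ n); rewrite exprMn_comm //; apply: mulrC. Qed.

Lemma dividesBC x y z : divides x (y - z) -> divides x (z - y).
Proof. by move/dividesN; rewrite opprB. Qed.

Lemma dividesB_trans y x z t :
  divides x (z - y) -> divides x (y - t) -> divides x (z - t).
Proof. by move=> h1 h2; have:= dividesD h1 h2; rewrite addrA subrK. Qed.

Lemma dividesBB x a b c d :
  divides x (a - b) -> divides x (c - d) -> divides x ((a - c) - (b - d)).
Proof.
move=> h1 h2; suff -> : a - c - (b - d) = (a - b) - (c - d) by apply: dividesB.
by rewrite !opprB addrACA [RHS]addrACA; congr (_ + _); rewrite addrC.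
Qed.

Lemma dividesDB x a b c d :
  divides x (a - b) -> divides x (c - d) -> divides x ((a + c) - (b + d)).
Proof. by move=> h1 h2; rewrite opprD addrACA; apply: dividesD. Qed.

Lemma dividesMB x a b c d :
  divides x (a - b) -> divides x (c - d) -> divides x (a * c - b * d).
Proof.
move=> h1 h2; apply: (@dividesB_trans (b * c)).
  by rewrite -mulrBl; apply: dividesMr.
by rewrite -mulrBr; apply: dividesMl.
Qed.

Lemma divides_expB x a b n : divides x (a - b) -> divides x (a ^+ n - b ^+ n).
Proof.
move=> h; elim: n => [|n ih]; first by rewrite !expr0 subrr; apply: divides0.
by rewrite !exprS; apply: dividesMB.
Qed.

Lemma divides_sumB x I (r : seq I) (P : pred I) (F G : I -> R) :
  (forall i, P i -> divides x (F i - G i)) ->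
  divides x (\sum_(i <- r | P i) F i - \sum_(i <- r | P i) G i).
Proof. by move=> h; rewrite -sumrB; apply: divides_sum. Qed.

Lemma regular_exp x n r :
  (forall y, x * y = 0 -> y = 0) -> x ^+ n * r = 0 -> r = 0.
Proof.
move=> tf; elim: n r => [r|n ih r]; first by rewrite expr0 mul1r.
by rewrite exprSr -mulrA => /ih /tf.
Qed.

(** The step from [x^n] to [x^n.+1] uses that the sum
    [\sum_(i < q) a^i b^(q.-1-i)] is [q b^(q.-1)], hence 0, modulo [x]. *)
Lemma divides_exp_lift x a b q n : (0 < n)%N -> divides x q%:R ->
  divides (x ^+ n) (a - b) -> divides (x ^+ n.+1) (a ^+ q - b ^+ q).
Proof.
move=> n0 hq hab; rewrite subrXX // exprSr; apply: divides_mul => //.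
have hx : divides x (a - b).
  by have:= @divides_expW x 1 n (a - b) n0 hab; rewrite expr1.
apply: (@divides_trans (q%:R * b ^+ q.-1 - (q%:R * b ^+ q.-1 -
  \sum_(i < q) a ^+ (q.-1 - i) * b ^+ i))); last first.
  by rewrite subKr; apply: divides_refl.
apply: dividesB; first exact: dividesMr.
have -> : q%:R * b ^+ q.-1 = \sum_(i < q) b ^+ (q.-1 - i) * b ^+ i.
  rewrite (eq_bigr (fun=> b ^+ q.-1)); last first.
    move=> i _; rewrite -exprD subnK //; have := ltn_ord i; lia.
  by rewrite sumr_const card_ord mulr_natl.
apply: divides_sumB => i _; rewrite -mulrBl; apply: dividesMr.
exact/divides_expB/dividesBC.
Qed.

End Divides.

Lemma divides_rmorph (A B : comPzRingType) (g : {rmorphism A -> B}) x y :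
  divides x y -> divides (g x) (g y).
Proof. by case=> s ->; exists (g s); rewrite rmorphM. Qed.

Lemma rmorph_of_fun (A B : pzRingType) (f : A -> B) :
  {morph f : x y / x - y} -> {morph f : x y / x * y} -> f 1 = 1 ->
  exists g : {rmorphism A -> B}, g =1 f.
Proof.
move=> fB fM f1.
pose mA := GRing.isZmodMorphism.Build A B f fB.
pose mM := GRing.isMonoidMorphism.Build A B f (conj f1 fM).
by exists (HB.pack f mA mM : {rmorphism A -> B}).
Qed.

Lemma factor_rmorph (A B C : pzRingType) (H : {rmorphism A -> B})
    (g : {rmorphism A -> C}) :
  is_surj H -> (forall a, H a = 0 -> g a = 0) ->
  exists g' : {rmorphism B -> C}, forall a, g' (H a) = g a.
Proof.
move=> /choice [s sK] kerH.
have gE a b : H a = H b -> g a = g b.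
  by move=> e; apply/eqP; rewrite -subr_eq0 -rmorphB kerH // rmorphB e subrr.
have [g' g'E] : exists g' : {rmorphism B -> C}, g' =1 g \o s.
  apply: rmorph_of_fun => [x y|x y|] /=.
  - by rewrite -rmorphB; apply: gE; rewrite rmorphB !sK.
  - by rewrite -rmorphM; apply: gE; rewrite rmorphM !sK.
  - by rewrite -(rmorph1 g); apply: gE; rewrite sK rmorph1.
by exists g' => a; rewrite g'E /=; apply: gE; rewrite sK.
Qed.

(** Uniqueness of Teichmueller-like lifts: two morphisms that agree modulo [x]
    and commute with lifts [F], [s] of a Frobenius agree, because taking
    [q]-th powers improves every congruence by one power of [x]. *)
Lemma frobenius_rigidity (B O : comPzRingType) (q : nat) (x : O)
    (g g' : {rmorphism B -> O}) (F : B -> B) (s : {additive O -> O}) :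
  adically_separated x -> divides x q%:R ->
  (forall n y, divides (x ^+ n) (s y) -> divides (x ^+ n) y) ->
  (forall w, s (g w) = g (F w)) -> (forall w, s (g' w) = g' (F w)) ->
  (forall w, exists c w', [/\ F w = w ^+ q + c * w', divides x (g c) & g c = g' c]) ->
  (forall w, divides x (g w - g' w)) -> g =1 g'.
Proof.
move=> sep hq sdiv gF g'F hF h1 w; apply/eqP; rewrite -subr_eq0; apply/eqP.
apply: sep => n; case: n => [|n]; first by exists (g w - g' w); rewrite mul1r.
elim: n w => [|n ih] w; first by rewrite expr1.
apply: sdiv; rewrite raddfB gF g'F; have [c [w' [-> hc ec]]] := hF w.
rewrite !rmorphD !rmorphXn !rmorphM /= -ec; apply: dividesDB.
  by apply: divides_exp_lift.
by rewrite -mulrBr exprS; apply: divides_mul.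
Qed.

(** * Flat complete lifts of a field, and their presentation by one generator *)

(** [O] is flat and complete along [x], with [O / x = L].  For [x = p] this is
    the definition of a Witt ring; in general it describes the unramified
    extensions of a complete discrete valuation ring. *)
Definition flat_lift (O : comNzRingType) (L : fieldType) (x : O)
    (r : {rmorphism O -> L}) : Prop :=
  [/\ is_quotient x r, forall y, x * y = 0 -> y = 0 & adically_complete x].

(** [O = R[t] / (P)], with [alpha] the class of [t]. *)
Definition monogenic (R O : comNzRingType) (i : {rmorphism R -> O}) (alpha : O)
    (P : {poly R}) : Prop :=
  [/\ P \is monic, forall x, exists g, x = (map_poly i g).[alpha] &
      forall g, (map_poly i g).[alpha] = 0 <-> exists h, g = h * P].

Lemma horner_rmorph (R O : comNzRingType) (i : {rmorphism R -> O}) (alpha : O) :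
  exists e : {rmorphism {poly R} -> O}, forall g, e g = (map_poly i g).[alpha].
Proof. by exists (horner_morph (fun x => mulrC alpha (i x))). Qed.

Lemma monogenic_hom (R O T : comNzRingType) (i : {rmorphism R -> O}) alpha P
    (j : {rmorphism R -> T}) (beta : T) :
  monogenic i alpha P -> (map_poly j P).[beta] = 0 ->
  exists g : {rmorphism O -> T}, (forall v, g (i v) = j v) /\ g alpha = beta.
Proof.
case=> _ span ker Pb; have [e eE] := horner_rmorph i alpha.
have [e' e'E] := horner_rmorph j beta.
have [||g gE] := @factor_rmorph _ _ _ e e'.
- by move=> x; have [h ->] := span x; exists h.
- move=> h; rewrite eE => /ker [h' ->].
  by rewrite e'E rmorphM /= hornerM Pb mulr0.
exists g; split=> [v|].
  by have := gE v%:P; rewrite eE e'E !map_polyC /= !hornerC.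
by have := gE 'X; rewrite eE e'E !map_polyX !hornerX.
Qed.

Lemma monogenic_ext (R O T : comNzRingType) (i : {rmorphism R -> O}) alpha P
    (g g' : {rmorphism O -> T}) :
  monogenic i alpha P -> (forall v, g (i v) = g' (i v)) -> g alpha = g' alpha ->
  g =1 g'.
Proof.
case=> _ span _ gi ga x; have [h ->] := span x.
rewrite -!horner_map /= ga -!map_poly_comp; congr horner.
by apply: eq_map_poly => v /=; rewrite gi.
Qed.

Lemma monic_division (R : comNzRingType) (P g : {poly R}) : P \is monic ->
  exists h g', g = h * P + g' /\ (size g' < size P)%N.
Proof.
move=> mP; exists (Pdiv.CommonRing.rdivp g P), (Pdiv.CommonRing.rmodp g P).
split; first exact: Pdiv.RingMonic.rdivp_eq.
by rewrite Pdiv.CommonRing.ltn_rmodpN0 // monic_neq0.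
Qed.

Lemma monic_mul_small (R : comNzRingType) (P h : {poly R}) : P \is monic ->
  (size (h * P)%R < size P)%N -> h = 0.
Proof.
move=> mP; have [//|h0] := eqVneq h 0; rewrite size_Mmonic //.
have : (0 < size h)%N by rewrite size_poly_gt0.
lia.
Qed.

Section FlatLifts.
Variables (R : comNzRingType) (pi : R) (k : fieldType) (rho : {rmorphism R -> k}).
Hypothesis hR : flat_lift pi rho.

Lemma map_poly_surj (g : {poly k}) :
  exists h, map_poly rho h = g /\ (size h <= size g)%N.
Proof.
have [[/choice [s sK] _] _ _] := hR.
exists (\poly_(j < size g) s g`_j); split; last exact: size_poly.
apply/polyP => j; rewrite coef_map coef_poly /=; case: ltnP => [_|le]; first exact: sK.
by rewrite rmorph0 nth_default.
Qed.

Lemma poly_divides (g : {poly R}) : (forall j, divides pi g`_j) ->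
  exists g', g = pi *: g' /\ (size g' <= size g)%N.
Proof.
move=> /choice [s sE]; exists (\poly_(j < size g) s j); split; last exact: size_poly.
apply/polyP => j; rewrite coefZ coef_poly; case: ltnP => [_|le]; first exact: sE.
by rewrite mulr0 nth_default.
Qed.

Lemma map_poly_eq0_divides (g : {poly R}) : map_poly rho g = 0 ->
  exists g', g = pi *: g' /\ (size g' <= size g)%N.
Proof.
have [[_ qE] _ _] := hR.
by move=> g0; apply: poly_divides => j; apply/qE; rewrite -coef_map g0 coef0.
Qed.

Lemma scale_poly_regular n (g : {poly R}) : pi ^+ n *: g = 0 -> g = 0.
Proof.
have [_ tf _] := hR; move=> e; apply/polyP => j; rewrite coef0.
by apply: (@regular_exp _ pi n) => //; rewrite -coefZ e coef0.
Qed.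

(** Completeness of [R] passes to polynomials of bounded degree. *)
Lemma poly_adic_sum d (h : nat -> {poly R}) : (forall n, (size (h n) <= d)%N) ->
  exists g : {poly R}, (size g <= d)%N /\
    forall n, exists g' : {poly R}, g - \sum_(i < n) pi ^+ i *: h i = pi ^+ n *: g'.
Proof.
have [_ _ [_ compl]] := hR; move=> hd.
have /choice [v vE] : forall j, exists v, adic_sum pi (fun i => pi ^+ i * (h i)`_j) v.
  by move=> j; apply: compl.
exists (\poly_(j < d) v j); split; first exact: size_poly.
move=> n; have /choice [w wE] := fun j => vE j n.
exists (\poly_(j < d) w j); apply/polyP => j.
rewrite coefB coef_sum coefZ !coef_poly; case: ltnP => lt; last first.
  rewrite mulr0 sub0r big1 ?oppr0 // => i _; rewrite coefZ nth_default ?mulr0 //.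
  exact: leq_trans (hd i) lt.
by rewrite -wE; congr (_ - _); apply: eq_bigr => i _; rewrite coefZ.
Qed.

Variables (O : comNzRingType) (i : {rmorphism R -> O}).
Variables (L : fieldType) (kappa : {rmorphism k -> L}) (r : {rmorphism O -> L}).
Hypothesis hr : forall v, r (i v) = kappa (rho v).

Lemma residue_horner (g : {poly R}) x :
  r (map_poly i g).[x] = (map_poly kappa (map_poly rho g)).[r x].
Proof.
rewrite -horner_map /= -!map_poly_comp; congr horner.
by apply: eq_map_poly => v /=; rewrite hr.
Qed.

Lemma horner_scale c (g : {poly R}) x :
  (map_poly i (c *: g)).[x] = i c * (map_poly i g).[x].
Proof. by rewrite linearZ /= hornerZ. Qed.

(** A monogenic algebra is free over [R], with a basis of powers of the
    generator, so that it inherits flatness and completeness from [R]. *)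
Lemma flat_lift_of_monogenic alpha P :
  monogenic i alpha P -> monogenic kappa (r alpha) (map_poly rho P) ->
  flat_lift (i pi) r.
Proof.
have [[rhoS rhoE] tf [sep _]] := hR.
case=> mP span ker [_ spank kerk].
have [e eE] := horner_rmorph i alpha.
have /choice [span' spanE] : forall x, exists g : {poly R},
    x = (map_poly i g).[alpha] /\ (size g <= (size P).-1)%N.
  move=> x; have [g ->] := span x.
  have [h [g' [-> lt]]] := monic_division g mP; exists g'; split.
    rewrite rmorphD /= hornerD.
    have -> : (map_poly i (h * P)).[alpha] = 0 by apply/ker; exists h.
    by rewrite add0r.
  by move: lt; case: (size P).
split.
- split=> [xi|x].
    have [g ->] := spank xi; have [h [<- _]] := map_poly_surj g.
    by exists (map_poly i h).[alpha]; rewrite residue_horner.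
  split=> [rx|[s ->]]; last first.
    have -> : r (i pi * s) = kappa (rho pi) * r s by rewrite rmorphM hr.
    by have /rhoE -> := divides_refl pi; rewrite rmorph0 mul0r.
  have [g xE] := span x; move: rx; rewrite xE residue_horner => /kerk [h].
  have [h' [<- _]] := map_poly_surj h; rewrite -rmorphM /= => /eqP.
  rewrite -subr_eq0 -rmorphB /= => /eqP /map_poly_eq0_divides [g' [gE _]].
  exists (map_poly i g').[alpha]; rewrite -horner_scale -gE rmorphB /= hornerD hornerN.
  have -> : (map_poly i (h' * P)).[alpha] = 0 by apply/ker; exists h'.
  by rewrite subr0.
- move=> x; have [g ->] := span x; rewrite -horner_scale => /ker [h hE].
  apply/ker.
  have /map_poly_eq0_divides [h' [h'E _]] : map_poly rho h = 0.
    apply: (@monic_mul_small _ (map_poly rho P)); first exact: monic_map.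
    rewrite -rmorphM /= -hE linearZ /=.
    have -> : rho pi = 0 by apply/rhoE/divides_refl.
    by rewrite scale0r size_poly0 size_poly_gt0 monic_neq0 // monic_map.
  exists h'; apply/eqP; rewrite -subr_eq0; apply/eqP.
  apply: (@scale_poly_regular 1); rewrite expr1 scalerBr hE h'E -scalerAl.
  by rewrite subrr.
- split.
    move=> x xdiv; have [xE sx] := spanE x; rewrite xE.
    suff -> : span' x = 0 by rewrite rmorph0 horner0.
    apply/polyP => j; rewrite coef0; apply: sep => n.
    have [y yE] := xdiv n; have [yE' sy] := spanE y.
    have /ker [h hE] : (map_poly i (span' x - pi ^+ n *: span' y)).[alpha] = 0.
      by rewrite rmorphB /= hornerD hornerN -xE horner_scale -yE' yE rmorphXn subrr.
    have h0 : h = 0.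
      apply: (monic_mul_small mP); rewrite -hE.
      have P0 : (0 < size P)%N by rewrite size_poly_gt0 monic_neq0.
      have := size_polyD (span' x) (- (pi ^+ n *: span' y)); rewrite size_polyN.
      have := size_scale_leq (pi ^+ n) (span' y).
      move=> h1 h2; apply: leq_ltn_trans h2 _.
      by rewrite -[X in (_ < X)%N](prednK P0) ltnS geq_max sx (leq_trans h1 sy).
    move: hE; rewrite h0 mul0r => /eqP; rewrite subr_eq0 => /eqP ->.
    by rewrite coefZ; apply: divides_mulr.
  move=> a; have [n|g [_ gE]] := @poly_adic_sum (size P).-1 (fun n => span' (a n)).
    by case: (spanE (a n)).
  exists (map_poly i g).[alpha] => n; have [g' g'E] := gE n.
  exists (map_poly i g').[alpha]; rewrite -rmorphXn -horner_scale -g'E.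
  rewrite rmorphB /= hornerD hornerN rmorph_sum /= horner_sum; congr (_ - _).
  apply: eq_bigr => l _; rewrite horner_scale rmorphXn.
  by have [<- _] := spanE (a l).
Qed.

(** Conversely, the powers of any lift of a generator of [L] over [k] form a
    basis of [O], by successive approximation. *)
Lemma monogenic_of_flat_lift alpha p : flat_lift (i pi) r ->
  monogenic kappa (r alpha) p ->
  exists P, map_poly rho P = p /\ monogenic i alpha P.
Proof.
case=> -[rS rE] tfO [sepO _] [mp span ker].
have [_ _ [sep _]] := hR.
have p0 : (0 < size p)%N by rewrite size_poly_gt0 monic_neq0.
pose d := (size p).-1.
have step x : exists gy : {poly R} * O, (size gy.1 <= d)%N /\
    x = (map_poly i gy.1).[alpha] + i pi * gy.2.
  have [g xE] := span (r x); have [h [g' [gE lt]]] := monic_division g mp.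
  have [g1 [g1E s1]] := map_poly_surj g'.
  have /rE [y yE] : r (x - (map_poly i g1).[alpha]) = 0.
    rewrite rmorphB residue_horner g1E xE gE rmorphD /= hornerD.
    have -> : (map_poly kappa (h * p)).[r alpha] = 0 by apply/ker; exists h.
    by rewrite add0r subrr.
  exists (g1, y); split; last by rewrite /= -yE addrC subrK.
  by apply: leq_trans s1 _; rewrite /d -ltnS prednK.
have [st stE] := choice step.
have span' x : exists g : {poly R}, (size g <= d)%N /\ x = (map_poly i g).[alpha].
  pose xs n := iter n (fun z => (st z).2) x.
  have [n|g [sg gE]] := @poly_adic_sum d (fun n => (st (xs n)).1).
    by case: (stE (xs n)).
  exists g; split=> //; apply/eqP; rewrite -subr_eq0; apply/eqP; apply: sepO => n.
  have xE : x = (map_poly i (\sum_(l < n) pi ^+ l *: (st (xs l)).1)).[alpha]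
                + i pi ^+ n * xs n.
    elim: n => [|n ih].
      by rewrite big_ord0 rmorph0 horner0 expr0 mul1r add0r.
    rewrite {1}ih big_ord_recr /= rmorphD /= hornerD -addrA horner_scale.
    rewrite rmorphXn exprSr -mulrA -mulrDr; congr (_ + _ * _).
    by have [_ {1}->] := stE (xs n).
  have [g' g'E] := gE n.
  rewrite {1}xE addrAC -hornerN -hornerD -rmorphN -rmorphD /= addrC.
  apply: dividesD; first exact: divides_mulr.
  rewrite -opprB g'E rmorphN /= hornerN horner_scale rmorphXn.
  exact/dividesN/divides_mulr.
have [g [sg gE]] := span' (alpha ^+ d).
pose P := 'X^d - g.
have sP : size P = d.+1 by rewrite size_polyDl ?size_polyXn // size_polyN.
have mP : P \is monic.
  by rewrite monicE lead_coefDl ?lead_coefXn // size_polyXn size_polyN.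
have Pa : (map_poly i P).[alpha] = 0.
  by rewrite rmorphB /= map_polyXn hornerD hornerN hornerXn gE subrr.
have small (g1 : {poly k}) : (size g1 <= d)%N ->
    (map_poly kappa g1).[r alpha] = 0 -> g1 = 0.
  move=> s1 /ker [h hE]; rewrite hE (@monic_mul_small _ p h) ?mul0r // -hE.
  by apply: leq_ltn_trans s1 _; rewrite /d prednK.
exists P; split.
  have mrP : map_poly rho P \is monic by apply: monic_map.
  have srP : size (map_poly rho P) = d.+1 by rewrite size_map_poly_id0 ?sP //
    (monicP mP) rmorph1 oner_neq0.
  apply/eqP; rewrite -subr_eq0; apply/eqP; apply: small.
    have /ker [h hE] : (map_poly kappa (map_poly rho P)).[r alpha] = 0.
      by rewrite -residue_horner Pa rmorph0.
    have h0 : h != 0.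
      by apply: contraTneq mrP => h0; rewrite hE h0 mul0r qualifE /=
        lead_coef0 eq_sym oner_eq0.
    have sh : size h = 1%N.
      move: srP; rewrite hE size_Mmonic // -[in LHS](prednK p0) addnS /=.
      by rewrite -/d -[in RHS]add1n => /addIn.
    have /size_poly1P [c c0 hc] := introT eqP sh.
    have c1 : c = 1.
      move: mrP; rewrite hE hc mul_polyC monicE lead_coefZ (monicP mp) mulr1.
      by move/eqP.
    by rewrite hE hc c1 mul1r subrr size_poly0.
  rewrite rmorphB /= hornerD hornerN -residue_horner Pa rmorph0 sub0r.
  have -> : (map_poly kappa p).[r alpha] = 0 by apply/ker; exists 1; rewrite mul1r.
  by rewrite oppr0.
split=> // [x|g1]; first by have [g1 [_ ->]] := span' x; exists g1.
split=> [g1a|[h ->]]; last by rewrite rmorphM /= hornerM Pa mulr0.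
have [h [g2 [E s2]]] := monic_division g1 mP.
suff g20 : g2 = 0 by exists h; rewrite E g20 addr0.
have g2a : (map_poly i g2).[alpha] = 0.
  by move: g1a; rewrite E rmorphD rmorphM /= hornerD hornerM Pa mulr0 add0r.
apply/polyP => j; rewrite coef0; apply: sep => n.
suff [g3 [-> _]] : exists g3 : {poly R}, g2 = pi ^+ n *: g3 /\
    (size g3 <= d)%N /\ (map_poly i g3).[alpha] = 0.
  by rewrite coefZ; apply: divides_mulr.
elim: n => [|n [g3 [-> [s3 g3a]]]].
  by exists g2; rewrite expr0 scale1r; split=> //; split=> //; rewrite -ltnS -sP.
have /map_poly_eq0_divides [g4 [g3E s4]] : map_poly rho g3 = 0.
  apply: small; first by apply: leq_trans (size_poly _ _) s3.
  by rewrite -residue_horner g3a rmorph0.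
exists g4; rewrite g3E scalerA -exprSr; split=> //; split.
  exact: leq_trans s4 s3.
by apply: tfO; rewrite -horner_scale -g3E.
Qed.

End FlatLifts.

(** * Extensions of a finite field *)

Section FiniteFields.
Variables (k : finFieldType).

Lemma fieldExt_fermat (L : fieldExtType k) (x : L) :
  x ^+ (#|k| ^ \dim {:L}) = x.
Proof.
have := @expf_card (finvect_type L) x.
have <- : #|finvect_type L| = (#|k| ^ \dim {:L})%N; last by [].
by rewrite -(card_vspacef (Vector.class (finvect_type L))) (card_vspace {:finvect_type L}).
Qed.

(** A generator of the cyclic group of units of [L] generates the extension, and
    [p] is its minimal polynomial. *)
Lemma fieldExt_monogenic (L : fieldExtType k) :
  exists (alpha : L) (p : {poly k}),
    monogenic (in_alg L) alpha p /\ size p = (\dim {:L}).+1.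
Proof.
have [u uE] : exists u : {unit finvect_type L}, [set: {unit finvect_type L}] = <[u]>%g.
  exact/cyclicP/field_unit_group_cyclic.
pose al : L := FinRing.uval u.
have powers (x : L) : exists g : {poly k}, x = (map_poly (in_alg L) g).[al].
  have [->|x0] := eqVneq x 0; first by exists 0; rewrite rmorph0 horner0.
  have xu : (x : finvect_type L) \is a GRing.unit by rewrite unitfE.
  have : FinRing.unit (finvect_type L) xu \in <[u]>%g by rewrite -uE inE.
  case/cycleP=> j jE; exists 'X^j; rewrite map_polyXn hornerXn.
  by have := congr1 val jE; rewrite FinRing.val_unitX.
have /polyOver1P [p pE] := minPolyOver 1%VS al.
have mp : p \is monic.
  have := monic_minPoly 1%VS al.
  by rewrite pE !monicE lead_coef_map fmorph_eq1.
exists al, p; split.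
  split=> // g; split=> [ga|[h ->]]; last first.
    by rewrite rmorphM /= hornerM -pE minPolyxx mulr0.
  have : minPoly 1%VS al %| map_poly (in_alg L) g.
    by apply: minPoly_dvdp; [apply/polyOver1P; exists g | rewrite rootE ga].
  by rewrite pE dvdp_map => /dvdpP [h ->]; exists h.
have -> : size p = size (minPoly 1%VS al) by rewrite pE size_map_poly.
have full : <<1; al>>%VS = fullv :> {vspace L}.
  apply/vspaceP => x; rewrite memvf; have [g ->] := powers x.
  rewrite rpred_horner ?memv_adjoin //.
  apply/polyOverP => j; rewrite coef_map /=; apply: subvP_adjoin.
  by rewrite rpredZ ?mem1v.
rewrite size_minPoly adjoin_degreeE.
by have := full => /= ->; rewrite dimv1 divn1.
Qed.

Lemma separable_XqX (L : fieldType) (Q : nat) : Q%:R = 0 :> L -> (1 < Q)%N ->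
  separable_poly ('X^Q - 'X : {poly L}).
Proof.
move=> Q0 Q1; rewrite unlock derivB derivX derivXn -mulr_natl.
have -> : Q%:R = 0 :> {poly L} by rewrite -polyC_natr Q0.
rewrite mul0r sub0r -[X in coprimep _ X]scaleN1r.
by rewrite coprimepZr ?oppr_eq0 ?oner_eq0 // coprimep1.
Qed.

Lemma dvdp_XqX (L : fieldType) (Q m : nat) :
  ('X^Q - 'X : {poly L}) %| 'X^(Q ^ m) - 'X.
Proof.
elim: m => [|m ih]; first by rewrite expn0 expr1 subrr dvdp0.
have -> : 'X^(Q ^ m.+1) - 'X = ('X^(Q ^ m) ^+ Q - 'X ^+ Q) + ('X^Q - 'X) :> {poly L}.
  by rewrite expnSr exprM addrA subrK.
by rewrite dvdp_add // subrXX dvdp_mulr.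
Qed.

(** The splitting field of the separable polynomial [X^(q^N) - X] for [N = n!],
    which is divisible by [X^(q^m) - X] for all [m <= n]: it contains all
    extensions of [k] of degree at most [n]. *)
Lemma big_field_exists (n : nat) : #|k|%:R = 0 :> k ->
  exists L : splittingFieldType k,
    forall m (f : {poly L}), (0 < m <= n)%N -> f %| 'X^(#|k| ^ m) - 'X ->
    exists rs : seq L, uniq rs /\ f %= \prod_(z <- rs) ('X - z%:P).
Proof.
move=> q0; have k1 := finNzRing_gt1 k.
pose N := n`!; pose P : {poly k} := 'X^(#|k| ^ N) - 'X.
have N0 : (0 < N)%N by apply: fact_gt0.
have P0 : P != 0.
  have: size P == (#|k| ^ N).+1.
    rewrite size_polyDl ?size_polyXn // size_polyN size_polyX ltnS.
    by apply: (leq_trans k1); rewrite -{1}(expn1 #|k|) leq_exp2l.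
  by apply: contraTneq => ->; rewrite size_poly0.
have [L [rs rsE _]] := FinSplittingFieldFor P0; exists L => m f /andP[m0 mn] fdvd.
have PE : map_poly (in_alg L) P = 'X^(#|k| ^ N) - 'X.
  by rewrite rmorphB /= map_polyXn map_polyX.
have urs : uniq rs.
  rewrite -separable_prod_XsubC -(eqp_separable rsE) PE separable_XqX //.
    by rewrite natrX -(rmorph_nat (in_alg L)) q0 rmorph0 expr0n -[N == 0%N]negbK -lt0n N0.
  by apply: (leq_trans k1); rewrite -{1}(expn1 #|k|) leq_exp2l.
have [|b bE] := @dvdp_prod_XsubC _ _ rs id f.
  rewrite -(eqp_dvdr _ rsE) PE; apply: dvdp_trans fdvd _.
  have /dvdnP [M ->] : (m %| N)%N by rewrite dvdn_fact // m0.
  by rewrite mulnC expnM dvdp_XqX.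
by exists (mask b rs); split=> //; apply: mask_uniq.
Qed.

End FiniteFields.

(** * Hensel's lemma and lifting of morphisms *)

Lemma divides_horner (R : comNzRingType) (P : {poly R}) a b :
  divides (a - b) (P.[a] - P.[b]).
Proof.
rewrite !horner_coef; apply: divides_sumB => i _; rewrite -mulrBr.
apply/dividesMl/divides_expB/divides_refl.
Qed.

Lemma taylor1 (R : comNzRingType) (P : {poly R}) b e :
  exists q, P.[b + e] = P.[b] + P^`().[b] * e + e ^+ 2 * q.
Proof.
elim/poly_ind: P => [|P c [q E]].
  by exists 0; rewrite deriv0 !horner0; ring.
exists (P^`().[b] + (b + e) * q).
rewrite !hornerMXaddC derivMXaddC hornerD hornerMX E; ring.
Qed.

Section Hensel.
Variables (O : comNzRingType) (L : fieldType) (x : O) (r : {rmorphism O -> L}).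
Hypothesis hO : flat_lift x r.

(** Newton's iteration with the derivative frozen at [b0]: each step gains one
    power of [x], and completeness gives the limit. *)
Lemma hensel (P : {poly O}) b0 : r P.[b0] = 0 -> r P^`().[b0] != 0 ->
  exists b, P.[b] = 0 /\ r b = r b0.
Proof.
have [[rS rE] tf [sep compl]] := hO; move=> P0 P'0.
have [c cE] := rS (r P^`().[b0])^-1.
have rx : r x = 0 by apply/rE/divides_refl.
pose b n := iter n (fun z => z - c * P.[z]) b0.
have inv n : exists t, P.[b n] = x ^+ n.+1 * t /\ r (b n) = r b0.
  elim: n => [|n [t [PE bE]]].
    by have /rE [t tE] := P0; exists t; rewrite expr1.
  have [q qE] := taylor1 P (b n) (- (c * P.[b n])).
  have /rE [y yE] : r (1 - P^`().[b n] * c) = 0.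
    have e : r P^`().[b n] = r P^`().[b0].
      apply/eqP; rewrite -subr_eq0 -rmorphB; apply/eqP/rE.
      apply: divides_trans (divides_horner _ _ _); apply/rE.
      by rewrite rmorphB bE subrr.
    by rewrite rmorphB rmorphM rmorph1 e cE divff // subrr.
  exists (y * t + x ^+ n * (c * t) ^+ 2 * q); split; last first.
    by rewrite /= -/(b n) rmorphB rmorphM PE rmorphM rmorphXn /= rx exprS
      !(mul0r, mulr0) subr0.
  rewrite /= -/(b n) qE.
  have -> : P.[b n] + P^`().[b n] * - (c * P.[b n]) =
    (1 - P^`().[b n] * c) * P.[b n] by ring.
  rewrite yE PE !exprS; ring.
have [t tE] := choice inv.
have [s sE] := compl (fun i => - (c * t i)).
have bn n : b n = b0 + x * \sum_(i < n) x ^+ i * - (c * t i).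
  elim: n => [|n ih]; first by rewrite big_ord0 mulr0 addr0.
  rewrite big_ord_recr /= -/(b n) {1}ih; have [-> _] := tE n; rewrite exprS; ring.
exists (b0 + x * s); split; last by rewrite rmorphD rmorphM rx mul0r addr0.
apply: sep => n.
have h : divides (x ^+ n) (P.[b0 + x * s] - P.[b n]).
  apply: divides_trans (divides_horner _ _ _).
  have [w wE] := sE n; exists (x * w); rewrite bn.
  have -> : b0 + x * s - (b0 + x * \sum_(i < n) x ^+ i * - (c * t i)) =
    x * (s - \sum_(i < n) x ^+ i * - (c * t i)) by ring.
  by rewrite wE; ring.
rewrite -[X in divides _ X](subrK P.[b n]); apply: dividesD => //.
by have [-> _] := tE n; exists (x * t n); rewrite exprSr mulrA.
Qed.

End Hensel.

(** A monogenic algebra with separable residual equation has the lifting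
    property of an etale one. *)
Lemma monogenic_lift (R O1 O2 : comNzRingType) (L1 L2 : fieldType)
    (i : {rmorphism R -> O1}) alpha P (r1 : {rmorphism O1 -> L1})
    (x : O2) (r2 : {rmorphism O2 -> L2}) (j : {rmorphism R -> O2})
    (eps : {rmorphism L1 -> L2}) :
  monogenic i alpha P -> flat_lift x r2 ->
  (forall v, r2 (j v) = eps (r1 (i v))) ->
  r1 (map_poly i P)^`().[alpha] != 0 ->
  exists g : {rmorphism O1 -> O2},
    (forall v, g (i v) = j v) /\ (forall w, r2 (g w) = eps (r1 w)).
Proof.
move=> mon hO2 hr sepP; have [[r2S _] _ _] := hO2.
have Pa : (map_poly i P).[alpha] = 0.
  by have [_ _ ker] := mon; apply/ker; exists 1; rewrite mul1r.
have [b0 b0E] := r2S (eps (r1 alpha)).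
have res (g : {poly R}) : r2 (map_poly j g).[b0] = eps (r1 (map_poly i g).[alpha]).
  rewrite -!horner_map /= b0E -!map_poly_comp; congr horner.
  by apply: eq_map_poly => v /=; rewrite hr.
have [||b [Pb bE]] := hensel hO2 (P := map_poly j P) (b0 := b0).
- by rewrite res Pa !rmorph0.
- by rewrite deriv_map res -deriv_map fmorph_eq0.
have [g [gi ga]] := monogenic_hom mon Pb; exists g; split=> //.
apply: (@monogenic_ext _ _ _ i alpha P (r2 \o g) (eps \o r1)) => // [v|] /=.
  by rewrite gi hr.
by rewrite ga bE b0E.
Qed.

(** * Unramified extensions of the base *)

Lemma qpoly_horner (R : comNzRingType) (P g : {poly R}) :
  (map_poly (qpolyC P) g).[qpolyX P] = in_qpoly P g.
Proof.
elim/poly_ind: g => [|g c ih]; first by rewrite rmorph0 horner0 in_qpoly0.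
rewrite rmorphD rmorphM /= map_polyX map_polyC /= hornerMXaddC ih.
rewrite in_qpolyD in_qpolyM -/(qpolyX P); congr (_ + _).
apply/val_inj; rewrite [RHS]in_qpoly_small ?qpolyCE // size_polyC.
by rewrite (leq_ltn_trans (leq_b1 _)) // size_mk_monic_gt1.
Qed.

Lemma qpoly_monogenic (R : comNzRingType) (P : {poly R}) :
  P \is monic -> (1 < size P)%N -> monogenic (qpolyC P) (qpolyX P) P.
Proof.
move=> mP sP; have PE : mk_monic P = P by rewrite /mk_monic sP mP.
split=> // [x|g].
  exists (val x); rewrite qpoly_horner; apply/val_inj.
  by rewrite [RHS]in_qpoly_small // size_mk_monic.
rewrite qpoly_horner; split=> [/(congr1 val) /= e|[h ->]].
  exists (Pdiv.CommonRing.rdivp g P).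
  have := Pdiv.RingMonic.rdivp_eq mP g; rewrite -[in Pdiv.CommonRing.rmodp _ _]PE.
  by rewrite e addr0.
apply/val_inj; rewrite /= PE.
by rewrite Pdiv.RingMonic.rmodp_mull.
Qed.

Lemma frobenius_rmorph (L : comNzRingType) (p a : nat) : p \in [pchar L] ->
  exists f : {rmorphism L -> L}, forall x, f x = x ^+ (p ^ a).
Proof.
move=> ch; have pr := pcharf_prime ch.
have pn : [pchar L].-nat (p ^ a)%N.
  by rewrite pnatX; apply/orP; left; rewrite pnatE.
have [|||f fE] := @rmorph_of_fun L L (fun x => x ^+ (p ^ a)); last by exists f.
- move=> x y; apply/eqP; rewrite eq_sym subr_eq -exprDn_pchar //.
  by rewrite subrK.
- by move=> x y; rewrite exprMn.
- by rewrite expr1n.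
Qed.

Section Base.
Variables (p a : nat) (S : base p a).
Notation V := (bV S).
Notation k := (bk S).
Notation pi := (bpi S).
Notation q := (p ^ a)%N.

Lemma base_flat : flat_lift pi (bres S).
Proof.
split; [exact: base_residue | | exact: base_complete].
move=> y /eqP; have [pi0 _ _] := base_dvr S.
by rewrite mulf_eq0 (negPf pi0) => /eqP.
Qed.

Lemma base_pchar : p \in [pchar k].
Proof. exact: card_finPcharP (base_card S) (base_prime S). Qed.

Lemma base_a_gt0 : (0 < a)%N.
Proof.
by have := finNzRing_gt1 k; rewrite base_card; case: (a); rewrite ?expn0.
Qed.

Lemma base_card0 : #|k|%:R = 0 :> k.
Proof.
rewrite base_card natrX (pcharf0 base_pchar) expr0n -[a == 0%N]negbK -lt0n.
by rewrite base_a_gt0.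
Qed.

Lemma base_divides_p : divides pi (p%:R).
Proof.
have [_ rE] := base_residue S; apply/rE.
by rewrite rmorph_nat (pcharf0 base_pchar).
Qed.

Lemma base_divides_q n : (0 < n)%N -> divides pi ((p ^ n)%:R).
Proof.
case: n => // n _; rewrite natrX exprS; apply: dividesMr; exact: base_divides_p.
Qed.

Lemma base_natr0 n : n%:R = 0 :> V -> n = 0%N.
Proof.
move=> n0; have /pcharf0P ch := base_char0 S.
have := congr1 (@FracField.tofrac V) n0; rewrite rmorph_nat rmorph0 => /eqP.
by rewrite ch => /eqP.
Qed.

(** [sigma] reduces to the identity of [F_q], so it is the identity on [W(k)],
    which together with [pi] generates [V].  Hence [f_i(x^sigma)] in the exponent
    of the Dwork crystal, where [sigma] is not applied to the coefficients of
    [f_i], is the Frobenius of [f_i(x)]. *)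
Lemma base_sigma_id v : bsigma S v = v.
Proof.
have [sep _] := base_complete S; have [rS rE] := base_residue S.
have [[WS WE] _ [sepW _]] := base_witt S.
have fermat (y : k) : y ^+ q = y by rewrite -(base_card S) expf_card.
(* A morphism from [W(k)] is determined by its reduction, as [w^q = w] mod p. *)
have WV w : bsigma S (bWV S w) = bWV S w.
  apply: (@frobenius_rigidity (bW S) V q pi (bsigma S \o bWV S) (bWV S) id idfun).
  - exact: sep.
  - by apply: base_divides_q; exact: base_a_gt0.
  - by [].
  - by [].
  - by [].
  - move=> z; have /WE [z' z'E] : bWres S (z - z ^+ q) = 0.
      by rewrite rmorphB rmorphXn fermat subrr.
    exists p%:R, z'; split; first by rewrite -z'E addrC subrK.
      by rewrite !rmorph_nat; apply: base_divides_p.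
    by rewrite !rmorph_nat.
  - move=> z /=; apply/rE; rewrite rmorphB base_sigma_res fermat subrr //.
have approx n : forall u, divides (pi ^+ n) (bsigma S u - u).
  elim: n => [|n ih] u; first by exists (bsigma S u - u); rewrite mul1r.
  have [w wE] := WS (bres S u).
  have /rE [u' u'E] : bres S (u - bWV S w) = 0.
    by rewrite rmorphB base_WV wE subrr.
  have -> : u = bWV S w + pi * u' by rewrite -u'E addrC subrK.
  rewrite rmorphD rmorphM /= WV base_sigma_pi.
  have -> : bWV S w + pi * bsigma S u' - (bWV S w + pi * u') =
    pi * (bsigma S u' - u') by ring.
  by rewrite exprS; apply: divides_mul => //; apply: divides_refl.
by apply/eqP; rewrite -subr_eq0; apply/eqP/sep => n; apply: approx.
Qed.

(** The properties of [V(x)], and of the larger rings to which the traces at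
    different points are compared. *)
Record unramified (O : comNzRingType) (i : {rmorphism V -> O}) (L : fieldType)
    (kappa : {rmorphism k -> L}) (r : {rmorphism O -> L}) : Prop := Unramified {
  unr_flat : flat_lift (i pi) r;
  unr_res : forall v, r (i v) = kappa (bres S v)
}.

Section Unramified.
Variables (O : comNzRingType) (i : {rmorphism V -> O}) (L : fieldType).
Variables (kappa : {rmorphism k -> L}) (r : {rmorphism O -> L}).
Hypothesis hO : unramified i kappa r.

Lemma unr_separated : adically_separated (i pi).
Proof. by have [[_ _ []]] := hO. Qed.

Lemma unr_res0 w : r w = 0 <-> divides (i pi) w.
Proof. by have [[[_ h] _ _] _] := hO. Qed.

Lemma unr_regular n w : i pi ^+ n * w = 0 -> w = 0.
Proof. by have [[_ tf _] _] := hO; apply: regular_exp. Qed.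

Lemma unr_cancel n m w : divides (i pi ^+ (n + m)) (i pi ^+ n * w) ->
  divides (i pi ^+ m) w.
Proof.
case=> s; rewrite exprD -mulrA => e; exists s; apply/eqP; rewrite -subr_eq0.
by apply/eqP/(@unr_regular n); rewrite mulrBr e subrr.
Qed.

Lemma unr_inj : injective i.
Proof.
move=> v w e; apply/eqP; rewrite -subr_eq0; apply/negP => /negP vw.
have [_ _ /(_ _ vw) [n [u [uu uE]]]] := base_dvr S.
have : i pi ^+ n * i u = 0 by rewrite mulrC -rmorphXn -rmorphM -uE rmorphB e subrr.
move=> /unr_regular iu0.
have : i u * i u^-1 = 1 by rewrite -rmorphM divrr // rmorph1.
by rewrite iu0 mul0r => /esym/eqP; rewrite oner_eq0.
Qed.

Lemma unr_divides_q n : (0 < n)%N -> divides (i pi) ((p ^ n)%:R : O).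
Proof.
by move=> n0; rewrite -(rmorph_nat i); apply/divides_rmorph/base_divides_q.
Qed.

(** If [h w = 0] then [w] has residue 0; divide by [pi] and repeat. *)
Lemma unr_res_regular h w : r h != 0 -> h * w = 0 -> w = 0.
Proof.
move=> rh hw; apply: unr_separated => n.
suff [w' [_ ->]] : exists w', h * w' = 0 /\ w = i pi ^+ n * w'.
  exact: divides_mulr.
elim: n => [|n [w' [hw' ->]]]; first by exists w; rewrite mul1r.
have : r h * r w' = 0 by rewrite -rmorphM hw' rmorph0.
move/eqP; rewrite mulf_eq0 (negPf rh) /= => /eqP /unr_res0 [w2 w2E].
exists w2; rewrite w2E exprSr mulrA; split=> //.
by apply: (@unr_regular 1); rewrite expr1 mulrCA -w2E.
Qed.

Lemma unr_pchar : p \in [pchar L].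
Proof. by have := base_pchar; rewrite -(fmorph_pchar kappa). Qed.

Variable (sg : {rmorphism O -> O}).
Hypothesis sgi : forall v, sg (i v) = i v.
Hypothesis sgr : forall w, r (sg w) = r w ^+ q.

Lemma unr_sigma_div n w : divides (i pi ^+ n) (sg w) -> divides (i pi ^+ n) w.
Proof.
elim: n w => [|n ih] w; first by exists w; rewrite mul1r.
move=> h; have : r (sg w) = 0.
  by apply/unr_res0/(divides_trans _ h); exists (i pi ^+ n); rewrite exprS.
rewrite sgr => /eqP; rewrite expf_eq0 => /andP[_ /eqP /unr_res0 [w' w'E]].
move: h; rewrite w'E rmorphM /= sgi -[i pi * sg w'](expr1) => h.
rewrite exprS; apply: divides_mul; first exact: divides_refl.
by apply/ih/(@unr_cancel 1); rewrite add1n expr1 -[X in divides _ X]expr1.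
Qed.

(** An invariant element is, modulo every power of [pi], in [V], because the
    residues fixed by the [q]-power map are those of [k]; then use that [V] is
    complete. *)
Lemma unr_invariants w : sg w = w -> exists v, w = i v.
Proof.
have [[rS rE] _ [_ compl]] := base_flat.
have step z : sg z = z -> exists vz : V * O, sg vz.2 = vz.2 /\ z = i vz.1 + i pi * vz.2.
  move=> sz; have [c cE] : exists c, r z = kappa c.
    have rz : root ('X^#|k| - 'X) (r z).
      by rewrite rootE !hornerE base_card -sgr sz subrr.
    have : root (map_poly kappa ('X^#|k| - 'X)) (r z).
      by rewrite rmorphB /= map_polyXn map_polyX.
    rewrite finField_genPoly rmorph_prod /=.
    have -> : \prod_x map_poly kappa ('X - x%:P) =
       \prod_(c <- [seq kappa c | c <- enum k]) ('X - c%:P).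
      rewrite big_map big_enum /=; apply: eq_bigr => c _.
      by rewrite rmorphB /= map_polyX map_polyC.
    by rewrite root_prod_XsubC => /mapP [c _ ->]; exists c.
  have [v vE] := rS c.
  have /unr_res0 [y yE] : r (z - i v) = 0 by rewrite rmorphB (unr_res hO) cE vE subrr.
  exists (v, y); rewrite /= -yE addrC subrK; split=> //.
  apply/eqP; rewrite -subr_eq0; apply/eqP/(@unr_regular 1).
  by rewrite expr1 mulrBr -{1}[i pi]sgi -rmorphM -yE rmorphB sz sgi subrr.
move=> sw.
have /choice [st stE] : forall z, exists vz : V * O,
    sg z = z -> sg vz.2 = vz.2 /\ z = i vz.1 + i pi * vz.2.
  move=> z; have [/step [vz h]|n] := pselect (sg z = z); first by exists vz.
  by exists (0, 0).
pose ws n := iter n (fun z => (st z).2) w.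
have wsE n : sg (ws n) = ws n by elim: n => [//|n ih]; have [] := stE _ ih.
have [v vE] := compl (fun n => (st (ws n)).1); exists v.
apply/eqP; rewrite -subr_eq0; apply/eqP/unr_separated => n.
have -> : w = i (\sum_(l < n) pi ^+ l * (st (ws l)).1) + i pi ^+ n * ws n.
  elim: n => [|n ih]; first by rewrite big_ord0 rmorph0 mul1r add0r.
  rewrite {1}ih big_ord_recr /= rmorphD -addrA rmorphM rmorphXn exprSr -mulrA -mulrDr.
  by congr (_ + _ * _); have [_ {1}->] := stE _ (wsE n).
rewrite addrAC -rmorphB; apply: dividesD; last exact: divides_mulr.
by rewrite -rmorphXn; apply/divides_rmorph/dividesBC/vE.
Qed.

End Unramified.

(** Frobenius rigidity with the identity in the role of the Frobenius: modulo
    [pi] every element of the source is its own [q^n]-th power. *)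
Lemma unr_rigid (O1 : comNzRingType) (i1 : {rmorphism V -> O1}) (L1 : fieldType)
    (kappa1 : {rmorphism k -> L1}) (r1 : {rmorphism O1 -> L1})
    (O2 : comNzRingType) (i2 : {rmorphism V -> O2}) (L2 : fieldType)
    (kappa2 : {rmorphism k -> L2}) (r2 : {rmorphism O2 -> L2}) n
    (g g' : {rmorphism O1 -> O2}) :
  unramified i1 kappa1 r1 -> unramified i2 kappa2 r2 ->
  (0 < n)%N -> (forall x : L1, x ^+ (q ^ n) = x) ->
  (forall v, g (i1 v) = i2 v) -> (forall v, g' (i1 v) = i2 v) ->
  (forall w, r2 (g w) = r2 (g' w)) -> g =1 g'.
Proof.
move=> h1 h2 n0 fermat gi g'i res.
apply: (@frobenius_rigidity O1 O2 (q ^ n) (i2 pi) g g' id idfun) => //.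
- exact: unr_separated h2.
- by rewrite -expnM; apply: unr_divides_q; rewrite muln_gt0 base_a_gt0.
- move=> w; have /(unr_res0 h1) [w' w'E] : r1 (w - w ^+ (q ^ n)) = 0.
    by rewrite rmorphB rmorphXn fermat subrr.
  exists (i1 pi), w'; split; first by rewrite -w'E addrC subrK.
    by rewrite gi; apply: divides_refl.
  by rewrite gi g'i.
- by move=> w; apply/(unr_res0 h2); rewrite rmorphB res subrr.
Qed.

(** The residual equation is separable because it divides [X^(q^n) - X]. *)
Lemma unr_lift (O1 : comNzRingType) (i1 : {rmorphism V -> O1}) (L1 : fieldType)
    (kappa1 : {rmorphism k -> L1}) (r1 : {rmorphism O1 -> L1})
    (O2 : comNzRingType) (i2 : {rmorphism V -> O2}) (L2 : fieldType)
    (kappa2 : {rmorphism k -> L2}) (r2 : {rmorphism O2 -> L2}) n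
    alpha P (eps : {rmorphism L1 -> L2}) :
  unramified i1 kappa1 r1 -> unramified i2 kappa2 r2 ->
  monogenic i1 alpha P -> monogenic kappa1 (r1 alpha) (map_poly (bres S) P) ->
  (0 < n)%N -> (forall x : L1, x ^+ (q ^ n) = x) ->
  (forall c, eps (kappa1 c) = kappa2 c) ->
  exists g : {rmorphism O1 -> O2},
    (forall v, g (i1 v) = i2 v) /\ (forall w, r2 (g w) = eps (r1 w)).
Proof.
move=> h1 h2 mon [_ _ ker] n0 fermat epsk.
apply: (@monogenic_lift V O1 O2 L1 L2 i1 alpha P r1 (i2 pi) r2 i2 eps) => //.
- exact: unr_flat h2.
- by move=> v; rewrite (unr_res h1) (unr_res h2) epsk.
rewrite deriv_map (residue_horner (unr_res h1)).
have Q1 : (1 < q ^ n)%N.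
  by rewrite -(expn0 q) ltn_exp2l // -(base_card S) finNzRing_gt1.
have /ker [h hE] : (map_poly kappa1 ('X^(q ^ n) - 'X)).[r1 alpha] = 0.
  by rewrite rmorphB /= map_polyXn map_polyX !hornerE fermat subrr.
have Q0 : (q ^ n)%:R = 0 :> k.
  by rewrite natrX -(base_card S) base_card0 expr0n -[n == 0%N]negbK -lt0n n0.
have Pa : (map_poly kappa1 (map_poly (bres S) P)).[r1 alpha] = 0.
  by apply/ker; exists 1; rewrite mul1r.
have := congr1 (fun g => (map_poly kappa1 g^`()).[r1 alpha]) hE.
rewrite derivB derivX derivXn -mulr_natl derivM.
have -> : (q ^ n)%:R = 0 :> {poly k} by rewrite -polyC_natr Q0.
rewrite mul0r sub0r rmorphN rmorph1 rmorphD !rmorphM /= hornerD !hornerM Pa.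
rewrite mulr0 add0r hornerN hornerC deriv_map => e.
by apply: contra_eqN e => /eqP ->; rewrite mulr0 oppr_eq0 oner_eq0.
Qed.

End Base.

(** * The rings V(x) and their comparison *)

Section Comparison.
Variables (p a : nat) (S : base p a).
Notation V := (bV S).
Notation k := (bk S).
Notation pi := (bpi S).
Notation q := (p ^ a)%N.

(** A ring receiving all the [V(x)] with [deg x <= n], in which the local
    contributions can be added and compared. *)
Record comparison_ring (n : nat) := ComparisonRing {
  cL : finFieldType;
  ck : {rmorphism k -> cL};
  cO :> comNzRingType;
  cV : {rmorphism V -> cO};
  cres : {rmorphism cO -> cL};
  csg : {rmorphism cO -> cO};
  c_unr : unramified cV ck cres;
  csg_V : forall v, csg (cV v) = cV v;
  csg_res : forall w, cres (csg w) = cres w ^+ q;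
  c_split : forall m (f : {poly cL}), (0 < m <= n)%N -> f %| 'X^(q ^ m) - 'X ->
    exists rs : seq cL, uniq rs /\ f %= \prod_(z <- rs) ('X - z%:P)
}.

Lemma monic_lift (f : {poly k}) : f \is monic ->
  exists P : {poly V}, [/\ P \is monic, map_poly (bres S) P = f & size P = size f].
Proof.
move=> mf; have f0 : (0 < size f)%N by rewrite size_poly_gt0 monic_neq0.
pose d := (size f).-1.
have [h [hE sh]] := map_poly_surj (base_flat S) (f - 'X^d).
have lt : (size (f - 'X^d)%R <= d)%N.
  apply/leq_sizeP => j; rewrite leq_eqVlt coefB coefXn => /orP[/eqP <-|lt].
    by rewrite eqxx -lead_coefE (monicP mf) subrr.
  rewrite (gtn_eqF lt) subr0 nth_default //.
  by rewrite -(prednK f0).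
have szh : (size h < size ('X^d : {poly V}))%N.
  by rewrite size_polyXn ltnS (leq_trans sh).
exists ('X^d + h); split.
- by rewrite monicE lead_coefDl // lead_coefXn.
- by rewrite rmorphD /= map_polyXn hE addrC subrK.
- by rewrite size_polyDl // size_polyXn prednK.
Qed.

(** Take [V[t] / (P)], where [P] lifts the minimal polynomial of a generator of
    the field of [big_field_exists]. *)
Lemma comparison_ring_exists n : inhabited (comparison_ring n).
Proof.
have [L0 splitL] := big_field_exists n (base_card0 S).
pose L : fieldExtType k := finvect_type L0.
have [al [f [mon sf]]] := fieldExt_monogenic L.
have [mf _ _] := mon; have [P [mP PE sP]] := monic_lift mf.
have d0 : (0 < \dim {:L})%N by rewrite adim_gt0.
have monO : monogenic (qpolyC P) (qpolyX P) P.
  by apply: qpoly_monogenic => //; rewrite sP sf.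
have [|r [ri ra]] := @monogenic_hom _ _ _ _ _ _ (in_alg L \o bres S) al monO.
  have := mon => -[_ _ ker]; rewrite map_poly_comp PE; apply/ker.
  by exists 1; rewrite mul1r.
have resmon : monogenic (in_alg L) (r (qpolyX P)) (map_poly (bres S) P).
  by rewrite ra PE.
have hO : unramified (qpolyC P) (in_alg L) r.
  by split=> //; apply: (flat_lift_of_monogenic (base_flat S) ri monO).
have fermat (x : L) : x ^+ (q ^ \dim {:L}) = x.
  by rewrite -(base_card S) fieldExt_fermat.
have [fr frE] := @frobenius_rmorph L p a (unr_pchar (S:=S) (in_alg L)).
have [|sg [sgi sgr]] := unr_lift (eps := fr)
    hO hO monO resmon d0 fermat.
  by move=> c; rewrite frE -rmorphXn -(base_card S) expf_card.
constructor; apply: (@ComparisonRing n (finvect_type L0) (in_alg L) _ (qpolyC P) r sg).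
- exact: hO.
- exact: sgi.
- by move=> w; rewrite sgr frE.
- move=> m g hm; rewrite -(base_card S); exact: splitL.
Qed.

Section Teichmueller.
Variables (B B0 : comPzRingType) (sB : {rmorphism V -> B}) (rB : {rmorphism B -> B0}).
Variables (D : dagger sB rB) (x : closed_point B0) (T : teichmueller D x).

(** [W(k(x))] is [W(k)[t] / (P)], so [W(k(x)) \otimes V] is [V[t] / (P)]. *)
Lemma tV_monogenic : exists alpha P,
  monogenic (tinV T) alpha P /\
  monogenic (in_alg (tk T)) (tres T alpha) (map_poly (bres S) P).
Proof.
have [al0 [f [mon sf]]] := fieldExt_monogenic (tk T).
have [[WS _] _ _] := tW_witt T; have [alW alWE] := WS al0.
have d0 : (0 < \dim {:tk T})%N by rewrite adim_gt0.
have fW : flat_lift (tWW T p%:R) (tWres T) by rewrite rmorph_nat; apply: tW_witt.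
have monW0 : monogenic (in_alg (tk T)) (tWres T alW) f by rewrite alWE.
have [PW [PWE monW]] := monogenic_of_flat_lift (kappa := in_alg (tk T))
  (base_witt S : flat_lift _ (bWres S)) (tWW_res T) fW monW0.
pose P := map_poly (bWV S) PW.
have rP : map_poly (bres S) P = f.
  by rewrite -map_poly_comp -PWE; apply: eq_map_poly => w /=; apply: base_WV.
have [mPW _ kerW] := monW.
have mP : P \is monic by apply: monic_map.
have sP : (1 < size P)%N.
  rewrite size_map_poly_id0 ?(monicP mPW) ?rmorph1 ?oner_neq0 //.
  have := congr1 (size \o polyseq) PWE; rewrite /= size_map_poly_id0 => [->|].
    by rewrite sf.
  by rewrite (monicP mPW) rmorph1 oner_neq0.
have monU := qpoly_monogenic mP sP.
have PWa : (map_poly (tWW T) PW).[alW] = 0 by apply/kerW; exists 1; rewrite mul1r.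
have [|g1 [g1i g1a]] := @monogenic_hom _ _ _ _ _ _ (qpolyC P \o bWV S) (qpolyX P) monW.
  by rewrite map_poly_comp; have [_ _ ker] := monU; apply/ker; exists 1; rewrite mul1r.
have [tens ump] := tV_tensor T.
have [[g [gW gV]] _] := ump _ g1 (qpolyC P) g1i.
have PV : (map_poly (tinV T) P).[tinW T alW] = 0.
  rewrite -map_poly_comp.
  have -> : map_poly (tinV T \o bWV S) PW = map_poly (tinW T) (map_poly (tWW T) PW).
    by rewrite -map_poly_comp; apply: eq_map_poly => w /=; rewrite tens.
  by rewrite horner_map /= PWa rmorph0.
have [b [bi ba]] := monogenic_hom monU PV.
have bg : b \o g =1 idfun.
  have [_ uniq] := ump _ (tinW T) (tinV T) tens.
  apply: (uniq (b \o g) idfun) => [w|v] /=; last by rewrite gV bi.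
  apply: (monogenic_ext (g := b \o g \o tinW T) (g' := tinW T) monW) => [v|] /=.
    by rewrite gW g1i /= bi tens.
  by rewrite gW g1a ba.
exists (tinW T alW), P; split; last by rewrite tres_W alWE rP.
have [_ spanU kerU] := monU.
have gh h : g (map_poly (tinV T) h).[tinW T alW] = (map_poly (qpolyC P) h).[qpolyX P].
  rewrite -horner_map /= gW g1a -map_poly_comp; congr horner.
  by apply: eq_map_poly => v /=; rewrite gV.
split=> // [z|h].
  have [h hE] := spanU (g z); exists h; have := bg z; rewrite /= hE => <-.
  rewrite -horner_map /= ba -map_poly_comp; congr horner.
  by apply: eq_map_poly => v /=; rewrite bi.
split=> [h0|[h' ->]]; last by rewrite rmorphM /= hornerM PV mulr0.
by apply/kerU; rewrite -gh h0 rmorph0.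
Qed.

Lemma tV_unramified : unramified (tinV T) (in_alg (tk T)) (tres T).
Proof.
have [al [P [mon mon0]]] := tV_monogenic.
split; last exact: tres_V.
exact: (flat_lift_of_monogenic (kappa := in_alg (tk T)) (base_flat S) (tres_V T) mon mon0).
Qed.

Lemma tsigma_id v : tsigma T (tinV T v) = tinV T v.
Proof. by rewrite tsigma_V base_sigma_id. Qed.

Lemma tsigma_res w : tres T (tsigma T w) = tres T w ^+ q.
Proof.
have [tens ump] := tV_tensor T.
have [fr frE] := @frobenius_rmorph (tk T) p a (unr_pchar (S:=S) (in_alg (tk T))).
have compat w' : (fr \o tWres T) (tWW T w') = (fr \o in_alg (tk T) \o bres S) (bWV S w').
  by rewrite /= tWW_res base_WV.
have [_ uniq] := ump _ (fr \o tWres T) (fr \o in_alg (tk T) \o bres S) compat.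
rewrite -frE; apply: (uniq (tres T \o tsigma T) (fr \o tres T)) => [z|v] /=.
  by rewrite tsigma_W !tres_W tWfrob_res frE.
rewrite tsigma_V base_sigma_id !tres_V frE.
by rewrite -[RHS](rmorphXn (in_alg (tk T)) q (bres S v)) -(base_card S) expf_card.
Qed.

Lemma tk_fermat (z : tk T) : z ^+ (q ^ \dim {:tk T}) = z.
Proof. by rewrite -(base_card S) fieldExt_fermat. Qed.

Lemma tV_invariants w : tsigma T w = w -> exists v, w = tinV T v.
Proof. exact: unr_invariants tV_unramified (tsigma T) tsigma_id tsigma_res w. Qed.

Lemma tsigma_order w : iter (\dim {:tk T}) (tsigma T) w = w.
Proof.
have [sg sgE] : exists sg : {rmorphism tV T -> tV T}, sg =1 iter (\dim {:tk T}) (tsigma T).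
  elim: (\dim _) => [|m [sg sgE]]; first by exists idfun.
  by exists (tsigma T \o sg) => z /=; rewrite sgE.
rewrite -sgE; apply: (unr_rigid (n := \dim {:tk T}) (g := sg) (g' := idfun)
  tV_unramified tV_unramified) => //.
- by rewrite adim_gt0.
- exact: tk_fermat.
- move=> v; rewrite sgE; elim: (\dim _) => [//|m ih]; by rewrite iterS ih tsigma_id.
- move=> z; rewrite sgE /= -[in RHS](tk_fermat (tres T z)).
  elim: (\dim _) => [|m ih]; first by rewrite expn0 expr1.
  by rewrite iterS tsigma_res ih -exprM expnSr.
Qed.

(** Etaleness lifts the embedding of residue fields, and rigidity makes the lift
    commute with the Frobenius morphisms. *)
Lemma tV_lift n (c : comparison_ring n) (eps : {rmorphism tk T -> cL c}) :
  (forall u, eps (in_alg (tk T) u) = ck c u) ->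
  exists g : {rmorphism tV T -> c},
    [/\ forall v, g (tinV T v) = cV c v, forall w, cres c (g w) = eps (tres T w) &
        forall w, g (tsigma T w) = csg c (g w)].
Proof.
move=> epsk; have [al [P [mon mon0]]] := tV_monogenic.
have d0 : (0 < \dim {:tk T})%N by rewrite adim_gt0.
have [g [gi gr]] := unr_lift tV_unramified (c_unr c) mon mon0 d0 tk_fermat epsk.
exists g; split=> //.
apply: (unr_rigid (n := \dim {:tk T}) (g := g \o tsigma T) (g' := csg c \o g)
  tV_unramified (c_unr c)) => //.
- exact: tk_fermat.
- by move=> v /=; rewrite tsigma_id gi.
- by move=> v /=; rewrite gi csg_V.
- by move=> w /=; rewrite gr csg_res gr tsigma_res rmorphXn.
Qed.

End Teichmueller.

End Comparison.

(** * Characteristic power series of matrices *)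

(** Both sides are the determinant of the block matrix with rows [1, A] and
    [B, 1]. *)
Lemma det_1subM (R : comNzRingType) m n (A : 'M[R]_(m, n)) (B : 'M[R]_(n, m)) :
  \det (1%:M - A *m B) = \det (1%:M - B *m A).
Proof.
have e1 : block_mx 1%:M A B 1%:M =
    block_mx 1%:M 0 B 1%:M *m block_mx 1%:M A 0 (1%:M - B *m A) :> 'M[R]_(m + n).
  by rewrite mulmx_block !mul1mx !mul0mx !mulmx1 ?mulmx0 !addr0 [B *m A + _]addrC subrK.
have e2 : block_mx 1%:M A B 1%:M =
    block_mx 1%:M A 0 1%:M *m block_mx (1%:M - A *m B) 0 B 1%:M :> 'M[R]_(m + n).
  by rewrite mulmx_block !mul1mx !mul0mx !mulmx1 ?mulmx0 ?add0r subrK.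
have := congr1 (@determinant R _) e1; rewrite {1}e2 !det_mulmx.
by rewrite !det_ublock !det_lblock !det1 !mul1r !mulr1.
Qed.

Lemma deriv_prod (R : comNzRingType) (I : finType) (f : I -> {poly R}) (P : pred I) :
  (\prod_(i | P i) f i)^`() =
  \sum_(i | P i) (f i)^`() * \prod_(j | P j && (j != i)) f j.
Proof.
have [n le] := ubnP #|P|; elim: n => // n ih in P le *.
have [i Pi|P0] := pickP P; last first.
  by rewrite !big_pred0 // derivC.
rewrite (bigD1 i) //= derivM ih; last first.
  move: le; rewrite (cardD1 i) [i \in P]Pi add1n ltnS; congr (_ < _)%N.
  by apply: eq_card => j; rewrite !inE andbC.
rewrite [RHS](bigD1 i) //=; congr (_ + _); rewrite big_distrr /=.
apply: eq_bigr => j /andP[Pj ji]; rewrite mulrCA; congr (_ * _).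
rewrite [RHS](bigD1 i) /=; last by rewrite Pi eq_sym ji.
by congr (_ * _); apply: eq_bigl => l; rewrite andbAC.
Qed.

(** Jacobi's formula. *)
Lemma deriv_det (R : comNzRingType) m (A : 'M[{poly R}]_m) :
  (\det A)^`() = \tr (map_mx (@deriv R) A *m \adj A).
Proof.
transitivity (\sum_i \sum_j (A i j)^`() * cofactor A i j); last first.
  by apply: eq_bigr => i _; rewrite !mxE; apply: eq_bigr => j _; rewrite !mxE.
have dsign (b : bool) (g : {poly R}) : ((-1) ^+ b * g)^`() = (-1) ^+ b * g^`().
  by rewrite !mulr_sign; case: b; rewrite ?derivN.
rewrite /determinant raddf_sum /=.
under eq_bigr => s _ do rewrite dsign deriv_prod mulr_sumr.
rewrite exchange_big /=; apply: eq_bigr => i _.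
rewrite (partition_big (fun s : 'S_m => s i) predT) //=; apply: eq_bigr => j _.
rewrite expand_cofactor mulr_sumr; apply: eq_bigr => s /eqP <-.
rewrite mulrCA; congr (_ * (_ * _)).
by apply: eq_bigl => l; rewrite eq_sym.
Qed.

(** By Jacobi's formula and the geometric series for the inverse of
    [1 - t^d M], the logarithmic derivative of [det (1 - t^d M)] is
    [- \sum_j d tr(M^j) t^(d j - 1)]. *)
Lemma newton_det (R : comNzRingType) m d (M : 'M[R]_m) n : (0 < d)%N ->
  let P := \det (1%:M - 'X^d *: map_mx polyC M) in
  divides ('X^(n.+1)) (- ('X * P^`()) -
    P * \sum_(j < n) (d%:R * \tr (M ^+ j.+1))%:P * 'X^(d * j.+1)).
Proof.
move=> d0 P; pose Mp := map_mx polyC M; pose N := 'X^d *: Mp; pose A := 1%:M - N.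
have NE j : N ^+ j = 'X^(d * j) *: map_mx polyC (M ^+ j).
  elim: j => [|j ih]; first by rewrite !expr0 muln0 expr0 scale1r map_mx1.
  rewrite exprS ih [M ^+ j.+1]exprS -!mulmxE map_mxM /N -scalemxAl -scalemxAr scalerA.
  by rewrite -exprD mulnS.
have geo : A *m (\sum_(j < n) N ^+ j) = 1%:M - N ^+ n.
  have e : (N - 1%:M) *m (\sum_(j < n) N ^+ j) = N ^+ n - 1%:M.
    by symmetry; apply: subrX1.
  by rewrite /A -[1%:M - N]opprB mulNmx e opprB.
have adjA : \adj A = P *: (\sum_(j < n) N ^+ j) + \adj A *m N ^+ n.
  rewrite -mul_scalar_mx -mul_adj_mx -mulmxA geo mulmxBr mulmx1 subrK //.
have dA : 'X *: map_mx (@deriv R) A = - (d%:R *: N).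
  have Xd : 'X^d = 'X * 'X^(d.-1) :> {poly R} by rewrite -exprS prednK.
  apply/matrixP => i j; rewrite !mxE derivB.
  have -> : ((i == j)%:R : {poly R})^`() = 0.
    by case: (i == j); rewrite ?mulr1n ?mulr0n -?polyC1 ?derivC ?deriv0.
  rewrite derivM derivXn derivC mulr0 addr0 sub0r -mulr_natl Xd; ring.
have trE : - ('X * P^`()) = d%:R * \tr (N *m \adj A).
  have -> : 'X * P^`() = \tr (('X *: map_mx (@deriv R) A) *m \adj A).
    by rewrite -scalemxAl mxtraceZ -deriv_det.
  by rewrite dA mulNmx linearN /= opprK -scalemxAl mxtraceZ.
rewrite trE adjA mulmxDr linearD /= -scalemxAr mxtraceZ mulrDr.
have -> : d%:R * (P * \tr (N *m \sum_(j < n) N ^+ j)) =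
  P * \sum_(j < n) (d%:R * \tr (M ^+ j.+1))%:P * 'X^(d * j.+1).
  rewrite mulrCA; congr (_ * _); rewrite mulmx_sumr raddf_sum mulr_sumr.
  apply: eq_bigr => j _; rewrite -[_ *m _]exprS NE /= mxtraceZ.
  rewrite trace_map_mx polyCM polyC_natr; ring.
rewrite addrC addKr.
have -> : N *m (\adj A *m N ^+ n) = 'X^(n.+1) *: ('X^(d * n + d - n.+1) *:
   (Mp *m \adj A *m map_mx polyC (M ^+ n))).
  rewrite NE -!scalemxAl -!scalemxAr !scalerA mulmxA; congr (_ *: _).
  rewrite -!exprD; congr ('X^_).
  have : (n <= d * n)%N by rewrite leq_pmull.
  by move: d0; clear; lia.
by rewrite mxtraceZ mulrCA; apply: divides_mulr.
Qed.

(** * Logarithmic derivatives of truncated power series *)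

Section LogDerivative.
Variable R : comNzRingType.
Implicit Types P Q T : {poly R}.

Lemma dividesXnP n P : divides 'X^n P <-> forall j, (j < n)%N -> P`_j = 0.
Proof.
split=> [[s ->] j lt|h]; first by rewrite coefXnM lt.
exists (drop_poly n P); apply/polyP => j; rewrite coefXnM coef_drop_poly.
by case: ltnP => [/h //|le]; rewrite subnK.
Qed.

(** [T] is the logarithmic derivative [t P'(t) / P(t)] modulo [t^n.+1]. *)
Definition log_deriv n P T := divides 'X^(n.+1) ('X * P^`() - P * T).

Lemma log_deriv_prod n I (r : seq I) (P T : I -> {poly R}) :
  (forall i, log_deriv n (P i) (T i)) ->
  log_deriv n (\prod_(i <- r) P i) (\sum_(i <- r) T i).
Proof.
move=> h; elim: r => [|i r ih].
  rewrite !big_nil /log_deriv -polyC1 derivC mulr0 mulr0 subrr; exact: divides0.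
rewrite !big_cons /log_deriv derivM.
have -> : 'X * ((P i)^`() * \prod_(j <- r) P j + P i * (\prod_(j <- r) P j)^`())
  - P i * (\prod_(j <- r) P j) * (T i + \sum_(j <- r) T j) =
  (\prod_(j <- r) P j) * ('X * (P i)^`() - P i * T i) +
  P i * ('X * (\prod_(j <- r) P j)^`() - (\prod_(j <- r) P j) * \sum_(j <- r) T j).
  ring.
by apply: dividesD; apply: dividesMl => //; apply: h.
Qed.

Lemma trunc_invE n P : P * trunc_inv n P = 1 - (1 - P) ^+ n.+1.
Proof.
rewrite /trunc_inv; have := subrX1 (1 - P) n.+1.
have -> : 1 - P - 1 = - P by ring.
by rewrite mulNr => /(congr1 -%R); rewrite opprB opprK => ->.
Qed.

Lemma trunc_inv_coef0 n P : P`_0 = 1 -> (trunc_inv n P)`_0 = 1.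
Proof.
move=> P0; rewrite /trunc_inv coef_sum big_ord_recl expr0 coef1 /= big1 ?addr0 //.
by move=> i _; rewrite exprS coef0M coefB coef1 P0 subrr mul0r.
Qed.

Lemma trunc_inv_log_deriv n P T : P`_0 = 1 ->
  divides 'X^(n.+1) (- ('X * P^`()) - P * T) -> log_deriv n (trunc_inv n P) T.
Proof.
move=> P0 h; set Q := trunc_inv n P; pose E := (1 - P) ^+ n.+1.
have PQ : P * Q = 1 - E by exact: trunc_invE.
have [e eE] : divides 'X (1 - P).
  have := dividesXnP 1 (1 - P); rewrite expr1 => [[_]]; apply=> -[] // _.
  by rewrite coefB coef1 P0 subrr.
have EE : E = 'X^(n.+1) * e ^+ n.+1 by rewrite /E eE exprMn.
have hE : divides 'X^(n.+1) E by rewrite EE; apply: divides_mulr.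
have hE' : divides 'X^(n.+1) ('X * E^`()).
  rewrite EE derivM derivXn mulrDr; apply: dividesD.
    exists ((n.+1)%:R * e ^+ n.+1).
    rewrite -[X in 'X * (X * _)]mulr_natl /= ['X^(n.+1)]exprS.
    by move: (n.+1%:R) (e ^+ _) => c u; ring.
  by rewrite mulrCA; apply: divides_mulr.
have PQ' : P^`() * Q + P * Q^`() = - E^`().
  by rewrite -derivM PQ derivB -polyC1 derivC sub0r.
rewrite /log_deriv.
have -> : 'X * Q^`() - Q * T = E * ('X * Q^`() - Q * T) - Q * ('X * E^`())
   + Q * Q * (- ('X * P^`()) - P * T).
  have -> : E^`() = - (P^`() * Q + P * Q^`()) by rewrite PQ' opprK.
  have -> : E = 1 - P * Q by rewrite PQ; ring.
  ring.
apply: dividesD; last exact: dividesMl.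
by apply: dividesB; [apply: dividesMr | apply: dividesMl].
Qed.

Lemma log_deriv_coef n P T m : log_deriv n P T -> (m <= n)%N ->
  m%:R * P`_m = \sum_(j < m.+1) T`_j * P`_(m - j).
Proof.
move=> /dividesXnP h mn; have := h m mn; rewrite coefB coefXM mulrC coefM => /eqP.
rewrite subr_eq0 => /eqP <-; rewrite coef_deriv.
by case: (m) => [|l] /=; rewrite ?mul0r // mulr_natl.
Qed.

End LogDerivative.

(** A power series with constant term 1 is determined by its logarithmic
    derivative, in characteristic 0. *)
Lemma log_deriv_rescale (R : idomainType) n (P P' T T' : {poly R}) c :
  (forall m, m%:R = 0 :> R -> m = 0%N) ->
  log_deriv n P T -> log_deriv n P' T' -> P`_0 = 1 -> P'`_0 = 1 ->
  T`_0 = 0 -> T'`_0 = 0 ->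
  (forall j, (0 < j <= n)%N -> T'`_j = c ^+ j * T`_j) ->
  forall m, (m <= n)%N -> P'`_m = c ^+ m * P`_m.
Proof.
move=> ch hP hP' P0 P'0 T0 T'0 hT m; have [l le] := ubnP m.
elim: l m le => // l ih m ml mn; case: m ml mn => [|m] ml mn.
  by rewrite P0 P'0 expr0 mulr1.
have m0 : (m.+1)%:R != 0 :> R by apply/eqP => /ch.
apply: (mulfI m0); rewrite (log_deriv_coef hP' mn) mulrCA (log_deriv_coef hP mn).
rewrite mulr_sumr big_ord_recl [RHS]big_ord_recl T0 T'0 !mul0r mulr0 !add0r.
apply: eq_bigr => j _; have lj := ltn_ord j.
rewrite hT; last by rewrite /= (leq_trans _ mn).
rewrite ih; last 2 first.
- by rewrite lift0; move: lj ml; clear; lia.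
- by rewrite lift0; move: lj mn; clear; lia.
rewrite mulrACA -exprD; congr (c ^+ _ * _).
rewrite lift0; move: lj; clear; lia.
Qed.

(** * Iterates of a semilinear map *)

Lemma frobenius_iter_map (R R' : comPzRingType) (F : {rmorphism R -> R})
    (F' : {rmorphism R' -> R'}) (g : {rmorphism R -> R'}) m (C : 'M[R]_m) n :
  (forall w, g (F w) = F' (g w)) ->
  map_mx g (frobenius_iter_mx F C n) = frobenius_iter_mx F' (map_mx g C) n.
Proof.
move=> gF; elim: n => [|n ih] /=; first by rewrite map_mx1.
rewrite map_mxM -ih -!map_mx_comp; congr (_ *m _).
by apply/matrixP => i j; rewrite !mxE /= gF.
Qed.

Section FrobeniusIter.
Variables (R : comPzRingType) (F : {rmorphism R -> R}).

Lemma iter_map_mx m n (A : 'M[R]_(m, n)) d :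
  iter d (map_mx F) A = map_mx (iter d F) A.
Proof.
elim: d => [|d ih]; first by apply/matrixP => i j; rewrite !mxE.
by rewrite iterS ih; apply/matrixP => i j; rewrite !mxE.
Qed.

Lemma frobenius_iter_add m (C : 'M[R]_m) n1 n2 :
  frobenius_iter_mx F C (n1 + n2) =
  frobenius_iter_mx F C n1 *m iter n1 (map_mx F) (frobenius_iter_mx F C n2).
Proof.
elim: n1 => [|n1 ih]; first by rewrite /= mul1mx.
by rewrite addSn /= ih map_mxM mulmxA.
Qed.

Variable d : nat.
Hypothesis Fd : forall w, iter d F w = w.

Lemma iter_map_mx_id m n (A : 'M[R]_(m, n)) : iter d (map_mx F) A = A.
Proof. by rewrite iter_map_mx; apply/matrixP => i j; rewrite mxE Fd. Qed.

Lemma frobenius_iter_exp m (C : 'M[R]_m) j :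
  frobenius_iter_mx F C (d * j) = frobenius_iter_mx F C d ^+ j.
Proof.
elim: j => [|j ih]; first by rewrite muln0 expr0.
by rewrite mulnS frobenius_iter_add iter_map_mx_id ih exprS.
Qed.

(** The twist by Frobenius of the matrix [C K] of [phi^d] is [K C], so that the
    traces of its powers are invariant. *)
Lemma frobenius_iter_cyclic m (C : 'M[R]_m) : (0 < d)%N ->
  exists K, frobenius_iter_mx F C d = C *m K /\
            map_mx F (frobenius_iter_mx F C d) = K *m C.
Proof.
move=> d0; exists (map_mx F (frobenius_iter_mx F C d.-1)).
have e : d = (d.-1 + 1)%N by rewrite addn1 prednK.
split; first by rewrite -[in LHS](prednK d0).
rewrite {1}e frobenius_iter_add /= map_mx1 mulmx1 map_mxM; congr (_ *m _).
by rewrite -iterS prednK // iter_map_mx_id.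
Qed.

Lemma frobenius_iter_basis m m' (C : 'M[R]_m) (C' : 'M[R]_m') (U : 'M[R]_(m, m')) :
  U *m C' = C *m map_mx F U ->
  U *m frobenius_iter_mx F C' d = frobenius_iter_mx F C d *m U.
Proof.
move=> h; rewrite -[in RHS](iter_map_mx_id U).
elim: (d) => [|n ih]; first by rewrite /= mulmx1 mul1mx.
by rewrite /= mulmxA h -!mulmxA -!map_mxM ih.
Qed.

End FrobeniusIter.

Lemma trace_cyclic_exp (R : comPzRingType) m (C K : 'M[R]_m) j :
  \tr ((C *m K) ^+ j) = \tr ((K *m C) ^+ j).
Proof.
case: j => [//|j]; have h : (C *m K) ^+ j.+1 = C *m (K *m C) ^+ j *m K.
  elim: j => [|j ih]; first by rewrite !expr1 expr0 mulmx1.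
  by rewrite exprSr ih [in RHS]exprSr -!mulmxE !mulmxA.
by rewrite h mxtrace_mulC mulmxA [in RHS]exprS.
Qed.

Section Bases.
Variables (R : comPzRingType) (F : {rmorphism R -> R}) (N : lmodType R) (phi : N -> N).
Hypothesis hphi : is_semilinear F phi.

Lemma semilinear_sum (I : Type) (r : seq I) (c : I -> R) (v : I -> N) :
  phi (\sum_(i <- r) c i *: v i) = \sum_(i <- r) F (c i) *: phi (v i).
Proof.
have phi0 : phi 0 = 0.
  have := hphi 1 0 0; rewrite scale1r addr0 rmorph1 scale1r => /esym/eqP.
  by rewrite -subr_eq0 addrK => /eqP.
by elim: r => [|i r ih]; rewrite ?big_nil // !big_cons hphi ih.
Qed.

Lemma basis_coord_inj m (e : 'I_m -> N) (c c' : 'cV[R]_m) : is_basis e ->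
  \sum_i c i 0 *: e i = \sum_i c' i 0 *: e i -> c = c'.
Proof.
move=> he h; have [x [_ u]] := he (\sum_i c i 0 *: e i).
by rewrite -(u _ erefl) -(u _ h).
Qed.

Lemma basis_mx_inj m n (e : 'I_m -> N) (A A' : 'M[R]_(m, n)) : is_basis e ->
  (forall j, \sum_i A i j *: e i = \sum_i A' i j *: e i) -> A = A'.
Proof.
move=> he h; apply/matrixP => i j.
have : col j A = col j A'.
  apply: (basis_coord_inj he); rewrite -[LHS](_ : \sum_i A i j *: e i = _).
    by rewrite h; apply: eq_bigr => l _; rewrite mxE.
  by apply: eq_bigr => l _; rewrite mxE.
by move/colP/(_ i); rewrite !mxE.
Qed.

Lemma basis_change_sum m m' (e : 'I_m -> N) (e' : 'I_m' -> N) (U : 'M[R]_(m, m'))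
    n (A : 'M[R]_(m', n)) j :
  (forall l, e' l = \sum_i U i l *: e i) ->
  \sum_l A l j *: e' l = \sum_i (U *m A) i j *: e i.
Proof.
move=> eU; under eq_bigr => l _ do rewrite eU scaler_sumr.
rewrite exchange_big /=; apply: eq_bigr => i _; rewrite mxE scaler_suml.
by apply: eq_bigr => l _; rewrite scalerA mulrC.
Qed.

Lemma basis_change m m' (e : 'I_m -> N) (e' : 'I_m' -> N) (C : 'M[R]_m) (C' : 'M[R]_m') :
  is_basis e -> is_basis e' ->
  is_frobenius_matrix phi e C -> is_frobenius_matrix phi e' C' ->
  exists (U : 'M[R]_(m, m')) (U' : 'M[R]_(m', m)),
    [/\ U *m U' = 1%:M, U' *m U = 1%:M & U *m C' = C *m map_mx F U].
Proof.
move=> he he' hC hC'.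
have coords n n' (b : 'I_n -> N) (b' : 'I_n' -> N) : is_basis b ->
    exists U : 'M[R]_(n, n'), forall l, b' l = \sum_i U i l *: b i.
  move=> hb.
  have /choice [c cE] : forall l, exists c : 'cV[R]_n, b' l = \sum_i c i 0 *: b i.
    by move=> l; have [c [hc _]] := hb (b' l); exists c.
  exists (\matrix_(i, l) c l i 0) => l; rewrite {1}cE.
  by apply: eq_bigr => i _; rewrite mxE.
have one n (b : 'I_n -> N) j : b j = \sum_i (1%:M : 'M[R]_n) i j *: b i.
  rewrite (bigD1 j) //= mxE eqxx scale1r big1 ?addr0 // => i ij.
  by rewrite mxE (negPf ij) scale0r.
have [U UE] := coords _ _ e e' he; have [U' U'E] := coords _ _ e' e he'.
exists U, U'; split.
- apply: (basis_mx_inj he) => j; rewrite -(basis_change_sum _ _ UE) -U'E.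
  exact: one.
- apply: (basis_mx_inj he') => j; rewrite -(basis_change_sum _ _ U'E) -UE.
  exact: one.
apply: (basis_mx_inj he) => j; rewrite -(basis_change_sum _ _ UE) -hC' UE.
rewrite semilinear_sum -(basis_change_sum (e' := phi \o e)) ?mxE; last first.
  by move=> l; rewrite /= hC.
by apply: eq_bigr => i _; rewrite mxE.
Qed.

End Bases.

(** * Closed points and geometric points *)

Lemma rmorph_peval (V : nzRingType) (T : comPzRingType) r
    (g : {rmorphism {mpoly V[r]} -> T}) P :
  g P = peval (fun v => g v%:MP) (fun i => g 'X_i) P.
Proof.
rewrite {1}(mpolyE P) rmorph_sum; apply: eq_bigr => m _.
rewrite -mul_mpolyC rmorphM mpolyXE_id rmorph_prod; congr (_ * _).
by apply: eq_bigr => i _; rewrite rmorphXn.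
Qed.

Lemma mpoly_rmorph_ext (V : nzRingType) (T : comPzRingType) r
    (g g' : {rmorphism {mpoly V[r]} -> T}) :
  (forall v, g v%:MP = g' v%:MP) -> (forall i, g 'X_i = g' 'X_i) -> g =1 g'.
Proof.
move=> hC hX P; rewrite !rmorph_peval; apply: eq_bigr => m _; rewrite hC.
by congr (_ * _); apply: eq_bigr => i _; rewrite hX.
Qed.

(** If the remainder [r] of [m] modulo [d = \dim L] were not 0, the [q^d] elements
    of [L] would be roots of [X^(q^r) - X]. *)
Lemma fieldExt_fixed (k : finFieldType) (L : fieldExtType k) m :
  (forall z : L, z ^+ (#|k| ^ m) = z) <-> (\dim {:L} %| m)%N.
Proof.
set d := \dim {:L}; have d0 : (0 < d)%N by rewrite adim_gt0.
have fermat j (z : L) : z ^+ (#|k| ^ (d * j)%N) = z.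
  elim: j => [|j ih]; first by rewrite muln0 expn0 expr1.
  by rewrite mulnS expnD exprM fieldExt_fermat.
split=> [h|/dvdnP [j ->] z]; last by rewrite mulnC fermat.
have h' (z : L) : z ^+ (#|k| ^ (m %% d)%N) = z.
  by rewrite -[RHS]h [in RHS](divn_eq m d) mulnC expnD exprM fermat.
have k1 := finNzRing_gt1 k.
rewrite /dvdn -leqn0 leqNgt; apply/negP => r0.
pose P : {poly finvect_type L} := 'X^(#|k| ^ (m %% d)%N) - 'X.
have sP : size P = (#|k| ^ (m %% d)%N).+1.
  rewrite size_polyDl ?size_polyXn // size_polyN size_polyX ltnS.
  by apply: (leq_trans k1); rewrite -{1}(expn1 #|k|) leq_exp2l.
have P0 : P != 0 by rewrite -size_poly_gt0 sP.
have rP : all (root P) (enum (finvect_type L)).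
  by apply/allP => z _; rewrite rootE !hornerE h' subrr.
have := max_poly_roots P0 rP (enum_uniq _); rewrite -cardE sP ltnS.
have -> : #|finvect_type L| = (#|k| ^ d)%N.
  by rewrite -(card_vspacef (Vector.class (finvect_type L)))
    (card_vspace {:finvect_type L}).
by rewrite leq_exp2l // leqNgt ltn_pmod.
Qed.

Section Points.
Variables (p a : nat) (S : base p a).
Notation V := (bV S).
Notation k := (bk S).
Notation pi := (bpi S).
Notation q := (p ^ a)%N.
Variables (B B0 : comPzRingType) (sB : {rmorphism V -> B}) (rB : {rmorphism B -> B0}).
Variables (D : dagger sB rB) (r : nat) (H : {rmorphism {mpoly V[r]} -> B0}).
Hypothesis HC : forall v : V, H v%:MP = rB (sB v).
Hypothesis Hsurj : is_surj H.
Hypothesis rB_pi : forall b, rB b = 0 -> divides (sB pi) b.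
Variables (n : nat) (c : comparison_ring S n).
Notation L := (cL c).

(** The second condition says that [P] is a morphism of [k]-algebras, as
    [V -> k] is surjective. *)
Definition is_point (u : {ffun 'I_r -> L}) (P : {rmorphism B0 -> L}) : Prop :=
  (forall i, P (H 'X_i) = u i) /\ forall v : V, P (H v%:MP) = ck c (bres S v).

Definition is_teich (P : {rmorphism B0 -> L}) (t : {rmorphism D -> c}) : Prop :=
  [/\ forall v, t (din D (sB v)) = cV c v, forall w, cres c (t w) = P (dred D w) &
      forall w, t (dfrob D w) = csg c (t w)].

Hypothesis rB_pi0 : rB (sB pi) = 0.

Lemma dred_kernel w : dred D w = 0 -> divides (din D (sB pi)) w.
Proof.
have [_ approx _ _ _] := dagger_wc D; move=> w0.
have [b [s]] := approx 1%N w; rewrite expr1 => sE.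
have bE : w = din D b + din D (sB pi) * s by rewrite -sE addrC subrK.
have : rB b = 0.
  by rewrite -(dagger_red D) -w0 bE rmorphD rmorphM /= !dagger_red rB_pi0 mul0r addr0.
move=> /rB_pi hb; rewrite bE; apply: dividesD; first exact: divides_rmorph.
exact: divides_mulr.
Qed.

Lemma teich_unique P (t t' : {rmorphism D -> c}) :
  is_teich P t -> is_teich P t' -> t =1 t'.
Proof.
move=> [tV tr tF] [t'V t'r t'F].
apply: (@frobenius_rigidity D c q (cV c pi) t t' (dfrob D) (csg c)) => //.
- exact: unr_separated (c_unr c).
- by apply: (unr_divides_q (cV c)); apply: (base_a_gt0 S).
- by move=> m y; apply: (unr_sigma_div (c_unr c)); [apply: csg_V | apply: csg_res].
- move=> w; have /dred_kernel [w' w'E] : dred D (dfrob D w - w ^+ q) = 0.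
    by rewrite rmorphB rmorphXn /= dagger_frob_lift subrr.
  exists (din D (sB pi)), w'; split; first by rewrite -w'E addrC subrK.
    by rewrite tV; apply: divides_refl.
  by rewrite tV t'V.
- by move=> w; apply/(unr_res0 (c_unr c)); rewrite rmorphB tr t'r subrr.
Qed.

Lemma point_unique u P P' : is_point u P -> is_point u P' -> P =1 P'.
Proof.
move=> [PX PC] [P'X P'C] b; have [g <-] := Hsurj b.
apply: (@mpoly_rmorph_ext _ _ _ (P \o H) (P' \o H)) => [v|i] /=.
  by rewrite PC P'C.
by rewrite PX P'X.
Qed.

Lemma point_fixed u P m : is_point u P ->
  (forall i, u i ^+ (q ^ m) = u i) -> forall b, P b ^+ (q ^ m) = P b.
Proof.
move=> [PX PC] fixu b; have [g <-] := Hsurj b.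
have [fr frE] := @frobenius_rmorph L p (a * m) (unr_pchar (ck c)).
rewrite -expnM -frE.
apply: (@mpoly_rmorph_ext _ _ _ (fr \o P \o H) (P \o H)) => [v|i] /=.
  rewrite PC frE -rmorphXn; congr (ck c _).
  elim: (m) => [|l ih]; first by rewrite muln0 expn0 expr1.
  by rewrite mulnS expnD exprM -[(p ^ a)%N](base_card S) expf_card ih.
by rewrite PX frE expnM.
Qed.

Definition over (x : closed_point B0) (u : {ffun 'I_r -> L}) : Prop :=
  exists P : {rmorphism B0 -> L}, is_point u P /\ forall b, P b = 0 <-> cp_ideal x b.

(** The kernel of a point is maximal because [L] is finite: every nonzero value
    has a power equal to 1. *)
Lemma point_over u P : is_point u P -> exists x, over x u.
Proof.
move=> hP.
have mx : is_maximal_ideal [set b | P b = 0]%classic.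
  split.
  - split=> [|b b' /= b0 b'0|b b' /= b0]; rewrite /= ?rmorph0 //.
      by rewrite rmorphD b0 b'0 addr0.
    by rewrite rmorphM b0 mulr0.
  - by move=> /= /eqP; rewrite rmorph1 oner_eq0.
  move=> J [J0 JD JM] J1 IJ; apply/predeqP => b; split=> [Jb|]; last exact: IJ.
  apply: contrapT => /eqP Pb; apply: J1.
  have L1 := finNzRing_gt1 L.
  have e : b ^+ #|L|.-1 = b * b ^+ #|L|.-2.
    by rewrite -exprS prednK // -ltnS prednK // ltnW.
  have : J (1 - b ^+ #|L|.-1).
    apply: IJ; rewrite /= rmorphB rmorphXn rmorph1; apply/eqP.
    rewrite subr_eq0 eq_sym; apply/eqP/(mulfI Pb).
    by rewrite -exprS prednK ?expf_card ?mulr1 // ltnW.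
  move/JD => /(_ (b ^+ #|L|.-1)); rewrite subrK; apply.
  by rewrite e mulrC; apply: JM.
by exists (ClosedPoint mx), P.
Qed.

Variable T : forall x : closed_point B0, teichmueller D x.
Notation deg x := (cp_degree T x).

Lemma deg_gt0 x : (0 < deg x)%N.
Proof. by rewrite /cp_degree adim_gt0. Qed.

Lemma over_uniq x x' u : over x u -> over x' u -> x = x'.
Proof.
move=> [P [hP kP]] [P' [hP' kP']].
have e : cp_ideal x = cp_ideal x'.
  apply/predeqP => b; rewrite -kP -kP'; rewrite (point_unique hP hP'); tauto.
case: x x' e {kP kP'} => I hI [I' hI'] /= e.
by subst I'; congr ClosedPoint; apply: Prop_irrelevance.
Qed.

Lemma over_embedding x u P : is_point u P -> (forall b, P b = 0 <-> cp_ideal x b) ->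
  exists eps : {rmorphism tk (T x) -> L},
    (forall b, eps (tev (T x) b) = P b) /\
    (forall z, eps (in_alg (tk (T x)) z) = ck c z).
Proof.
move=> [PX PC] kP.
have [||eps epsE] := @factor_rmorph _ _ _ (tev (T x)) P.
- exact: tev_surj.
- by move=> b /tev_ker /kP.
exists eps; split=> // z.
have [v <-] := (base_residue S).1 z.
by rewrite -PC -epsE HC tev_alg.
Qed.

Lemma over_fixed x u m : over x u ->
  (forall i, u i ^+ (q ^ m) = u i) <-> (deg x %| m)%N.
Proof.
move=> [P [hP kP]]; have [eps [epsE _]] := over_embedding hP kP.
rewrite /cp_degree -fieldExt_fixed; split=> [h z|h i].
  have [b <-] := tev_surj z; apply: (fmorph_inj eps).
  by rewrite rmorphXn /= epsE base_card; exact: (point_fixed hP h).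
have [<- _] := hP.
by rewrite -epsE -rmorphXn /= -(base_card S) h.
Qed.

(** An embedding of [k(x)] in [L] is given by a root in [L] of the minimal
    polynomial of a generator, and it has [deg x] distinct roots. *)
Lemma card_over x : (deg x <= n)%N -> #|[set u | `[< over x u >]]| = deg x.
Proof.
move=> xn; have [al [f [mon sf]]] := fieldExt_monogenic (tk (T x)).
have [mf span ker] := mon.
have fa : (map_poly (in_alg (tk (T x))) f).[al] = 0.
  by apply/ker; exists 1; rewrite mul1r.
have [rs [urs frs]] : exists rs : seq L, uniq rs /\
    map_poly (ck c) f %= \prod_(z <- rs) ('X - z%:P).
  apply: (@c_split _ _ _ _ c (deg x)); first by rewrite deg_gt0 xn.
  have /ker [h hE] :
      (map_poly (in_alg (tk (T x))) ('X^(q ^ deg x) - 'X)).[al] = 0.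
    by rewrite rmorphB /= map_polyXn map_polyX !hornerE tk_fermat subrr.
  have -> : 'X^(q ^ deg x) - 'X = map_poly (ck c) ('X^(q ^ deg x) - 'X).
    by rewrite rmorphB /= map_polyXn map_polyX.
  by rewrite hE rmorphM dvdp_mull.
have srs : size rs = deg x.
  apply/eqP; rewrite -eqSS -(size_prod_XsubC rs id) -(eqp_size frs).
  by rewrite size_map_poly sf.
have [b bE] := tev_surj al; have [g gE] := Hsurj b.
have root_eps (eps : {rmorphism tk (T x) -> L}) :
    (forall z, eps (in_alg (tk (T x)) z) = ck c z) -> eps al \in rs.
  move=> epsk; rewrite -root_prod_XsubC -(eqp_root frs) rootE.
  have -> : map_poly (ck c) f = map_poly eps (map_poly (in_alg (tk (T x))) f).
    by rewrite -map_poly_comp; apply: eq_map_poly => z /=; rewrite epsk.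
  by rewrite horner_map fa rmorph0.
have /choice [eps epsP] : forall z, exists eps : {rmorphism tk (T x) -> L}, z \in rs ->
    (forall y, eps (in_alg (tk (T x)) y) = ck c y) /\ eps al = z.
  have [e0 e0P] : exists e0 : {rmorphism tk (T x) -> L}, True.
    have : (0 < size rs)%N by rewrite srs deg_gt0.
    case: (rs) frs => // z0 rs' frs' _.
    have [|e0 _] := @monogenic_hom _ _ _ _ al f (ck c) z0 mon; last by exists e0.
    apply/eqP; rewrite -[_ == _]/(root _ _) (eqp_root frs') root_prod_XsubC.
    by rewrite mem_head.
  move=> z; case: (boolP (z \in rs)) => zrs; last by exists e0.
  have [|e [ei ea]] := @monogenic_hom _ _ _ _ al f (ck c) z mon; last by exists e.
  by apply/eqP; rewrite -[_ == _]/(root _ _) (eqp_root frs) root_prod_XsubC.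
pose psi z : {ffun 'I_r -> L} := [ffun i => eps z (tev (T x) (H 'X_i))].
have psi_point z : z \in rs -> is_point (psi z) (eps z \o tev (T x)).
  move=> /epsP [ek _]; split=> [i|v]; first by rewrite ffunE.
  by rewrite /= HC tev_alg -ek.
have psi_inj : {in rs &, injective psi}.
  move=> z z' hz hz' e; have [_ <-] := epsP _ hz; have [_ <-] := epsP _ hz'.
  have hp := psi_point _ hz; rewrite e in hp.
  by rewrite -bE; apply: (point_unique hp (psi_point _ hz')).
rewrite -srs -(size_map psi) -(card_uniqP _); last by rewrite map_inj_in_uniq.
apply: eq_card => u; rewrite inE; apply/asboolP/mapP => [[P [hP kP]]|[z hz ->]].
  have [e [eE ek]] := over_embedding hP kP.
  have hz := root_eps e ek; exists (e al) => //.
  have [ek' ea'] := epsP _ hz.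
  apply/ffunP => i; rewrite ffunE; have [<- _] := hP; rewrite -eE.
  by symmetry; apply: (monogenic_ext mon) => // y; rewrite ek ek'.
exists (eps z \o tev (T x)); split; first exact: psi_point.
move=> b' /=; have := @tev_ker p a S B B0 sB rB D x (T x) b' => -[h1 h2].
by split=> [/eqP|/h2 ->]; [rewrite fmorph_eq0 => /eqP /h1 | rewrite rmorph0].
Qed.

(** The Teichmueller lift at [x] followed by the lift of an embedding of [k(x)]. *)
Lemma over_teich x u P : is_point u P -> (forall b, P b = 0 <-> cp_ideal x b) ->
  exists g : {rmorphism tV (T x) -> c},
    [/\ forall v, g (tinV (T x) v) = cV c v,
        forall w, g (tsigma (T x) w) = csg c (g w) & is_teich P (g \o tau (T x))].
Proof.
move=> hP kP; have [eps [epsE epsk]] := over_embedding hP kP.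
have [g [gV gr gs]] := tV_lift epsk; exists g; split=> //.
split=> [v|w|w] /=; first by rewrite tau_alg gV.
  by rewrite gr tau_lift epsE.
by rewrite tau_frob gs.
Qed.

Lemma teich_exists u P : is_point u P -> exists t : {rmorphism D -> c}, is_teich P t.
Proof.
move=> hP; have [x [P' [hP' kP']]] := point_over hP.
have kP b : P b = 0 <-> cp_ideal x b by rewrite (point_unique hP hP').
by have [g [_ _ h]] := over_teich hP kP; exists (g \o tau (T x)).
Qed.

(** * The Euler product and its logarithmic derivative *)

Section LSeries.
Variables (N : lmodType D) (phi : N -> N) (hphi : is_semilinear (dfrob D) phi).
Variables (m : nat) (e : 'I_m -> N) (he : is_basis e).
Variables (C : 'M[D]_m) (hC : is_frobenius_matrix phi e C).

(** The matrix of [phi_x^(deg x)]. *)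
Definition fibre_mx x := frobenius_iter_mx (tsigma (T x)) (map_mx (tau (T x)) C) (deg x).

Lemma fibre_trace_V x j : exists v, \tr (fibre_mx x ^+ j) = tinV (T x) v.
Proof.
apply: tV_invariants; rewrite -trace_map_mx.
have [K [MK sMK]] := frobenius_iter_cyclic (@tsigma_order _ _ _ _ _ _ _ _ _ (T x))
  (map_mx (tau (T x)) C) (deg_gt0 x).
have -> : map_mx (tsigma (T x)) (fibre_mx x ^+ j) =
    (map_mx (tsigma (T x)) (fibre_mx x)) ^+ j.
  elim: j => [|j ih]; first by rewrite !expr0 map_mx1.
  by rewrite !exprS -!mulmxE map_mxM ih.
by rewrite /fibre_mx sMK MK trace_cyclic_exp.
Qed.

(** Frobenius transforms [phi^d = C K] into [K C], so the coefficients are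
    invariant and lie in [V]. *)
Lemma fibre_det_V x : exists P, map_poly (tinV (T x)) P = fibre_det T x C.
Proof.
have [K [MK sMK]] := frobenius_iter_cyclic (@tsigma_order _ _ _ _ _ _ _ _ _ (T x))
  (map_mx (tau (T x)) C) (deg_gt0 x).
have inv : map_poly (tsigma (T x)) (fibre_det T x C) = fibre_det T x C.
  rewrite /fibre_det -det_map_mx map_mxB map_mx1 map_mxZ /= map_polyXn.
  have -> (A : 'M[tV (T x)]_m) : map_mx (map_poly (tsigma (T x))) (map_mx polyC A) =
      map_mx polyC (map_mx (tsigma (T x)) A).
    by apply/matrixP => i j; rewrite !mxE map_polyC.
  rewrite sMK MK !map_mxM scalemxAl det_1subM.
  by rewrite -scalemxAr.
have /choice [s sE] : forall j, exists v, (fibre_det T x C)`_j = tinV (T x) v.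
  by move=> j; apply: tV_invariants; rewrite -coef_map inv.
exists (\poly_(j < size (fibre_det T x C)) s j); apply/polyP => j.
rewrite coef_map coef_poly /=; case: ltnP => [_|le]; first by rewrite sE.
by rewrite rmorph0 nth_default.
Qed.

(** The matrices [U] and [U'] of the change of basis are mutually inverse but
    may have a rectangular shape, which [det_1subM] allows. *)
Lemma fibre_det_basis x m' (e' : 'I_m' -> N) (C' : 'M[D]_m') :
  is_basis e' -> is_frobenius_matrix phi e' C' -> fibre_det T x C' = fibre_det T x C.
Proof.
move=> he' hC'; have [U [U' [UU' U'U hU]]] := basis_change hphi he he' hC hC'.
have hT := frobenius_iter_basis (C := map_mx (tau (T x)) C)
  (C' := map_mx (tau (T x)) C') (U := map_mx (tau (T x)) U)
  (@tsigma_order _ _ _ _ _ _ _ _ _ (T x)).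
have {}hT := hT _; rewrite /fibre_det.
set M' := frobenius_iter_mx _ _ _; set M := frobenius_iter_mx _ _ _.
have hM : map_mx (tau (T x)) U *m M' = M *m map_mx (tau (T x)) U.
  apply: hT; rewrite -map_mxM hU map_mxM -!map_mx_comp; congr (_ *m _).
  by apply/matrixP => i j; rewrite !mxE /= tau_frob.
have -> : M' = map_mx (tau (T x)) U' *m (M *m map_mx (tau (T x)) U).
  by rewrite -hM mulmxA -map_mxM U'U map_mx1 mul1mx.
rewrite map_mxM scalemxAr det_1subM -scalemxAl -map_mxM -mulmxA -map_mxM.
by rewrite UU' map_mx1 mulmx1.
Qed.

Lemma euler_polyE x : map_poly (tinV (T x)) (euler_poly T phi x) = fibre_det T x C.
Proof.
have [P PE] := fibre_det_V x.
have [|m' [e' [C' [he' hC' ->]]]] := @xgetPex _ 1 [set P : {poly V} |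
    exists (m : nat) (e : 'I_m -> N) (C : 'M[D]_m),
      [/\ is_basis e, is_frobenius_matrix phi e C &
          map_poly (tinV (T x)) P = fibre_det T x C]]%classic.
  by exists P, m, e, C.
exact: fibre_det_basis.
Qed.

Lemma fibre_det_coef0 x : (fibre_det T x C)`_0 = 1.
Proof.
rewrite -horner_coef0 /fibre_det -[_.[0]]/(horner_eval 0 _) -det_map_mx.
rewrite map_mxB map_mx1 map_mxZ /= /horner_eval hornerXn expr0n.
by rewrite -[deg x == 0%N]negbK -lt0n deg_gt0 scale0r subr0 det1.
Qed.

(** [- t P'(t) / P(t)] for the Euler polynomial [P] of [x], with the traces
    descended to [V]. *)
Lemma euler_log_deriv x : exists v : nat -> V,
  (forall j, tinV (T x) (v j) = \tr (fibre_mx x ^+ j)) /\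
  log_deriv n (trunc_inv n (euler_poly T phi x))
    (\sum_(j < n) ((deg x)%:R * v j.+1)%:P * 'X^(deg x * j.+1)).
Proof.
have /choice [v vE] := fibre_trace_V x; exists v; split=> //.
have inj : injective (tinV (T x)) := unr_inj (tV_unramified (T x)).
apply: trunc_inv_log_deriv.
  by apply: inj; rewrite -coef_map /= euler_polyE fibre_det_coef0 rmorph1.
apply/dividesXnP => j lt; apply: inj; rewrite rmorph0 -coef_map /=.
have /dividesXnP h := newton_det (fibre_mx x) n (deg_gt0 x).
rewrite -[RHS](h j lt); congr (_`_j).
rewrite rmorphB rmorphN !rmorphM /= map_polyX -deriv_map euler_polyE.
rewrite rmorph_sum /= (eq_bigr (fun i : 'I_n =>
  ((deg x)%:R * \tr (fibre_mx x ^+ i.+1))%:P * 'X^(deg x * i.+1))) // => i _.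
by rewrite rmorphM /= map_polyXn map_polyC /= rmorphM rmorph_nat vE.
Qed.

(** A closed point of degree at most [n] is determined by the set of points of
    [L] above it, which is not empty. *)
Lemma degree_le_finite : finite_set [set x | (deg x <= n)%N]%classic.
Proof.
have [->|/set0P [x0 _]] := eqVneq [set x | (deg x <= n)%N]%classic set0.
  exact: finite_set0.
pose E x := [set u | `[< over x u >]].
apply: (@sub_finite_set _ _ ((fun U : {set {ffun 'I_r -> L}} =>
    xget x0 [set x | (deg x <= n)%N /\ E x = U]) @` setT)%classic).
  move=> x /= xn; exists (E x) => //.
  have := @xgetI _ x0 [set y | (deg y <= n)%N /\ E y = E x]%classic x (conj xn erefl).
  move: (xget _ _) => y [_ eE].
  have : (0 < #|E x|)%N by rewrite card_over // deg_gt0.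
  case/card_gt0P => u ux; have uy : u \in E y by rewrite eE.
  move: ux uy; rewrite !inE => /asboolP /asboolP h2 /asboolP /asboolP h1.
  exact: over_uniq h1 h2.
exact/finite_image/finite_finset.
Qed.

(** A closed point of degree [d] dividing [j] contributes [d tr(phi_x^j)] to the
    coefficient of [t^j] in the logarithmic derivative [Tr].  There are [d]
    points of [L] above it, all with this trace, and they are fixed by the
    [j]-th power of Frobenius. *)
Theorem Lfun_trace_formula : exists Lam Tr : {poly V},
  [/\ Lfun T phi n = FracField.tofrac Lam`_n, Lam`_0 = 1, Tr`_0 = 0,
      log_deriv n Lam Tr &
      forall (j : nat) (s : {ffun 'I_r -> L} -> c), (0 < j <= n)%N ->
        (forall u P t, is_point u P -> (forall i, u i ^+ (q ^ j) = u i) ->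
           is_teich P t -> s u = \tr (frobenius_iter_mx (csg c) (map_mx t C) j)) ->
        cV c Tr`_j =
          \sum_(u | `[< exists P, is_point u P >] &&
                    [forall i, u i ^+ (q ^ j) == u i]) s u].
Proof.
pose rx := finmap.enum_fset (fset_set [set x | (deg x <= n)%N]%classic).
have urx : uniq rx by exact: finmap.fset_uniq.
have mem_rx x : (x \in rx) = (deg x <= n)%N.
  by rewrite in_fset_set ?mem_setE //; apply: degree_le_finite.
have /choice [v vE] := euler_log_deriv.
pose Tx x := \sum_(j < n) ((deg x)%:R * v x j.+1)%:P * 'X^(deg x * j.+1).
exists (\prod_(x <- rx) trunc_inv n (euler_poly T phi x)), (\sum_(x <- rx) Tx x).
have Tx_coef x j : (Tx x)`_j =
    \sum_(i < n | (j == deg x * i.+1)%N) (deg x)%:R * v x i.+1.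
  rewrite coef_sum [RHS]big_mkcond; apply: eq_bigr => i _.
  by rewrite coefCM coefXn; case: eqP; rewrite ?mulr1 ?mulr0.
have inj x : injective (tinV (T x)) := unr_inj (tV_unramified (T x)).
split.
- by rewrite /Lfun fsbig_finite //; apply: degree_le_finite.
- rewrite -horner_coef0 horner_prod big1_seq // => x _; rewrite horner_coef0.
  apply: trunc_inv_coef0; apply: (inj x).
  by rewrite -coef_map /= euler_polyE fibre_det_coef0 rmorph1.
- rewrite coef_sum big1_seq // => x _; rewrite Tx_coef big_pred0 // => i.
  by rewrite eq_sym muln_eq0 -[deg x == 0%N]negbK -lt0n deg_gt0.
- by apply: log_deriv_prod => x; have [] := vE x.
move=> j s /andP[j0 jn] sE.
pose E x := [set u | `[< over x u >]].
pose fixed (u : {ffun 'I_r -> L}) := [forall i, u i ^+ (q ^ j) == u i].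
have fixedP (u : {ffun 'I_r -> L}) : reflect (forall i, u i ^+ (q ^ j) = u i) (fixed u).
  by apply: (iffP forallP) => h i; apply/eqP; exact: h.
transitivity (\sum_(x <- rx) \sum_(u in E x | fixed u) s u).
  rewrite coef_sum rmorph_sum big_seq [RHS]big_seq; apply: eq_bigr => x.
  rewrite mem_rx => xn; rewrite Tx_coef.
  have [/dvdnP [l jE]|ndvd] := boolP (deg x %| j)%N; last first.
    rewrite big_pred0 => [|i]; last first.
      by apply/negP => /eqP e'; move: ndvd; rewrite e' dvdn_mulr.
    rewrite rmorph0 big_pred0 // => u; rewrite inE; apply/negP => /andP[/asboolP hu].
    by move=> /fixedP /(over_fixed _ hu); apply/negP.
  have l0 : (0 < l)%N by move: j0; rewrite jE muln_gt0 => /andP[].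
  have ln : (l.-1 < n)%N.
    by rewrite prednK //; apply: leq_trans jn; rewrite jE leq_pmulr ?deg_gt0.
  rewrite (bigD1 (Ordinal ln)) /=; last by rewrite prednK // jE mulnC.
  rewrite big_pred0 => [|i]; last first.
    apply/negP => /andP[/eqP e' /negP]; apply; apply/eqP/val_inj => /=.
    move: e'; rewrite jE mulnC => /eqP; rewrite eqn_pmul2l ?deg_gt0 // => /eqP ->.
    by [].
  rewrite addr0 prednK // rmorphM rmorph_nat -(card_over xn).
  rewrite (eq_bigl (fun u : {ffun 'I_r -> L} => u \in E x)); last first.
    move=> u; rewrite inE; case: asboolP => //= hu; apply/fixedP.
    by apply/(over_fixed _ hu); rewrite jE dvdn_mull.
  rewrite (eq_bigr (fun=> cV c (v x l))); first by rewrite sumr_const mulr_natl.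
  move=> u; rewrite inE => /asboolP hu; have [P [hP kP]] := hu.
  have [g [gV gs ht]] := over_teich hP kP.
  have fu : forall i, u i ^+ (q ^ j) = u i.
    by apply/(over_fixed _ hu); rewrite jE dvdn_mull.
  rewrite (sE u P _ hP fu ht).
  have -> : map_mx (g \o tau (T x)) C = map_mx g (map_mx (tau (T x)) C).
    by rewrite -map_mx_comp.
  rewrite -(frobenius_iter_map _ _ gs) trace_map_mx jE mulnC.
  rewrite (frobenius_iter_exp (@tsigma_order _ _ _ _ _ _ _ _ _ (T x))).
  by have [<- _] := vE x; rewrite gV.
rewrite (exchange_big_dep (fun u : {ffun 'I_r -> L} =>
  `[< exists P, is_point u P >] && fixed u)) /=; last first.
  move=> x u _ /andP[]; rewrite inE => /asboolP [P [hP _]] ->; rewrite andbT.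
  by apply/asboolP; exists P.
apply: eq_bigr => u /andP[/asboolP [P hP] fu].
have [x hx] := point_over hP.
have xj : (deg x %| j)%N by apply/(over_fixed _ hx)/fixedP.
have xn : x \in rx by rewrite mem_rx (leq_trans _ jn) // dvdn_leq.
have Ex y : (u \in E y) = `[< over y u >] by rewrite inE.
rewrite big_mkcond (bigD1_seq x) //= Ex fu andbT asboolT //.
rewrite big1_seq ?addr0 // => y /andP[yx _]; rewrite Ex andbT.
by case: asboolP => // hy; case/eqP: yx; apply: over_uniq hy hx.
Qed.

End LSeries.

End Points.

(** * The coefficients of the Dwork exponential *)

(** By induction, as [v_p(n!) = m + v_p(m!)] for [m] the quotient of [n] by [p]. *)
Lemma logn_fact_bound p n : prime p -> (0 < n)%N ->
  ((p.-1 * logn p n`!).+1 <= n)%N /\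
  ((p.-1 * logn p n`!).+1 = n <-> exists j, n = p ^ j)%N.
Proof.
move=> pr; have p1 := prime_gt1 pr.
have rec m : logn p m`! = (m %/ p + logn p (m %/ p)`!)%N.
  rewrite !logn_fact //; have [->|m0] := posnP m; first by rewrite div0n !big_geq.
  rewrite big_ltn // expn1; congr (_ + _)%N; rewrite big_add1 /=.
  under eq_bigr => i _ do rewrite expnS divnMA.
  have lm : ((m %/ p).+1 <= m)%N by apply: ltn_Pdiv.
  rewrite (@big_cat_nat _ _ _ (m %/ p).+1) //= [X in (_ + X)%N]big1_seq ?addn0 //.
  move=> i; rewrite mem_index_iota /= => /andP[lt _]; apply: divn_small.
  by apply: ltn_trans lt _; apply: ltn_expl.
have [N le] := ubnP n; elim: N n le => // N ih n le n0.
rewrite rec; have [e0|m0] := posnP (n %/ p).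
  rewrite e0 fact0 logn1 muln0; split=> //; split=> [<-|[j jE]].
    by exists 0%N; rewrite expn0.
  have lt : (n < p)%N by rewrite -[p]mul1n -ltn_divLR ?e0 // ltnW.
  case: j jE => [->|j jE]; first by rewrite expn0.
  have : (p ^ 1 <= p ^ j.+1)%N by rewrite leq_exp2l.
  by rewrite -jE expn1 leqNgt lt.
have [|b1 b2] := ih (n %/ p)%N _ m0.
  by rewrite -ltnS; apply: leq_trans le; rewrite ltnS; apply: ltn_Pdiv.
have nE := divn_eq n p; set l := logn p _ in b1 b2 *.
set m := (n %/ p)%N in b1 b2 m0 nE *; set r := (n %% p)%N in nE.
have mp : (m * p = m + p.-1 * m)%N.
  by rewrite -{1}[p]prednK ?mulnS 1?mulnC // ltnW.
rewrite mulnDr; set w := (p.-1 * m)%N in mp *; set u := (p.-1 * l)%N in b1 b2 *.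
split; first by move: nE b1; rewrite mp; clear; lia.
split=> [h|[j jE]].
  have [r0 mu] : (r = 0 /\ u.+1 = m)%N by move: nE b1 h; rewrite mp; clear; lia.
  by have [j jE] := b2.1 mu; exists j.+1; rewrite nE r0 addn0 jE expnSr.
case: j jE => [n1|j jE].
  by move: m0; rewrite /m n1 expn0 divn_small.
have mE : m = (p ^ j)%N by rewrite /m jE expnS mulKn // ltnW.
have mu : u.+1 = m by apply/b2; exists j.
have nmp : n = (m * p)%N by rewrite jE mE expnSr.
rewrite [RHS]nmp mp; move: mu; clear; lia.
Qed.

Lemma sum_prime_powers (R : nmodType) p K (F : nat -> R) : prime p ->
  (forall l, (0 < l)%N -> ~ (exists j, l = p ^ j)%N -> F l = 0) ->
  \sum_(1 <= l < p ^ K) F l = \sum_(j < K) F (p ^ j)%N.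
Proof.
move=> pr F0; have p1 := prime_gt1 pr.
elim: K => [|K ih]; first by rewrite expn0 big_geq ?big_ord0.
have pK : (0 < p ^ K)%N by rewrite expn_gt0 prime_gt0.
have lt : (p ^ K < p ^ K.+1)%N by rewrite ltn_exp2l.
rewrite (@big_cat_nat _ _ _ (p ^ K)) //=; last exact: ltnW.
rewrite ih big_ord_recr /=; congr (_ + _); rewrite big_ltn // big1_seq ?addr0 //.
move=> l; rewrite mem_index_iota /= => /andP[l1 l2]; apply: F0.
  exact: leq_trans l1.
case=> j jE; move: l1 l2; rewrite jE !ltn_exp2l //; lia.
Qed.

(** [eta i = pistar^(i-1) / i!] is integral, and a unit exactly when [i] is a
    power of [p]. *)
Definition dwork_coefs (p a : nat) (S : base p a) (pistar : bV S) (eta : nat -> bV S) :=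
  forall i, (0 < i)%N ->
  (i`!)%:R * eta i = pistar ^+ i.-1 /\ (bres S (eta i) != 0 <-> exists j, i = (p ^ j)%N).

Section ExpCoef.
Variables (p a : nat) (S : base p a).
Notation V := (bV S).
Notation pi := (bpi S).
Variable pistar : V.
Hypothesis hpistar : pistar ^+ p.-1 = - p%:R.

Lemma base_unit (v : V) : bres S v != 0 -> v \is a GRing.unit.
Proof.
move=> rv; have v0 : v != 0 by apply: contraNneq rv => ->; rewrite rmorph0.
have [_ _ /(_ _ v0) [[|n] [u [uu vE]]]] := base_dvr S.
  by rewrite vE mulr1.
case/eqP: rv; have [_ rE] := base_residue S; apply/rE.
by rewrite vE exprS mulrCA; apply: divides_mulr.
Qed.

Lemma pistar_neq0 : pistar != 0.
Proof.
have p0 := prime_gt0 (base_prime S).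
apply/eqP => e; have := hpistar; rewrite e expr0n.
have -> : (p.-1 == 0)%N = false by have := prime_gt1 (base_prime S); case: (p) => [|[]].
move/esym/eqP; rewrite oppr_eq0 => /eqP /base_natr0 p00.
by rewrite p00 in p0.
Qed.

Lemma res_pistar : bres S pistar = 0.
Proof.
have : bres S (pistar ^+ p.-1) = 0.
  by rewrite hpistar rmorphN rmorph_nat (pcharf0 (base_pchar S)) oppr0.
by rewrite rmorphXn => /eqP; rewrite expf_eq0 => /andP[_ /eqP].
Qed.

(** As [-p = pistar^(p-1)], the factorial [i!] is a unit times
    [pistar^((p-1) v_p(i!))]. *)
Lemma exp_coef_exists : exists eta, dwork_coefs pistar eta.
Proof.
have pr := base_prime S.
suff /choice [eta etaE] : forall i, exists v : V, (0 < i)%N ->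
    (i`!)%:R * v = pistar ^+ i.-1 /\ (bres S v != 0 <-> exists j, i = (p ^ j)%N).
  by exists eta.
move=> i; have [->|i0] := posnP i; first by exists 0.
have [le eq] := logn_fact_bound pr i0; set l := logn p i`! in le eq.
have [m cpm mE] := pfactor_coprime pr (fact_gt0 i).
have rm : bres S m%:R != 0.
  rewrite rmorph_nat -(dvdn_pcharf (base_pchar S)).
  by rewrite -prime_coprime.
have um := base_unit rm.
have iE : (i`!)%:R = (-1) ^+ l * m%:R * pistar ^+ (p.-1 * l) :> V.
  rewrite mE natrM natrX exprM hpistar -/l -[- p%:R]mulN1r exprMn.
  by rewrite mulrACA -exprMn mulrNN mulr1 expr1n mul1r.
exists ((-1) ^+ l * m%:R^-1 * pistar ^+ (i.-1 - p.-1 * l)) => _; split.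
  rewrite iE mulrACA -exprD subnKC; last by rewrite -ltnS prednK.
  by rewrite mulrACA -exprMn mulrNN mulr1 expr1n mul1r divrr // mul1r.
rewrite -eq !rmorphM !rmorphXn /= rmorphN rmorph1 res_pistar expr0n.
have [e|ne] := eqVneq (p.-1 * l).+1 i.
  have -> : (i.-1 - p.-1 * l == 0)%N by rewrite -e /= subnn.
  split=> // _; rewrite mulr1 mulf_neq0 //; first by rewrite signr_eq0.
  by rewrite -unitfE; apply: rmorph_unit; rewrite unitrV.
have -> : (i.-1 - p.-1 * l == 0)%N = false.
  move: le ne; rewrite leq_eqVlt => /orP[->//|lt] _.
  by apply/negbTE; rewrite -lt0n subn_gt0 -ltnS prednK.
by rewrite mulr0 eqxx; split=> // e; rewrite e eqxx in ne.
Qed.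

End ExpCoef.

Lemma coefM_divides (R : comNzRingType) (x : R) (f g : {poly R}) n :
  (forall j, (j <= n)%N -> divides x f`_j) ->
  forall j, (j <= n)%N -> divides x (f * g)`_j.
Proof.
move=> h j jn; rewrite coefM; apply: divides_sum => i _; apply: dividesMr.
by apply: h; apply: leq_trans jn; rewrite -ltnS.
Qed.

(** * Values of the Dwork exponential *)

Section ExpValue.
Variables (p a : nat) (S : base p a).
Notation V := (bV S).
Notation pi := (bpi S).
Variable pistar : V.
Hypothesis hpistar : pistar ^+ p.-1 = - p%:R.
Variable eta : nat -> V.
Hypothesis etaE : dwork_coefs pistar eta.

(** [pistar^i / i!]. *)
Definition eps i : V := if i is 0 then 1 else pistar * eta i.

Lemma epsE i : (i`!)%:R * eps i = pistar ^+ i.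
Proof.
case: i => [|i]; first by rewrite mulr1.
by have [e _] := @etaE i.+1 isT; rewrite /eps mulrCA e -exprS.
Qed.

Lemma eps_mul i j : eps i * eps j = 'C(i + j, i)%:R * eps (i + j).
Proof.
have n0 n : (n`!)%:R != 0 :> V.
  by apply/eqP => /base_natr0 e; have := fact_gt0 n; rewrite e.
apply: (mulfI (mulf_neq0 (n0 i) (n0 j))).
rewrite mulrACA !epsE -exprD -epsE mulrA -!natrM; congr (_%:R * _).
by rewrite -(bin_fact (leq_addr j i)) addKn mulnC.
Qed.

Variables (n : nat) (c : comparison_ring S n).
Notation O := (cO c).
Notation i := (cV c).
Notation x := (cV c pi).

(** The series [exp (pistar z)] truncated after the term in [z^m]. *)
Definition Exp m (z : {poly O}) : {poly O} := \sum_(l < m.+1) (i (eps l)) *: z ^+ l.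

(** [f = 0] modulo [t^m.+1] and [pi^J]. *)
Definition vanish m J (f : {poly O}) := forall j, (j <= m)%N -> divides (x ^+ J) f`_j.

Lemma vanishD m J f g : vanish m J f -> vanish m J g -> vanish m J (f + g).
Proof. by move=> hf hg j jm; rewrite coefD; apply: dividesD; [apply: hf|apply: hg]. Qed.

Lemma vanishMr m J f g : vanish m J f -> vanish m J (f * g).
Proof. by move=> hf; apply: coefM_divides. Qed.

Lemma vanish_X m J f : divides ('X^(m.+1)) f -> vanish m J f.
Proof. by case=> g -> j jm; rewrite coefXnM ltnS jm; apply: divides0. Qed.

(** The power series [exp (pistar z)] in [t] is, modulo each power of [pi], a
    polynomial, and [v] is the limit of the values of these polynomials at 1.
    This is not the sum of the [(pistar z(1))^i / i!], which need not converge: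
    for [z = t - t^Q] one has [z(1) = 0], but [v] is a nontrivial root of unity
    in general. *)
Definition exp_value (z : {poly O}) (v : O) : Prop :=
  forall J, exists e : {poly O},
    (forall m, vanish m J (e - Exp m z)) /\ divides (x ^+ J) (v - e.[1]).

Lemma horner1_divides J (f : {poly O}) :
  (forall j, divides (x ^+ J) f`_j) -> divides (x ^+ J) f.[1].
Proof.
move=> h; rewrite horner_coef; apply: divides_sum => j _.
by apply: dividesMr.
Qed.

Lemma exp_value_unique z v v' : exp_value z v -> exp_value z v' -> v = v'.
Proof.
move=> h h'; apply/eqP; rewrite -subr_eq0; apply/eqP/(unr_separated (c_unr c)) => J.
have [e [eE ve]] := h J; have [e' [e'E v'e']] := h' J.
have -> : v - v' = (v - e.[1]) - (v' - e'.[1]) + (e - e').[1].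
  by rewrite hornerD hornerN; ring.
apply: dividesD; first exact: dividesB.
apply: horner1_divides => j.
have -> : e - e' = (e - Exp j z) - (e' - Exp j z) by ring.
by rewrite coefB; apply: dividesB; [apply: eE | apply: e'E].
Qed.

Lemma Exp_mul m z z' : divides 'X z -> divides 'X z' ->
  divides ('X^(m.+1)) (Exp m z * Exp m z' - Exp m (z + z')).
Proof.
move=> hz hz'.
pose A (w : {poly O}) := \poly_(l < m.+1) (i (eps l) *: w ^+ l).
have AE w : (A w).[1] = Exp m w.
  rewrite horner_poly; apply: eq_bigr => l _; by rewrite expr1n mulr1.
have sA : (size (A z * A z')%R <= m.+1 + m.+1)%N.
  apply: leq_trans (size_polyMleq _ _) _; apply: leq_trans (leq_pred _) _.
  by apply: leq_add; apply: size_poly.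
rewrite -!AE -hornerM (horner_coef_wide _ sA) big_split_ord /=.
have lowE : \sum_(l < m.+1) (A z * A z')`_l * 1 ^+ l = Exp m (z + z').
  apply: eq_bigr => l _; rewrite expr1n mulr1 coefM addrC exprDn scaler_sumr.
  apply: eq_bigr => j _.
  have jl : (j <= l)%N by rewrite -ltnS.
  have jm : (j < m.+1)%N by apply: leq_trans (ltn_ord l); rewrite ltnS.
  have ljm : (l - j < m.+1)%N by apply: leq_ltn_trans (ltn_ord l); apply: leq_subr.
  rewrite !coef_poly jm ljm -scalerAl -scalerAr scalerA -rmorphM eps_mul.
  rewrite subnKC // -[X in _ = _ *: X]scaler_nat scalerA rmorphM rmorph_nat mulrC.
  by rewrite [z ^+ j * _]mulrC.
rewrite lowE AE addrC addrK; apply: divides_sum => l _; rewrite expr1n mulr1.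
have hA : divides ('X^(m.+1 + l)) (A z * A z')`_(m.+1 + l).
  rewrite coefM; apply: divides_sum => j _.
  have jl : (j <= m.+1 + l)%N by rewrite -ltnS.
  rewrite !coef_poly; case: ifP => _; last by rewrite mul0r; apply: divides0.
  case: ifP => _; last by rewrite mulr0; apply: divides0.
  rewrite -scalerAl -scalerAr -mul_polyC -[_ *: (_ * _)]mul_polyC.
  rewrite -{1}(subnKC jl) exprD; do 2!apply: dividesMl.
  by apply: divides_mul; apply: divides_exp.
by apply: divides_expW hA; apply: leq_addr.
Qed.

Lemma exp_valueM z z' v v' : divides 'X z -> divides 'X z' ->
  exp_value z v -> exp_value z' v' -> exp_value (z + z') (v * v').
Proof.
move=> hz hz' h h' J; have [e [eE ve]] := h J; have [e' [e'E v'e']] := h' J.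
exists (e * e'); split; last by rewrite hornerM; apply: dividesMB.
move=> m.
have -> : e * e' - Exp m (z + z') = (e - Exp m z) * e' + (e' - Exp m z') * Exp m z
    + (Exp m z * Exp m z' - Exp m (z + z')) by ring.
apply: vanishD; last exact/vanish_X/Exp_mul.
by apply: vanishD; apply: vanishMr.
Qed.

Lemma exp_value0 : exp_value 0 1.
Proof.
move=> J; exists 1; split=> [m|]; last by rewrite hornerC subrr; apply: divides0.
rewrite /Exp big_ord_recl expr0 rmorph1 scale1r big1 ?addr0 ?subrr => [|l _].
  by move=> j _; rewrite coef0; apply: divides0.
by rewrite expr0n scaler0.
Qed.

(** The substitution [t -> t^M], combined with an endomorphism of [O]. *)
Lemma exp_value_subst (sg : {rmorphism O -> O}) M z v :
  (forall u, sg (i u) = i u) -> (0 < M)%N ->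
  exp_value z v -> exp_value (map_poly sg z \Po 'X^M) (sg v).
Proof.
move=> sgi M0 h J; have [e [eE ve]] := h J.
exists (map_poly sg e \Po 'X^M); split; last first.
  rewrite horner_comp hornerXn expr1n.
  have -> : (map_poly sg e).[1] = sg e.[1] by rewrite -{1}(rmorph1 sg) horner_map.
  rewrite -rmorphB -[x]sgi -rmorphXn; exact: divides_rmorph.
move=> m.
have -> : Exp m (map_poly sg z \Po 'X^M) = map_poly sg (Exp m z) \Po 'X^M.
  rewrite /Exp !rmorph_sum /=; apply: eq_bigr => l _.
  by rewrite map_polyZ comp_polyZ !rmorphXn /= sgi.
rewrite -rmorphB /= -rmorphB /= => j jm; rewrite coef_comp_poly_Xn //.
case: ifP => _; last exact: divides0.
rewrite coef_map /= -[x]sgi -rmorphXn; apply: divides_rmorph.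
by apply: eE; apply: leq_trans jm; apply: leq_div.
Qed.

Lemma exp_value_small c0 : cres c c0 = 0 -> exists v, exp_value (c0 *: 'X) v.
Proof.
move=> /(unr_res0 (c_unr c)) [c1 c1E].
have [[_ _ [_ compl]] _] := c_unr c.
have [v vE] := compl (fun l => i (eps l) * c1 ^+ l); exists v => J.
pose e : {poly O} := \poly_(l < J) (i (eps l) * c0 ^+ l).
have ExpE m j : (Exp m (c0 *: 'X))`_j = if (j <= m)%N then i (eps j) * c0 ^+ j else 0.
  rewrite coef_sum; case: leqP => jm.
    rewrite (bigD1 (Ordinal (jm : (j < m.+1)%N))) //= big1 ?addr0 => [|l lj].
      by rewrite exprZn scalerA coefZ coefXn eqxx mulr1.
    rewrite exprZn scalerA coefZ coefXn; case: eqP => [e'|]; last by rewrite mulr0.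
    by case/eqP: lj; apply/val_inj.
  apply: big1 => l _; rewrite exprZn scalerA coefZ coefXn; case: eqP => [e'|].
    by move: jm; rewrite e' ltnNge -ltnS ltn_ord.
  by rewrite mulr0.
exists e; split=> [m j jm|].
  rewrite coefB ExpE jm coef_poly; case: ltnP => [_|le].
    by rewrite subrr; apply: divides0.
  rewrite sub0r; apply/dividesN/dividesMl; rewrite c1E exprMn.
  by apply: dividesMr; apply: divides_expW (divides_refl _).
rewrite horner_poly; have := vE J; congr (divides _ (_ - _)).
by apply: eq_bigr => l _; rewrite expr1n mulr1 c1E exprMn; ring.
Qed.

Lemma divides_scaleX (w : O) M : (0 < M)%N -> divides 'X (w *: 'X^M : {poly O}).
Proof.
by move=> M0; exists (w *: 'X^(M.-1)); rewrite -scalerAr -exprS prednK.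
Qed.

(** For [c0] divisible by [pi] both factors of
    [exp (pistar c0 t) exp (- pistar c0 t^Q)] converge at 1, to inverse values. *)
Lemma exp_value_trivial c0 Q : cres c c0 = 0 -> (0 < Q)%N ->
  exp_value (c0 *: ('X - 'X^Q)) 1.
Proof.
move=> c00 Q0; have [v hv] := exp_value_small c00.
have [|v' hv'] := @exp_value_small (- c0); first by rewrite rmorphN c00 oppr0.
have dX (w : O) : divides 'X (w *: 'X : {poly O}).
  by have := divides_scaleX w (ltn0Sn 0); rewrite expr1.
have vv' : v * v' = 1.
  apply: exp_value_unique exp_value0.
  by have := exp_valueM (dX _) (dX _) hv hv'; rewrite -scalerDl subrr scale0r.
have hv2 := exp_value_subst (sg := idfun) (fun=> erefl) Q0 hv'.
rewrite -vv' scalerBr -scaleNr; apply: exp_valueM => //; first exact: divides_scaleX.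
move: hv2; rewrite /= map_poly_id; last by move=> ? _.
by rewrite comp_polyZ comp_polyX.
Qed.

Lemma pistar_valuation : exists J, forall w : O, divides (x ^+ J) w ->
  divides (i pistar * x) w.
Proof.
have [_ _ /(_ _ (pistar_neq0 hpistar)) [e [u [uu uE]]]] := base_dvr S.
exists e.+1 => w [s ->]; exists (i u^-1 * s).
have -> : x ^+ e.+1 = (i u^-1 * i u) * x ^+ e * x.
  by rewrite -rmorphM mulVr // rmorph1 mul1r exprSr.
by rewrite uE rmorphM rmorphXn; ring.
Qed.

Lemma pistar_regular w : i pistar * w = 0 -> w = 0.
Proof.
have [_ _ /(_ _ (pistar_neq0 hpistar)) [e [u [uu uE]]]] := base_dvr S.
move=> h; apply: (@unr_regular _ _ _ _ _ _ _ _ (c_unr c) e).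
have -> : x ^+ e * w = i u^-1 * (i pistar * w).
  have e1 : i u^-1 * i u = 1 by rewrite -rmorphM mulVr // rmorph1.
  rewrite uE rmorphM rmorphXn -[LHS]mul1r -e1; ring.
by rewrite h mulr0.
Qed.

(** Modulo [pistar * pi], the value at 1 of [exp (pistar w (t - t^Q))] is 1
    plus [pistar] times the value of the polynomial congruent to
    [\sum_j eta_(p^j) w^(p^j) (t^(p^j) - t^(p^j Q))].  As that formal sum is a
    polynomial modulo [pi], it telescopes to its last [M] terms. *)
Lemma exp_value_residue w M v : (0 < M)%N ->
  exp_value (w *: ('X - 'X^(p ^ M))) v ->
  exists h K0, v = 1 + i pistar * h /\
    forall K, (K0 <= K)%N -> cres c h =
      \sum_(j < M) cres c (i (eta (p ^ (K + j)))) * cres c w ^+ (p ^ (K + j)).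
Proof.
move=> M0; set z := w *: _; move=> hv; have pr := base_prime S.
have p1 := prime_gt1 pr.
have [J valJ] := pistar_valuation; have [E0 [hE vE]] := hv J.
pose W m : {poly O} := \sum_(1 <= l < m.+1) i (eta l) *: z ^+ l.
have ExpW m : Exp m z = 1 + i pistar *: W m.
  rewrite /Exp -(big_mkord xpredT (fun l => i (eps l) *: z ^+ l)) big_ltn //.
  rewrite expr0 rmorph1 scale1r; congr (_ + _); rewrite /W scaler_sumr.
  rewrite !big_add1 /=; apply: eq_bigr => l _.
  by rewrite scalerA /eps rmorphM.
have /choice [Hs HsE] : forall j, exists s, (E0 - 1)`_j = i pistar * s.
  move=> j; have [s sE] := valJ _ (hE j j (leqnn j)).
  exists ((W j)`_j + x * s); rewrite mulrDr mulrA -sE ExpW !coefB coefD coefZ; ring.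
pose H := \poly_(j < size (E0 - 1)) Hs j.
have HE : E0 - 1 = i pistar *: H.
  apply/polyP => j; rewrite coefZ coef_poly; case: ltnP => [_|le]; first exact: HsE.
  by rewrite mulr0 nth_default.
have HW m j : (j <= m)%N -> cres c H`_j = cres c (W m)`_j.
  move=> jm; apply/eqP; rewrite -subr_eq0 -rmorphB; apply/eqP.
  apply/(unr_res0 (c_unr c)).
  have [s sE] := valJ _ (hE m j jm); exists s.
  apply/eqP; rewrite -subr_eq0; apply/eqP/pistar_regular.
  have -> : i pistar * (H`_j - (W m)`_j - x * s) =
      (i pistar *: H)`_j - (i pistar *: W m)`_j - i pistar * x * s.
    by rewrite !coefZ; ring.
  rewrite -HE -sE ExpW !coefB coefD; ring.
have [s sE] := valJ _ vE.
exists (H.[1] + x * s), (size H); split.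
  rewrite mulrDr mulrA -sE -hornerZ -HE hornerD hornerN hornerC; ring.
move=> K HK.
have rx : cres c x = 0 by apply/(unr_res0 (c_unr c))/divides_refl.
rewrite rmorphD rmorphM rx mul0r addr0.
pose N := (p ^ (K + M))%N.
have N0 : (0 < N)%N by rewrite expn_gt0 prime_gt0.
have HN : (size H <= N)%N.
  apply: leq_trans HK _; apply: leq_trans (leq_addr M K) _.
  exact/ltnW/ltn_expl.
rewrite (horner_coef_wide _ HN) rmorph_sum /=.
pose g l := cres c (i (eta l)) * cres c w ^+ l.
have WE : map_poly (cres c) (W N.-1) =
    \sum_(j < K + M) g (p ^ j)%N *: ('X^(p ^ j) - 'X^(p ^ (j + M))).
  rewrite /W prednK // rmorph_sum /=.
  have chX : p \in [pchar {poly cL c}] by rewrite pchar_poly; apply: (unr_pchar (ck c)).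
  rewrite (@sum_prime_powers _ p (K + M)
    (fun l => map_poly (cres c) (i (eta l) *: z ^+ l))) //.
    apply: eq_bigr => j _; rewrite map_polyZ rmorphXn /= map_polyZ /= exprZn scalerA.
    congr (_ *: _); rewrite rmorphB /= map_polyX map_polyXn.
    have [fr frE] := frobenius_rmorph j chX.
    by rewrite -frE rmorphB /= !frE -exprM -expnD [(M + j)%N]addnC.
  move=> l l0 lp; rewrite map_polyZ /= (unr_res (c_unr c)).
  have [_ [h _]] := etaE l0.
  have [->|/h //] := eqVneq (bres S (eta l)) 0.
  by rewrite rmorph0 scale0r.
transitivity (\sum_(l < N) (map_poly (cres c) (W N.-1))`_l).
  apply: eq_bigr => l _; rewrite expr1n mulr1 coef_map /=; apply: HW.
  by rewrite -ltnS prednK.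
have indic b : \sum_(l < N) ('X^b : {poly cL c})`_l = (b < N)%N%:R.
  case: ltnP => bN.
    rewrite (bigD1 (Ordinal bN)) //= coefXn eqxx big1 ?addr0 // => l lb.
    by rewrite coefXn; case: eqP => // e; case/eqP: lb; apply/val_inj.
  rewrite big1 // => l _; rewrite coefXn; case: eqP => // e.
  by have := ltn_ord l; rewrite e ltnNge bN.
transitivity (\sum_(j < K + M) g (p ^ j)%N * ((p ^ j < N)%N%:R - (p ^ (j + M) < N)%N%:R)).
  rewrite WE; under eq_bigr => l _ do rewrite coef_sum.
  rewrite exchange_big /=; apply: eq_bigr => j _.
  rewrite -!indic -sumrB mulr_sumr; apply: eq_bigr => l _.
  by rewrite coefZ coefB.
rewrite big_split_ord /= big1 ?add0r => [|j _].
  apply: eq_bigr => j _; rewrite !ltn_exp2l // ltn_add2l ltn_ord.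
  by rewrite ltn_add2r ltnNge leq_addr subr0 mulr1.
by rewrite !ltn_exp2l // ltn_add2r ltn_ord ltn_addr // subrr mulr0.
Qed.

End ExpValue.

(** * The Dwork exponential at a Teichmueller point *)

Lemma rmorph_peval_comp (V : nzRingType) (A T : comPzRingType) (g : {rmorphism A -> T})
    (sV : V -> A) r (b : 'I_r -> A) P :
  g (peval sV b P) = peval (g \o sV) (g \o b) P.
Proof.
rewrite rmorph_sum; apply: eq_bigr => m _; rewrite rmorphM rmorph_prod.
by congr (_ * _); apply: eq_bigr => i _; rewrite rmorphXn.
Qed.

Lemma eq_peval (V : nzRingType) (A : comPzRingType) (sV sV' : V -> A) r
    (b b' : 'I_r -> A) P :
  sV =1 sV' -> b =1 b' -> peval sV b P = peval sV' b' P.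
Proof.
move=> es eb; apply: eq_bigr => m _; rewrite es; congr (_ * _).
by apply: eq_bigr => i _; rewrite eb.
Qed.

Section DworkPoint.
Variables (p a : nat) (S : base p a).
Notation V := (bV S).
Notation pi := (bpi S).
Notation q := (p ^ a)%N.
Variable pistar : V.
Hypothesis hpistar : pistar ^+ p.-1 = - p%:R.
Variable eta : nat -> V.
Hypothesis etaE : dwork_coefs pistar eta.
Variables (n : nat) (c : comparison_ring S n).
Notation x := (cV c pi).
Variables (d s : nat) (f : 'I_s -> {mpoly V[d]}).
Variables (Rd : aff_dagger S d) (Ryd : aff_dagger S (d + s)) (pr : {rmorphism Rd -> Ryd}).
Hypothesis hpr : forall g, pr (din Rd g) = din Ryd (pr_poly s g).
Hypothesis hprF : forall w, dfrob Ryd (pr w) = pr (dfrob Rd w).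
Hypothesis hyF : forall i, dfrob Ryd (yvar Ryd i) = yvar Ryd i ^+ q.
Variables (E : Ryd) (hE : is_exp (yvar Ryd) (dwork_exponent Ryd pistar f) E).
Variable t : {rmorphism Ryd -> c}.
Hypothesis tV : forall v, t (din Ryd (affC S (d + s) v)) = cV c v.
Hypothesis tF : forall w, t (dfrob Ryd w) = csg c (t w).

Notation PI := (din Ryd (affC S (d + s) pi)).
Notation sV := (fun v => din Ryd (affC S (d + s) v)).

(** The specialization [x_l -> t(x_l)], [y_i -> t(y_i) t] of polynomials.  Its
    extension to [R[y]^dagger] takes values in restricted power series; it is
    only used modulo powers of [pi], where its values are polynomials. *)
Lemma specialization_exists : exists th : {rmorphism {mpoly V[d + s]} -> {poly c}},
  [/\ forall v, th v%:MP = (cV c v)%:P,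
      forall l, th 'X_(lshift s l) = (t (xvar Ryd l))%:P &
      forall l, th 'X_(rshift d l) = t (yvar Ryd l) *: 'X].
Proof.
pose b (l : 'I_(d + s)) : {poly c} :=
  match split l with inl l => (t (xvar Ryd l))%:P | inr l => t (yvar Ryd l) *: 'X end.
pose f0 : {rmorphism V -> {poly c}} := polyC \o cV c.
exists (mmap f0 b); split=> [v|l|l].
- by rewrite /= mmapC.
- by rewrite /= mmapX mmap1U /b -[lshift s l]/(unsplit (inl l)) unsplitK.
- by rewrite /= mmapX mmap1U /b -[rshift d l]/(unsplit (inr l)) unsplitK.
Qed.

Lemma pr_poly_rmorph : exists g : {rmorphism {mpoly V[d]} -> {mpoly V[d + s]}},
  g =1 @pr_poly _ _ S d s.
Proof. by exists (mmap (affC S (d + s)) (fun l => 'X_(lshift s l))). Qed.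

Lemma pr_polyC v : pr_poly s (v%:MP : {mpoly V[d]}) = v%:MP.
Proof. by rewrite /pr_poly mmapC. Qed.

Lemma pr_polyX l : pr_poly s ('X_l : {mpoly V[d]}) = 'X_(lshift s l).
Proof. by rewrite /pr_poly mmapX mmap1U. Qed.

Section Approximation.
Variable th : {rmorphism {mpoly V[d + s]} -> {poly c}}.
Hypothesis thC : forall v, th v%:MP = (cV c v)%:P.
Hypothesis thx : forall l, th 'X_(lshift s l) = (t (xvar Ryd l))%:P.
Hypothesis thy : forall l, th 'X_(rshift d l) = t (yvar Ryd l) *: 'X.

(** [g] is the specialization of [w] modulo [pi^J]. *)
Definition approx J (w : Ryd) (g : {poly c}) : Prop :=
  exists b, divides (PI ^+ J) (w - din Ryd b) /\ divides (x%:P ^+ J) (g - th b).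

Lemma approx_din J b : approx J (din Ryd b) (th b).
Proof. by exists b; rewrite !subrr; split; apply: divides0. Qed.

Lemma approxC J v : approx J (sV v) (cV c v)%:P.
Proof. by rewrite -thC; apply: approx_din. Qed.

Lemma approxD J w w' g g' : approx J w g -> approx J w' g' -> approx J (w + w') (g + g').
Proof.
move=> [b [h1 h2]] [b' [h1' h2']]; exists (b + b').
by split; rewrite rmorphD; apply: dividesDB.
Qed.

Lemma approxM J w w' g g' : approx J w g -> approx J w' g' -> approx J (w * w') (g * g').
Proof.
move=> [b [h1 h2]] [b' [h1' h2']]; exists (b * b').
by split; rewrite rmorphM; apply: dividesMB.
Qed.

Lemma approxB J w w' g g' : approx J w g -> approx J w' g' -> approx J (w - w') (g - g').
Proof.
move=> [b [h1 h2]] [b' [h1' h2']]; exists (b - b').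
by split; rewrite rmorphB; apply: dividesBB.
Qed.

Lemma approx_nat J m : approx J m%:R m%:R.
Proof. by exists m%:R; rewrite !rmorph_nat !subrr; split; apply: divides0. Qed.

Lemma approx_exp J w g m : approx J w g -> approx J (w ^+ m) (g ^+ m).
Proof.
move=> h; elim: m => [|m ih]; first by rewrite !expr0; apply: (approx_nat J 1).
by rewrite !exprS; apply: approxM.
Qed.

Lemma approx_sum J I (r : seq I) (w : I -> Ryd) (g : I -> {poly c}) :
  (forall l, approx J (w l) (g l)) ->
  approx J (\sum_(l <- r) w l) (\sum_(l <- r) g l).
Proof.
move=> h; elim: r => [|l r ih]; first by rewrite !big_nil; apply: (approx_nat J 0).
by rewrite !big_cons; apply: approxD.
Qed.

Lemma approx_prod J I (r : seq I) (w : I -> Ryd) (g : I -> {poly c}) :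
  (forall l, approx J (w l) (g l)) ->
  approx J (\prod_(l <- r) w l) (\prod_(l <- r) g l).
Proof.
move=> h; elim: r => [|l r ih]; first by rewrite !big_nil; apply: (approx_nat J 1).
by rewrite !big_cons; apply: approxM.
Qed.

Lemma approx_peval J r (w : 'I_r -> Ryd) (g : 'I_r -> {poly c}) P :
  (forall l, approx J (w l) (g l)) ->
  approx J (peval sV w P) (peval (fun v => (cV c v)%:P) g P).
Proof.
move=> h; apply: approx_sum => m; apply: approxM; first exact: approxC.
by apply: approx_prod => l; apply: approx_exp.
Qed.

Lemma approx_exists J w : exists g, approx J w g.
Proof.
have [_ ap _ _ _] := dagger_wc Ryd; have [b hb] := ap J w.
by exists (th b), b; split=> //; rewrite subrr; apply: divides0.
Qed.

Lemma approx_weaken J J' w g : (J <= J')%N -> approx J' w g -> approx J w g.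
Proof.
by move=> le [b [h1 h2]]; exists b; split; apply: divides_expW le _.
Qed.

Lemma approx_unique J w g g' : approx J w g -> approx J w g' ->
  divides (x%:P ^+ J) (g - g').
Proof.
move=> [b [h1 h2]] [b' [h1' h2']].
have [_ _ inj _ _] := dagger_wc Ryd.
have hbb : divides (affC S (d + s) pi ^+ J) (b - b').
  apply: inj; rewrite rmorphB.
  exact: dividesB_trans (dividesBC h1) h1'.
have := divides_rmorph th hbb; rewrite rmorphXn rmorphB thC => h.
exact: dividesB_trans h2 (dividesB_trans h (dividesBC h2')).
Qed.

Lemma approx_value J w g : approx J w g -> divides (x ^+ J) (t w - g.[1]).
Proof.
move=> [b [h1 h2]].
have e : t (din Ryd b) = (th b).[1].
  apply: (@mpoly_rmorph_ext _ _ _ (t \o din Ryd) (horner_eval 1 \o th)) => [v|l] /=.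
    by rewrite /horner_eval thC hornerC tV.
  rewrite /horner_eval -(splitK l); case: (split l) => l' /=.
    by rewrite thx hornerC.
  by rewrite thy hornerZ hornerX mulr1.
apply: (@dividesB_trans _ (th b).[1]).
  by rewrite -e -rmorphB -tV -rmorphXn; apply: divides_rmorph.
have := divides_rmorph (horner_eval 1) h2.
by rewrite rmorphXn rmorphB /= /horner_eval hornerC => /dividesBC.

Qed.

(** [F(x_l)] comes from [R^dagger], so it is approximated by polynomials in [x]
    only, and their specializations are constants. *)
Lemma approx_xfrob J l : approx J (dfrob Ryd (xvar Ryd l)) (csg c (t (xvar Ryd l)))%:P.
Proof.
have [g gE] := pr_poly_rmorph; have [_ ap _ _ _] := dagger_wc Rd.
have xE : xvar Ryd l = pr (din Rd 'X_l) by rewrite hpr pr_polyX.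
have piE : pr (din Rd (affC S d pi)) = PI by rewrite hpr /affC /= pr_polyC.
have [b hb] := ap J (dfrob Rd (din Rd 'X_l)).
have hb' : divides (PI ^+ J) (dfrob Ryd (xvar Ryd l) - din Ryd (pr_poly s b)).
  by rewrite xE hprF -hpr -rmorphB -piE -rmorphXn; apply: divides_rmorph.
exists (pr_poly s b); split=> //.
have -> : th (pr_poly s b) = (t (din Ryd (pr_poly s b)))%:P.
  rewrite -gE; apply: (@mpoly_rmorph_ext _ _ _ (th \o g) (polyC \o t \o din Ryd \o g)).
    by move=> v /=; rewrite gE pr_polyC thC tV.
  by move=> i /=; rewrite gE pr_polyX thx.
rewrite -tF -polyCB -polyC_exp -rmorphB -tV -rmorphXn.
exact/divides_rmorph/divides_rmorph.
Qed.

Notation Xt := (fun l => t (xvar Ryd l)).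
Notation Yt := (fun l => t (yvar Ryd l)).

(** The value of [\sum_i y_i f_i(x)] at the Teichmueller point. *)
Definition fval : c := \sum_(l < s) Yt l * peval (cV c) Xt (f l).

Lemma approx_f J l : approx J (peval sV (xvar Ryd) (f l)) (peval (cV c) Xt (f l))%:P.
Proof.
rewrite (rmorph_peval_comp polyC); apply: approx_peval => i.
by exists 'X_(lshift s i); rewrite thx !subrr; split; apply: divides0.
Qed.

Lemma approx_ffrob J l :
  approx J (peval sV (fun i => dfrob Ryd (xvar Ryd i)) (f l))
           (csg c (peval (cV c) Xt (f l)))%:P.
Proof.
rewrite (rmorph_peval_comp (csg c)) (rmorph_peval_comp polyC).
rewrite (eq_peval (sV' := fun v => (cV c v)%:P) (b' := fun i => (csg c (Xt i))%:P)) //=.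
  by apply: approx_peval => i; apply: approx_xfrob.
by move=> v /=; rewrite csg_V.
Qed.

Lemma approx_y J l : approx J (yvar Ryd l) (Yt l *: 'X).
Proof. by exists 'X_(rshift d l); rewrite thy !subrr; split; apply: divides0. Qed.

(** The specialization of the Dwork exponent, divided by [pistar]. *)
Definition dwork_poly : {poly c} := fval *: 'X - csg c fval *: 'X^q.

Lemma approx_exponent J :
  approx J (dwork_exponent Ryd pistar f) (cV c pistar *: dwork_poly).
Proof.
have -> : cV c pistar *: dwork_poly =
    (cV c pistar)%:P * (\sum_(l < s) (Yt l *: 'X) * (peval (cV c) Xt (f l))%:P) -
    (cV c pistar)%:P *
      (\sum_(l < s) ((Yt l *: 'X) ^+ q) * (csg c (peval (cV c) Xt (f l)))%:P).
  rewrite /dwork_poly scalerBr -!mul_polyC; congr (_ * _ - _ * _).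
    rewrite /fval rmorph_sum /= mulr_suml; apply: eq_bigr => l _.
    by rewrite polyCM mulrAC mul_polyC.
  rewrite /fval rmorph_sum rmorph_sum /= mulr_suml; apply: eq_bigr => l _.
  rewrite rmorphM polyCM -[Yt l *: 'X]mul_polyC exprMn mulrAC; congr (_ * _ * _).
  by rewrite -tF hyF rmorphXn polyC_exp.
apply: approxB; apply: approxM; try exact: approxC.
  by apply: approx_sum => l; apply: approxM; [apply: approx_y | apply: approx_f].
apply: approx_sum => l; apply: approxM; last exact: approx_ffrob.
by rewrite hyF; apply/approx_exp/approx_y.
Qed.

Lemma fact_cancel m : exists l, forall J (w : c),
  divides (x ^+ (J + l)) (m`!%:R * w) -> divides (x ^+ J) w.
Proof.
have m0 : (m`!)%:R != 0 :> V.
  by apply/eqP => /base_natr0 e; have := fact_gt0 m; rewrite e.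
have [_ _ /(_ _ m0) [l [u [uu uE]]]] := base_dvr S; exists l => J w h.
apply: (@unr_cancel _ _ _ _ _ _ _ _ (c_unr c) l); rewrite addnC.
have -> : x ^+ l * w = cV c u^-1 * (m`!%:R * w).
  have e1 : cV c u^-1 * cV c u = 1 by rewrite -rmorphM mulVr // rmorph1.
  rewrite -(rmorph_nat (cV c)) uE rmorphM rmorphXn -[LHS]mul1r -e1; ring.
exact: dividesMl.
Qed.

(** The definition of [E], with the denominators that divide [m!] cleared,
    determines its specialization modulo [t^m.+1] up to [m!]-torsion; as [c]
    is flat this is enough when the precision in [pi] is increased first. *)
Lemma approx_Exp J g m : approx J E g -> vanish m J (g - Exp pistar eta m dwork_poly).
Proof.
move=> hg; have [l cancel] := fact_cancel m.
have [g' hg'] := approx_exists (J + l) E.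
have gg' := approx_unique hg (approx_weaken (leq_addr l J) hg').
have hvan : vanish m J (g' - Exp pistar eta m dwork_poly).
  have [cf cfE] := hE m.
  have /choice [gam gamE] : forall w, exists y, approx (J + l) (cf w) y.
    by move=> w; apply: approx_exists.
  have h1 : approx (J + l) (m`!%:R * E - \sum_(i < m.+1) (m ^_ (m - i))%:R *
      dwork_exponent Ryd pistar f ^+ i) (m`!%:R * (g' - Exp pistar eta m dwork_poly)).
    rewrite mulrBr; apply: approxB; first by apply: approxM => //; apply: approx_nat.
    rewrite /Exp mulr_sumr; apply: approx_sum => i.
    have im : (i <= m)%N by rewrite -ltnS.
    have -> : m`!%:R * (cV c (eps pistar eta i) *: dwork_poly ^+ i) =
        (m ^_ (m - i))%:R * (cV c pistar *: dwork_poly) ^+ i.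
      rewrite exprZn -rmorphXn -(epsE etaE) rmorphM rmorph_nat.
      rewrite -[in LHS](ffact_fact (leq_subr i m)) subKn // natrM.
      by rewrite -!mul_polyC polyCM polyC_natr; ring.
    by apply: approxM; [apply: approx_nat | apply/approx_exp/approx_exponent].
  have h2 : approx (J + l) (\sum_g cf g * \prod_(i < m.+1) yvar Ryd (g i))
      (\sum_g gam g * \prod_(i < m.+1) (Yt (g i) *: 'X)).
    apply: approx_sum => w; apply: approxM => //.
    by apply: approx_prod => i; apply: approx_y.
  rewrite cfE in h1; have [y yE] := approx_unique h1 h2.
  move=> j jm; apply: cancel.
  have := congr1 (fun u : {poly c} => u`_j) yE; rewrite -polyC_exp coefB coefCM.
  rewrite [X in _ - X](_ : _ = 0) ?subr0; last first.
    rewrite coef_sum big1 // => w _; rewrite scaler_prod prodr_const card_ord.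
    by rewrite -scalerAr coefZ coefMXn ltnS jm mulr0.
  rewrite -polyC_natr coefCM => ->; exact: divides_mulr.
move=> j jm; have -> : g - Exp pistar eta m dwork_poly =
  (g - g') + (g' - Exp pistar eta m dwork_poly) by rewrite addrA subrK.
rewrite coefD; apply: dividesD; last exact: hvan.
have [y ->] := gg'; rewrite -polyC_exp coefCM; exact: divides_mulr.
Qed.

Lemma exp_value_dwork : exp_value pistar eta dwork_poly (t E).
Proof.
move=> J; have [g hg] := approx_exists J E; exists g; split.
  by move=> m; apply: approx_Exp.
exact: approx_value.
Qed.

End Approximation.

(** The product of the values of [E] along a Frobenius orbit: the exponents
    telescope. *)
Lemma exp_value_orbit m :
  exp_value pistar eta (fval *: 'X - iter m (csg c) fval *: 'X^(q ^ m))
    (\prod_(j < m) iter j (csg c) (t E)).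
Proof.
have [th [thC thx thy]] := specialization_exists.
have q0 : (0 < q)%N by rewrite expn_gt0 prime_gt0 ?(base_prime S).
have qm0 j : (0 < q ^ j)%N by rewrite expn_gt0 q0.
pose Z j : {poly c} :=
  iter j (csg c) fval *: 'X^(q ^ j) - iter j.+1 (csg c) fval *: 'X^(q ^ j.+1).
have dZ j : divides 'X (Z j) by apply: dividesB; apply: divides_scaleX.
have hZ j : exp_value pistar eta (Z j) (iter j (csg c) (t E)).
  elim: j => [|j ih].
    rewrite /Z expn0 !expn1 expr1; exact: (exp_value_dwork thC thx thy).
  have := exp_value_subst (sg := csg c) (@csg_V _ _ _ _ c) q0 ih.
  rewrite /Z rmorphB /= !map_polyZ /= !map_polyXn rmorphB /= !comp_polyZ.
  by rewrite !comp_Xn_poly -!exprM -!expnS.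
elim: m => [|m ih].
  by rewrite big_ord0 expn0 expr1 subrr; apply: exp_value0.
rewrite big_ord_recr /=.
have -> : fval *: 'X - csg c (iter m (csg c) fval) *: 'X^(q ^ m.+1) =
    (fval *: 'X - iter m (csg c) fval *: 'X^(q ^ m)) + Z m.
  by rewrite /Z addrA subrK.
apply: (exp_valueM etaE) => //.
apply: dividesB; last exact: divides_scaleX.
by have := divides_scaleX fval (ltn0Sn 0); rewrite expr1.
Qed.

End DworkPoint.

(** * Additive character sums *)

Section CharacterSum.
Variables (p a : nat) (S : base p a).
Notation V := (bV S).
Variable pistar : V.
Hypothesis hpistar : pistar ^+ p.-1 = - p%:R.
Variable eta : nat -> V.
Hypothesis etaE : dwork_coefs pistar eta.
Variables (n : nat) (c : comparison_ring S n) (M : nat).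
Hypothesis M0 : (0 < M)%N.
Notation L := (cL c).
Notation Q := (p ^ M)%N.
Variable rs : seq L.
Hypothesis rs_uniq : uniq rs.
Hypothesis rs_size : size rs = Q.
Hypothesis rsE : forall z, (z \in rs) = (z ^+ Q == z).

Variables (s : nat) (lam : 'I_s -> L).
Hypothesis lamE : forall i, lam i ^+ Q = lam i.

Definition frob_fixed (w : {ffun 'I_s -> L}) := [forall i, w i ^+ Q == w i].

Lemma frob_fixedP (w : {ffun 'I_s -> L}) :
  reflect (forall i, w i ^+ Q = w i) (frob_fixed w).
Proof. by apply: (iffP forallP) => h i; apply/eqP; exact: h. Qed.

Lemma frob_fixedD (w w' : {ffun 'I_s -> L}) :
  frob_fixed w -> frob_fixed w' -> frob_fixed (w + w').
Proof.
move=> /frob_fixedP h /frob_fixedP h'; apply/frob_fixedP => i.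
have [fr frE] := frobenius_rmorph M (unr_pchar (ck c)).
by rewrite ffunE -frE rmorphD /= !frE h h'.
Qed.

Lemma frob_fixedN (w : {ffun 'I_s -> L}) : frob_fixed w -> frob_fixed (- w).
Proof.
move=> /frob_fixedP h; apply/frob_fixedP => i.
have [fr frE] := frobenius_rmorph M (unr_pchar (ck c)).
by rewrite ffunE -frE rmorphN /= !frE h.
Qed.

Lemma card_frob_fixed : #|[pred w | frob_fixed w]| = (Q ^ s)%N.
Proof.
have <- : #|mem rs| = Q by rewrite -rs_size; apply/card_uniqP.
rewrite -[in RHS](card_ord s) -card_ffun_on; apply: eq_card => w.
rewrite !inE; apply/forallP/ffun_onP => h i; have := h i; by rewrite rsE.
Qed.

Variables (F chi : {ffun 'I_s -> L} -> c).
Hypothesis F_res : forall w, frob_fixed w -> cres c (F w) = \sum_i w i * lam i.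
Hypothesis chi_val : forall w, frob_fixed w ->
  exp_value pistar eta (F w *: ('X - 'X^Q)) (chi w).

Lemma Q_gt0 : (0 < Q)%N.
Proof. by rewrite expn_gt0 prime_gt0 ?(base_prime S). Qed.

Lemma chi_trivial (w : {ffun 'I_s -> L}) : frob_fixed w -> cres c (F w) = 0 -> chi w = 1.
Proof.
move=> hw w0; apply: exp_value_unique (chi_val hw) _.
by apply: (exp_value_trivial etaE w0 Q_gt0).
Qed.

(** [F] is additive modulo [pi], and an error divisible by [pi] contributes the
    value 1. *)
Lemma chiD (w w' : {ffun 'I_s -> L}) :
  frob_fixed w -> frob_fixed w' -> chi (w + w') = chi w * chi w'.
Proof.
move=> hw hw'; have hD := frob_fixedD hw hw'.
have dX (u : c) : divides 'X (u *: ('X - 'X^Q)).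
  rewrite scalerBr; apply: dividesB; last by apply: divides_scaleX; apply: Q_gt0.
  by have := divides_scaleX u (ltn0Sn 0); rewrite expr1.
apply: exp_value_unique (chi_val hD) _.
have res0 : cres c (F (w + w') - (F w + F w')) = 0.
  rewrite rmorphB rmorphD !F_res // -big_split -sumrB big1 //= => i _.
  by rewrite ffunE; ring.
have h1 := exp_valueM etaE (dX _) (dX _) (chi_val hw) (chi_val hw').
have h2 := exp_value_trivial etaE res0 Q_gt0.
rewrite -scalerDl in h1.
have := exp_valueM etaE (dX _) (dX _) h1 h2; rewrite -scalerDl mulr1.
by rewrite addrC subrK.
Qed.

(** If all values of [chi] were trivial modulo [pistar * pi], then the nonzero
    polynomial [\sum_(j < M) eta_(p^(K + j)) t^(p^j)], of degree less than [Q],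
    would vanish on the field with [Q] elements. *)
Lemma chi_nontrivial i0 : lam i0 != 0 ->
  exists (w : {ffun 'I_s -> L}) h,
    [/\ frob_fixed w, chi w = 1 + cV c pistar * h & cres c h != 0].
Proof.
move=> l0; have p1 := prime_gt1 (base_prime S).
apply: contrapT => none.
have /choice [K0 K0E] : forall w : {ffun 'I_s -> L}, exists K0, forall K,
    (K0 <= K)%N -> frob_fixed w ->
    \sum_(j < M) cres c (cV c (eta (p ^ (K + j)))) * cres c (F w) ^+ (p ^ (K + j)) = 0.
  move=> w; case: (boolP (frob_fixed w)) => hw; last by exists 0%N.
  have [h [K0 [hE hK]]] := exp_value_residue hpistar etaE M0 (chi_val hw).
  exists K0 => K le _; rewrite -hK //; apply/eqP/negP => /negP h0.
  by apply: none; exists w, h.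
pose K1 := \max_w K0 w; pose K := (M * K1)%N.
have KE w : (K0 w <= K)%N.
  by apply: leq_trans (leq_bigmax w) _; rewrite /K leq_pmull.
pose g j := cres c (cV c (eta (p ^ (K + j)))).
pose P : {poly L} := \sum_(j < M) g j *: 'X^(p ^ j).
have P0 : P != 0.
  apply/eqP => /(congr1 (fun h : {poly L} => h`_1)); rewrite coef0 coef_sum.
  rewrite (bigD1 (Ordinal M0)) //= big1 => [|j j0]; last first.
    rewrite coefZ coefXn; case: eqP => [e|]; last by rewrite mulr0.
    case/eqP: j0; apply/val_inj => /=; apply/eqP; rewrite -leqn0 leqNgt.
    by apply/negP => jp; have := ltn_expl j p1; rewrite -e; case: (nat_of_ord j) jp.
  rewrite addr0 coefZ expn0 coefXn eqxx mulr1 => /eqP; apply/negP.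
  have pK : (0 < p ^ (K + 0))%N by rewrite expn_gt0 prime_gt0 ?(base_prime S).
  rewrite /g (unr_res (c_unr c)) fmorph_eq0.
  by have [_ [_ h]] := etaE pK; apply: h; exists (K + 0)%N.
have sP : (size P <= Q)%N.
  apply: leq_trans (size_sum _ _ _) _; apply/bigmax_leqP => j _.
  by apply: leq_trans (size_scale_leq _ _) _; rewrite size_polyXn ltn_exp2l.
have := max_poly_roots P0 _ rs_uniq; rewrite rs_size => /(_ _) h.
have : (Q < size P)%N; last by rewrite ltnNge sP.
apply: h; apply/allP => z; rewrite rsE => /eqP zE.
pose w : {ffun 'I_s -> L} := [ffun i => if i == i0 then z / lam i0 else 0].
have hw : frob_fixed w.
  apply/frob_fixedP => i; rewrite ffunE; case: eqP => _.
    by rewrite exprMn exprVn zE lamE.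
  by rewrite expr0n -[Q == 0%N]negbK -lt0n Q_gt0.
have wz : cres c (F w) = z.
  rewrite F_res // (bigD1 i0) //= ffunE eqxx divfK // big1 ?addr0 // => i ii.
  by rewrite ffunE (negPf ii) mul0r.
have hK := K0E w K (KE w) hw; rewrite wz in hK.
rewrite rootE horner_sum; apply/eqP; rewrite -[RHS]hK.
apply: eq_bigr => j _; rewrite hornerZ hornerXn; congr (_ * _).
rewrite expnD exprM; congr (_ ^+ _).
rewrite /K expnM; elim: (K1) => [|l ih]; first by rewrite expn0 expr1.
by rewrite expnS exprM zE.
Qed.

(** Translation by [w0] multiplies the sum by [chi w0 = 1 + pistar h], where [h]
    is a unit. *)
Lemma chi_sum : \sum_(w | frob_fixed w) chi w =
  if [forall i, lam i == 0] then (Q ^ s)%:R else 0.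
Proof.
case: ifPn => [/forallP l0|].
  rewrite (eq_bigr (fun=> 1)) => [|w hw].
    by rewrite sumr_const card_frob_fixed.
  apply: chi_trivial => //; rewrite F_res // big1 // => i _.
  by rewrite (eqP (l0 i)) mulr0.
rewrite negb_forall => /existsP [i0 /chi_nontrivial [w0 [h [hw0 w0E rh]]]].
set sm := \sum_(w | _) _.
have e : sm = chi w0 * sm.
  rewrite {1}/sm (reindex_inj (addrI w0)) /= mulr_sumr.
  rewrite (eq_bigl frob_fixed) => [|w].
    by apply: eq_bigr => w hw; rewrite chiD.
  apply/idP/idP => hw; last exact: frob_fixedD.
  by rewrite -(addKr w0 w) frob_fixedD // frob_fixedN.
apply: (unr_res_regular (c_unr c) rh); apply: (pistar_regular hpistar).
rewrite mulrA; apply: (addrI sm); rewrite addr0 -[in LHS](mul1r sm) -mulrA.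
by rewrite [in RHS]e w0E; ring.
Qed.

End CharacterSum.

(** * Tensor product with a rank one module *)

Section RankOne.
Variables (R : comPzRingType) (F : {rmorphism R -> R}).

Lemma tens_mx1 m : (1%:M : 'M[R]_m) *t (1%:M : 'M[R]_1) = 1%:M.
Proof.
apply/matrixP => i j.
case: (mxtens_indexP i) => i0 i1; case: (mxtens_indexP j) => j0 j1.
rewrite tensmxE !mxE (inj_eq (can_inj (@mxtens_indexK _ _))) xpair_eqE.
by case: (i0 == j0); case: (i1 == j1); rewrite /= ?mulr1n ?mulr0n ?mul0r ?mulr0 ?mulr1.
Qed.

Lemma frobenius_iter_tens m (A : 'M[R]_m) (b : R) n :
  frobenius_iter_mx F (A *t (b%:M : 'M_1)) n =
  frobenius_iter_mx F A n *t ((\prod_(l < n) iter l F b)%:M : 'M_1).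
Proof.
elim: n => [|n ih]; first by rewrite big_ord0 /= tens_mx1.
rewrite /= ih map_mxT tensmx_mul map_scalar_mx -scalar_mxM; congr (_ *t _%:M).
by rewrite big_ord_recl rmorph_prod.
Qed.

Lemma trace_tens1 m (A : 'M[R]_m) (b : R) : \tr (A *t (b%:M : 'M_1)) = \tr A * b.
Proof.
rewrite /mxtrace mulr_suml (reindex (fun i : 'I_m => mxtens_index (i, 0 : 'I_1))) /=.
  by apply: eq_bigr => i _; rewrite tensmxE mxE eqxx mulr1n.
exists (fun k => (mxtens_unindex k).1) => [i _|k _]; first by rewrite mxtens_indexK.
case: (mxtens_indexP k) => i j; rewrite mxtens_indexK /=; congr mxtens_index.
by congr pair; rewrite [RHS]ord1.
Qed.

Lemma cV_basis m : is_basis (N := 'cV[R]_m) (fun i => delta_mx i 0).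
Proof.
have sumE (w : 'cV[R]_m) : w = \sum_i w i 0 *: (delta_mx i 0 : 'cV[R]_m).
  by rewrite {1}(matrix_sum_delta w); apply: eq_bigr => i _; rewrite big_ord1.
move=> v; exists v; split=> // w ->.
apply/colP => i; rewrite summxE (bigD1 i) //= mxE mxE !eqxx mulr1 big1 ?addr0 // => j ji.
by rewrite !mxE eq_sym (negPf ji) mulr0.
Qed.

Lemma frobenius_of_mx_semilinear m (C : 'M[R]_m) :
  is_semilinear F (frobenius_of_mx F C).
Proof.
move=> c u v; rewrite /frobenius_of_mx map_mxD mulmxDr; congr (_ + _).
by rewrite map_mxZ scalemxAr.
Qed.

Lemma frobenius_of_mx_matrix m (C : 'M[R]_m) :
  is_frobenius_matrix (N := 'cV[R]_m) (frobenius_of_mx F C) (fun i => delta_mx i 0) C.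
Proof.
move=> i; rewrite /frobenius_of_mx map_delta_mx -colE.
rewrite [LHS]matrix_sum_delta; apply: eq_bigr => l _.
by rewrite big_ord1 mxE.
Qed.

End RankOne.

(** * Points of affine space *)

Section Affine.
Variables (p a : nat) (S : base p a).
Notation V := (bV S).
Notation k := (bk S).
Notation pi := (bpi S).
Notation q := (p ^ a)%N.

Lemma affR_surj r : is_surj (affR S r).
Proof.
have [/choice [s sK] _] := base_residue S; move=> g.
exists (\sum_(m <- msupp g) s g@_m *: 'X_[m]); rewrite rmorph_sum [RHS]mpolyE.
by apply: eq_bigr => m _; rewrite /affR /= map_mpolyZ map_mpolyX sK.
Qed.

Lemma affR_kernel r (g : {mpoly V[r]}) : affR S r g = 0 -> divides (affC S r pi) g.
Proof.
have [_ rE] := base_residue S; move=> g0.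
have /choice [s sE] : forall m, exists v, g@_m = pi * v.
  by move=> m; apply/rE; rewrite -mcoeff_map_mpoly -[map_mpoly _ _]/(affR S r g) g0 mcoeff0.
exists (\sum_(m <- msupp g) s m *: 'X_[m]); rewrite mulr_sumr {1}[g]mpolyE.
apply: eq_bigr => m _; rewrite sE /affC /= mul_mpolyC scalerA //.
Qed.

Lemma affR_pi r : affR S r (affC S r pi) = 0.
Proof.
have [_ rE] := base_residue S.
have e : bres S pi = 0 by apply/rE/divides_refl.
by rewrite /affR /affC /= map_mpolyC /= e mpolyC0.
Qed.

Variables (n : nat) (c : comparison_ring S n).
Notation L := (cL c).

Lemma aff_point_exists r (u : {ffun 'I_r -> L}) :
  exists P : {rmorphism {mpoly k[r]} -> L}, is_point (affR S r) u P.
Proof.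
exists (mmap (ck c) u); split=> [i|v] /=.
  by rewrite /affR /= map_mpolyX mmapX mmap1U.
by rewrite /affR /= map_mpolyC mmapC.
Qed.

(** It suffices to compare residues on the variables, because every element of
    the weak completion is a polynomial modulo [pi]. *)
Lemma aff_teich r (Dr : aff_dagger S r) (u : {ffun 'I_r -> L}) P
    (t : {rmorphism Dr -> c}) :
  is_point (affR S r) u P ->
  (forall v, t (din Dr (affC S r v)) = cV c v) ->
  (forall w, t (dfrob Dr w) = csg c (t w)) ->
  (forall l, cres c (t (din Dr 'X_l)) = u l) -> is_teich P t.
Proof.
move=> [PX PC] tV tF tu; split=> // w.
have poly b : cres c (t (din Dr b)) = P (affR S r b).
  apply: (@mpoly_rmorph_ext _ _ _ (cres c \o t \o din Dr) (P \o affR S r)) => [v|l] /=.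
    by rewrite tV (unr_res (c_unr c)) PC.
  by rewrite tu PX.
have [_ ap _ _ _] := dagger_wc Dr; have [b [w']] := ap 1%N w; rewrite expr1 => bE.
have -> : w = din Dr b + din Dr (affC S r pi) * w' by rewrite -bE addrC subrK.
rewrite !rmorphD !rmorphM /= poly !dagger_red tV affR_pi rmorph0 mul0r.
by have /(unr_res0 (c_unr c)) -> := divides_refl (cV c pi); rewrite mul0r.
Qed.

Definition join d s (v : {ffun 'I_d -> L}) (w : {ffun 'I_s -> L}) :
    {ffun 'I_(d + s) -> L} :=
  [ffun l => match split l with inl i => v i | inr i => w i end].

Lemma join_l d s (v : {ffun 'I_d -> L}) (w : {ffun 'I_s -> L}) l :
  join v w (lshift s l) = v l.
Proof. by rewrite ffunE -[lshift s l]/(unsplit (inl l)) unsplitK. Qed.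

Lemma join_r d s (v : {ffun 'I_d -> L}) (w : {ffun 'I_s -> L}) l :
  join v w (rshift d l) = w l.
Proof. by rewrite ffunE -[rshift d l]/(unsplit (inr l)) unsplitK. Qed.

Lemma sum_join d s (R : nmodType) (Pd : pred {ffun 'I_d -> L}) (Ps : pred {ffun 'I_s -> L})
    (G : {ffun 'I_(d + s) -> L} -> R) (Pds : pred {ffun 'I_(d + s) -> L}) :
  (forall v w, Pds (join v w) = Pd v && Ps w) ->
  \sum_(u | Pds u) G u = \sum_(v | Pd v) \sum_(w | Ps w) G (join v w).
Proof.
move=> hP; rewrite pair_big_dep /= (reindex (fun vw => join vw.1 vw.2)) /=.
  by apply: eq_bigl => -[v w] /=; rewrite hP.
exists (fun u => ([ffun l => u (lshift s l)], [ffun l => u (rshift d l)])).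
  move=> [v w] _ /=; congr pair; apply/ffunP => l; first by rewrite ffunE join_l.
  by rewrite ffunE join_r.
move=> u _; apply/ffunP => l /=; rewrite -[l]splitK.
by case: (split l) => l'; rewrite /= ?join_l ?join_r ffunE.
Qed.

End Affine.

(** * Sums over the fibres of the projection *)

Lemma fixed_roots (p a : nat) (S : base p a) n (c : comparison_ring S n) j :
  (0 < j <= n)%N -> exists rs : seq (cL c),
    [/\ uniq rs, size rs = (p ^ (a * j))%N &
        forall z, (z \in rs) = (z ^+ (p ^ (a * j)) == z)].
Proof.
move=> jn; have j0 : (0 < j)%N by case/andP: jn.
have [rs [urs rsE]] := c_split jn (dvdpp ('X^((p ^ a) ^ j) - 'X : {poly cL c})).
rewrite -expnM in rsE; exists rs; split=> // [|z].
  apply/eqP; rewrite -eqSS -(size_prod_XsubC rs id) -(eqp_size rsE).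
  rewrite size_polyDl ?size_polyXn // size_polyN size_polyX ltnS.
  have : (p ^ 0 < p ^ (a * j))%N.
    by rewrite ltn_exp2l ?prime_gt1 ?(base_prime S) // muln_gt0 (base_a_gt0 S).
  by rewrite expn0.
by rewrite -root_prod_XsubC -(eqp_root rsE) rootE !hornerE subr_eq0.
Qed.

Section Fibre.
Variables (p a : nat) (S : base p a).
Notation V := (bV S).
Notation k := (bk S).
Notation q := (p ^ a)%N.
Variables (n : nat) (c : comparison_ring S n).
Notation L := (cL c).
Variables (d s : nat) (f : 'I_s -> {mpoly V[d]}).

Lemma point_of_zero (A A0 : comPzRingType) (sA : {rmorphism V -> A})
    (rA : {rmorphism A -> A0}) (h : {rmorphism {mpoly V[d]} -> A})
    (hA : is_presentation sA f h) (hA0 : is_quotient (sA (bpi S)) rA)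
    (v : {ffun 'I_d -> L}) (P : {rmorphism {mpoly k[d]} -> L}) :
  is_point (affR S d) v P ->
  (forall i, P (affR S d (f i)) = 0) <->
  (exists P' : {rmorphism A0 -> L}, is_point (rA \o h) v P').
Proof.
move=> [PX PC]; have [hC hS hK] := hA; have [rS rE] := hA0; split; last first.
  move=> [P' [P'X P'C]] i.
  have -> : P (affR S d (f i)) = P' ((rA \o h) (f i)).
    apply: (@mpoly_rmorph_ext _ _ _ (P \o affR S d) (P' \o (rA \o h))) => [x|l].
      by move: (P'C x) (PC x) => /= -> ->.
    by move: (P'X l) (PX l) => /= -> ->.
  have hf : h (f i) = 0.
    apply/hK; exists (fun l => if l == i then 1 else 0).
    rewrite (bigD1 i) //= eqxx mul1r big1 ?addr0 // => l li.
    by rewrite (negPf li) mul0r.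
  by rewrite /= hf !rmorph0.
move=> Pf.
have [||P' P'E] := @factor_rmorph _ _ _ (rA \o h) (P \o affR S d).
- by move=> y; have [b <-] := rS y; have [g <-] := hS b; exists g.
- move=> g /= /rE [b bE]; have [g' g'E] := hS b.
  have /hK [cf cfE] : h (g - affC S d (bpi S) * g') = 0.
    by rewrite rmorphB rmorphM /= hC g'E bE subrr.
  have {g bE cfE}-> : g = \sum_i cf i * f i + affC S d (bpi S) * g' by rewrite -cfE subrK.
  have [G GE] : exists G : {rmorphism {mpoly V[d]} -> L}, G =1 P \o affR S d.
    by exists (P \o affR S d).
  have Gpi : G (affC S d (bpi S)) = 0 by rewrite GE /= affR_pi rmorph0.
  rewrite -[LHS]GE rmorphD rmorphM Gpi mul0r addr0 rmorph_sum big1 // => i _.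
  by rewrite rmorphM [X in _ * X]GE /= Pf mulr0.
exists P'; split=> [l|x]; first by rewrite P'E /= PX.
by rewrite P'E /= PC.
Qed.

Variable pistar : V.
Hypothesis hpistar : pistar ^+ p.-1 = - p%:R.
Variable eta : nat -> V.
Hypothesis etaE : dwork_coefs pistar eta.
Variables (Rd : aff_dagger S d) (Ryd : aff_dagger S (d + s)) (pr : {rmorphism Rd -> Ryd}).
Hypothesis hpr : forall g, pr (din Rd g) = din Ryd (pr_poly s g).
Hypothesis hprF : forall w, dfrob Ryd (pr w) = pr (dfrob Rd w).
Hypothesis hyF : forall i, dfrob Ryd (yvar Ryd i) = yvar Ryd i ^+ q.
Variables (E : Ryd) (hE : is_exp (yvar Ryd) (dwork_exponent Ryd pistar f) E).
Variables (PA : {ffun 'I_(d + s) -> L} -> {rmorphism {mpoly k[d + s]} -> L})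
          (tA : {ffun 'I_(d + s) -> L} -> {rmorphism Ryd -> c})
          (PR : {ffun 'I_d -> L} -> {rmorphism {mpoly k[d]} -> L}).
Hypothesis PA_point : forall u, is_point (affR S (d + s)) u (PA u).
Hypothesis tA_teich : forall u, is_teich (PA u) (tA u).
Hypothesis PR_point : forall v, is_point (affR S d) v (PR v).

Lemma teich_pr v w : is_teich (PR v) (tA (join v w) \o pr).
Proof.
have [tV tr tF] := tA_teich (join v w); have [PX _] := PA_point (join v w).
apply: (aff_teich (PR_point v)) => [x|x|l] /=.
- by rewrite hpr /affC /= pr_polyC tV.
- by rewrite -hprF tF.
- by rewrite hpr pr_polyX tr dagger_red PX join_l.
Qed.

Lemma teich_pr_indep v w w' : tA (join v w) \o pr =1 tA (join v w') \o pr.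
Proof.
exact: (teich_unique (@affR_kernel _ _ S d) (affR_pi S d) (teich_pr v w) (teich_pr v w')).
Qed.

Lemma fval_teich u : fval f (tA u) =
  tA u (\sum_(l < s) yvar Ryd l *
        peval (fun x => din Ryd (affC S (d + s) x)) (xvar Ryd) (f l)).
Proof.
have [tV _ _] := tA_teich u.
rewrite rmorph_sum; apply: eq_bigr => l _; rewrite rmorphM rmorph_peval_comp.
by congr (_ * _); apply: eq_peval => // x /=; rewrite tV.
Qed.

Variable j : nat.
Hypothesis jn : (0 < j <= n)%N.

Lemma teich_fixed (u : {ffun 'I_(d + s) -> L}) w : (forall l, u l ^+ (q ^ j) = u l) ->
  iter j (csg c) (tA u w) = tA u w.
Proof.
move=> fu; have [tV tr tF] := tA_teich u.
have [sg sgE] : exists sg : {rmorphism c -> c}, sg =1 iter j (csg c).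
  elim: (j) => [|m [sg sgE]]; first by exists idfun.
  by exists (csg c \o sg) => z /=; rewrite sgE.
have ht : is_teich (PA u) (sg \o tA u).
  split=> [x|z|z] /=; rewrite ?sgE.
  - by rewrite tV; elim: (j) => [//|m ih]; rewrite iterS ih csg_V.
  - have surj := @affR_surj _ _ S (d + s).
    rewrite -(point_fixed surj (PA_point u) fu) -tr.
    elim: (j) => [|m ih]; first by rewrite expn0 expr1.
    by rewrite iterS csg_res ih -exprM -expnSr.
  - by rewrite tF -iterSr -iterS.
rewrite -sgE.
exact: (teich_unique (@affR_kernel _ _ S (d + s)) (affR_pi S (d + s)) ht (tA_teich u)).
Qed.

(** The value at the point [(v, w)] of the [j]-th iterate of the Dwork
    Frobenius is an additive character of [\sum_i w_i f_i(v)]. *)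
Lemma dwork_fibre_sum (v : {ffun 'I_d -> L}) : (forall l, v l ^+ (q ^ j) = v l) ->
  \sum_(w : {ffun 'I_s -> L} | [forall i, w i ^+ (q ^ j) == w i])
     \prod_(l < j) iter l (csg c) (tA (join v w) E) =
  if [forall i, PR v (affR S d (f i)) == 0] then ((q ^ j) ^ s)%:R else 0.
Proof.
move=> fv; have [j0 _] := andP jn.
have M0 : (0 < a * j)%N by rewrite muln_gt0 (base_a_gt0 S).
have [rs [urs srs rsE]] := fixed_roots c jn.
have lamE i : PR v (affR S d (f i)) ^+ (p ^ (a * j)) = PR v (affR S d (f i)).
  by rewrite expnM; apply: (point_fixed (@affR_surj _ _ S d) (PR_point v) fv).
pose chi w := \prod_(l < j) iter l (csg c) (tA (join v w) E).
pose F w := fval f (tA (join v w)).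
have F_res w : frob_fixed (a * j) w ->
    cres c (F w) = \sum_i w i * PR v (affR S d (f i)).
  move=> _; have [_ tr _] := tA_teich (join v w).
  have [PX PC] := PR_point v; have [PAX _] := PA_point (join v w).
  rewrite rmorph_sum; apply: eq_bigr => i _; rewrite rmorphM tr dagger_red PAX join_r.
  congr (_ * _); rewrite rmorph_peval_comp.
  rewrite -[RHS]/((PR v \o affR S d) (f i)) (rmorph_peval (PR v \o affR S d)).
  apply: eq_peval => [x|l] /=; first by rewrite (unr_res (c_unr c)) PC.
  by rewrite tr dagger_red PAX join_l PX.
have chi_val w : frob_fixed (a * j) w ->
    exp_value pistar eta (F w *: ('X - 'X^(p ^ (a * j)))) (chi w).
  move=> /frob_fixedP fw; have [tV _ tF] := tA_teich (join v w).
  have := exp_value_orbit etaE hpr hprF hyF hE tV tF j.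
  rewrite fval_teich teich_fixed; last first.
    move=> l; rewrite -[l]splitK; case: (split l) => l' /=; first by rewrite join_l fv.
    by rewrite join_r -expnM fw.
  by rewrite -fval_teich -scalerBr -expnM.
rewrite -expnM; exact: (chi_sum hpistar etaE M0 urs srs rsE lamE F_res chi_val).
Qed.

End Fibre.

(** * Comparison of the two L-functions *)

Theorem mainTheorem4 (p a : nat) (S : base p a) (d s : nat)
  (* A = V[x_1, ..., x_d] / (f_1, ..., f_s), smooth over V, and A_0 = A / pi A *)
  (f : 'I_s -> {mpoly (bV S)[d]})
  (A A0 : comPzRingType)
  (sA : {rmorphism bV S -> A}) (rA : {rmorphism A -> A0})
  (h : {rmorphism {mpoly (bV S)[d]} -> A})
  (hA : is_presentation sA f h) (hsm : smooth sA)
  (hA0 : is_quotient (sA (bpi S)) rA)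
  (* A^dagger with its Frobenius *)
  (Ad : dagger sA rA)
  (* (M, phi_M), with a basis e and the matrix C of phi_M *)
  (M : lmodType Ad) (phiM : M -> M) (hphi : is_semilinear (dfrob Ad) phiM)
  (m : nat) (e : 'I_m -> M) (he : is_basis e)
  (C : 'M[Ad]_m) (hC : is_frobenius_matrix phiM e C)
  (* the root pi^* *)
  (pistar : bV S) (hpistar : pistar ^+ p.-1 = - p%:R)
  (* R^dagger with its Frobenius, and mu : R^dagger -> A^dagger *)
  (Rd : aff_dagger S d) (mu : {rmorphism Rd -> Ad})
  (hmu : forall g, mu (din Rd g) = din Ad (h g))
  (hmuF : forall w, mu (dfrob Rd w) = dfrob Ad (mu w))
  (* the matrix C_0 of the Frobenius of M_0 *)
  (C0 : 'M[Rd]_m) (hC0 : map_mx mu C0 = C)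
  (* R[y]^dagger with its Frobenius, and pr : R^dagger -> R[y]^dagger *)
  (Ryd : aff_dagger S (d + s)) (pr : {rmorphism Rd -> Ryd})
  (hpr : forall g, pr (din Rd g) = din Ryd (pr_poly s g))
  (hprF : forall w, dfrob Ryd (pr w) = pr (dfrob Rd w))
  (hyF : forall i, dfrob Ryd (yvar Ryd i) = yvar Ryd i ^+ (p ^ a))
  (* the Frobenius e |-> E e of f^*(L_psi) *)
  (E : Ryd) (hE : is_exp (yvar Ryd) (dwork_exponent Ryd pistar f) E)
  (* the fields k(x), rings V(x) and Teichmueller lifts at the closed points *)
  (TX : forall x : closed_point A0, teichmueller Ad x)
  (TA : forall x : closed_point {mpoly (bk S)[d + s]}, teichmueller Ryd x) :
  Lfun TX phiM =1
  rescale ((p ^ a)%:R ^- s)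
    (Lfun TA (frobenius_of_mx (dfrob Ryd) (map_mx pr C0 *t (E%:M : 'M_1)))).
Proof.
move=> n; have [hXC hS hK] := hA; have [rS rE] := hA0.
have [eta etaE] := exp_coef_exists hpistar.
have [c] := comparison_ring_exists S n.
have HXC v : (rA \o h) v%:MP = rA (sA v) by rewrite /= hXC.
have HXS : is_surj (rA \o h).
  by move=> y; have [b <-] := rS y; have [g <-] := hS b; exists g.
have rApi b : rA b = 0 -> divides (sA (bpi S)) b by move/rE.
have rApi0 : rA (sA (bpi S)) = 0 by apply/rE/divides_refl.
have [LX [SX [-> LX0 SX0 LXd SXE]]] := Lfun_trace_formula HXC HXS c TX hphi he hC.
pose C' := map_mx pr C0 *t (E%:M : 'M_1).
rewrite /rescale.
have [LA [SA [-> LA0 SA0 LAd SAE]]] := Lfun_trace_formula (H := affR S (d + s))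
  (fun=> erefl) (@affR_surj _ _ S (d + s)) c TA
  (frobenius_of_mx_semilinear (dfrob Ryd) C') (@cV_basis Ryd _)
  (frobenius_of_mx_matrix (dfrob Ryd) C').
suff main j : (0 < j <= n)%N -> SA`_j = ((p ^ a) ^ s)%:R ^+ j * SX`_j.
  rewrite (log_deriv_rescale (@base_natr0 _ _ S) LXd LAd LX0 LA0 SX0 SA0
    main (leqnn n)).
  have q0 : ((p ^ a)%:R : {fraction bV S}) != 0.
    rewrite -(rmorph_nat (@FracField.tofrac (bV S))) tofrac_eq0.
    apply/eqP => /base_natr0 e0; have := prime_gt0 (base_prime S).
    by move: e0 => /eqP; rewrite expn_eq0 => /andP[/eqP ->].
  have e0 : FracField.tofrac (((p ^ a) ^ s)%:R : bV S) = (p ^ a)%:R ^+ s.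
    by rewrite rmorph_nat natrX.
  have -> : FracField.tofrac (((p ^ a) ^ s)%:R ^+ n * LX`_n) =
      ((p ^ a)%:R ^+ s) ^+ n * FracField.tofrac LX`_n.
    by rewrite tofracM tofracXn e0.
  by rewrite mulrA -exprMn mulVf ?expf_neq0 // expr1n mul1r.
move=> hj.
have /choice [PA PAE] := @aff_point_exists _ _ S n c (d + s).
have /choice [PR PRE] := @aff_point_exists _ _ S n c d.
have /choice [tA tAE] : forall u, exists t : {rmorphism Ryd -> c}, is_teich (PA u) t.
  by move=> u; apply: (teich_exists (fun=> erefl) (@affR_surj _ _ S (d + s)) TA (PAE u)).
have tRE := teich_pr_indep hpr hprF PAE tAE PRE.
have tRT := teich_pr hpr hprF PAE tAE PRE.
pose tR v : {rmorphism Rd -> c} := tA (join v 0) \o pr.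
pose sX v := \tr (frobenius_iter_mx (csg c) (map_mx (tR v) C0) j).
pose chi v w := \prod_(l < j) iter l (csg c) (tA (join v w) E).
have traceA v w : \tr (frobenius_iter_mx (csg c) (map_mx (tA (join v w)) C') j) =
    sX v * chi v w.
  rewrite map_mxT map_scalar_mx frobenius_iter_tens trace_tens1.
  congr (\tr (frobenius_iter_mx _ _ _) * _); rewrite -map_mx_comp.
  by apply/matrixP => i l; rewrite !mxE; apply: tRE.
have sumX := SXE j sX hj; have sumA := SAE j
  (fun u => \tr (frobenius_iter_mx (csg c) (map_mx (tA u) C') j)) hj.
apply: (unr_inj (c_unr c)); rewrite {}sumA; last first.
  move=> u P t hP _ ht; congr (\tr (frobenius_iter_mx _ _ _)).
  have ht' : is_teich (PA u) t.
    have [tV tr tF] := ht; split=> // w.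
    by rewrite tr (point_unique (@affR_surj _ _ S (d + s)) hP (PAE u)).
  apply/matrixP => i l; rewrite !mxE.
  exact: (teich_unique (@affR_kernel _ _ S (d + s)) (affR_pi S (d + s)) (tAE u) ht').
rewrite rmorphM rmorphXn rmorph_nat {}sumX; last first.
  move=> v P t [PX PC] _ [tV tr tF]; congr (\tr (frobenius_iter_mx _ _ _)).
  rewrite -hC0 -map_mx_comp; apply/matrixP => i l; rewrite !mxE.
  have ht : is_teich (PR v) (t \o mu).
    apply: (aff_teich (PRE v)) => [x|w|l'] /=.
    - by rewrite hmu /affC /= hXC tV.
    - by rewrite hmuF tF.
    - by rewrite hmu tr dagger_red; apply: PX.
  exact: (teich_unique (@affR_kernel _ _ S d) (affR_pi S d) (tRT v 0) ht).
pose fix_d (v : {ffun 'I_d -> cL c}) := [forall i, v i ^+ ((p ^ a) ^ j) == v i].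
pose fix_s (w : {ffun 'I_s -> cL c}) := [forall i, w i ^+ ((p ^ a) ^ j) == w i].
rewrite (@sum_join _ _ S n c d s _ fix_d fix_s); last first.
  move=> v w; rewrite asboolT /=; last by exists (PA (join v w)).
  apply/forallP/andP => [hu|[/forallP hv /forallP hw] l].
    split; apply/forallP => l.
      by have := hu (lshift s l); rewrite join_l.
    by have := hu (rshift d l); rewrite join_r.
  by rewrite -[l]splitK; case: (split l) => l'; rewrite /= ?join_l ?join_r.
rewrite mulr_sumr [RHS]big_mkcond /= [LHS]big_mkcond /=; apply: eq_bigr => v _.
rewrite -/(fix_d v) andbC; case: (boolP (fix_d v)) => //= /forallP fv.
rewrite (eq_bigr (fun w => sX v * chi v w)) => [|w _]; last exact: traceA.
rewrite -mulr_sumr (dwork_fibre_sum hpistar etaE hpr hprF hyF hE PAE tAE PRE hj);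
  last by move=> l; apply/eqP.
have zP := point_of_zero hA hA0 (PRE v).
have -> : [forall i, PR v (affR S d (f i)) == 0] =
    `[< exists P : {rmorphism A0 -> cL c}, is_point (rA \o h) v P >].
  apply/forallP/asboolP => [h0|/zP h0 i]; last exact/eqP.
  by apply/zP => i; apply/eqP.
case: asboolP => _; last by rewrite mulr0.
by rewrite mulrC -natrX expnAC.
Qed.
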